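(* Let $M$ be a manifold of real dimension $4$ and $L\subset M$ a surface. Among all almost complex structures $J$ on $M$ for which $L$ is a pseudoholomorphic curve, the set of those $J$ for which the germ of $(M,J)$ along $L$ is isomorphic to the germ along the zero section $L\subset N_LM$ of the normal bundle with its canonical NB-II almost complex structure $\check J$ has infinite codimension.
   Context: $L$ is a pseudoholomorphic curve in $(M,J)$ if $TL$ is $J$-invariant. An isomorphism of germs is a diffeomorphism between neighborhoods of $L$ in $M$ and in $N_LM$, preserving $L$ and intertwining the almost complex structures. NB-II structure $\check J$ on $N_LM=TM|_L/TL$: fix a $J$-invariant subbundle $F\subset TM|_L$ with $TL\oplus F=TM|_L$, identify $F\simeq N_LM$, fix an almost complex connection ($\nabla J=0$) with torsion $\frac14N_J$ ($N_J(X,Y)=[JX,JY]-J[JX,Y]-J[X,JY]-[X,Y]$) for which $L$ is totally geodesic, and let $\varphi$ be its exponential map from a neighborhood of the zero section of $F$ to a neighborhood of $L$ in $M$. With $R^t:v\mapsto tv$ the fiberwise dilatation, $\check J=\lim_{t\to0}R^{1/t}_*(\varphi_*^{-1}J\varphi_* )R^t_*$; this does not depend on the choices. A condition on almost complex structures $J$ (with $L$ pseudoholomorphic) has infinite codimension if, for $x\in L$, the $m$-jets at $x$ of structures satisfying it are contained in subsets of the space of all $m$-jets at $x$ of such structures whose codimension tends to infinity as $m\to\infty$. *)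

(* Defs.v *)
(* MathComp-Analysis.  Points of R^n are row vectors, so a linear map acts on
   the right: the differential of f at y sends v to v *m jacobian f y. *)
From HB Require Import structures.
From mathcomp Require Import all_boot all_order all_algebra.
From mathcomp Require Import all_classical all_reals all_analysis.
Set Implicit Arguments.
Unset Strict Implicit.
Unset Printing Implicit Defensive.
Import Order.TTheory GRing.Theory Num.Theory.
Import numFieldNormedType.Exports.
Local Open Scope classical_set_scope.
Local Open Scope ring_scope.

(** * Smooth maps between Euclidean spaces *)

Fixpoint partials (R : realType) n (s : seq 'I_n) (f : 'rV[R]_n -> R) :
    'rV[R]_n -> R :=
  if s is i :: s' then fun y => 'D_(delta_mx 0 i) (partials s' f) y else f.

(* C^oo on an open set U; only the values of f on U matter. *)
Definition smooth_on (R : realType) n p q (U : set 'rV[R]_n)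
    (f : 'rV[R]_n -> 'M[R]_(p, q)) : Prop :=
  forall (i : 'I_p) (j : 'I_q) (s : seq 'I_n) y, U y ->
    differentiable (partials s (fun z => f z i j)) y.

(** * Smooth manifolds *)

(* [fwd] is meaningful on [dom] only, and [bwd] on the image of [dom] only. *)
Record chart (R : realType) (n : nat) (T : Type) := Chart {
  dom : set T;
  fwd : T -> 'rV[R]_n;
  bwd : 'rV[R]_n -> T }.

Definition cimg (R : realType) n T (c : chart R n T) (U : set T) :
    set 'rV[R]_n := fwd c @` (U `&` dom c).

Definition is_chart (R : realType) n T (c : chart R n T) : Prop :=
  open (cimg c setT) /\ (forall p, dom c p -> bwd c (fwd c p) = p).

(* the change of coordinates from c to c' *)
Definition transition (R : realType) n T (c c' : chart R n T) :
    'rV[R]_n -> 'rV[R]_n := fun y => fwd c' (bwd c y).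

Definition compatible (R : realType) n T (c c' : chart R n T) : Prop :=
  open (cimg c (dom c')) /\ smooth_on (cimg c (dom c')) (transition c c').

Definition mopen (R : realType) n T (A : set (chart R n T)) (U : set T) : Prop :=
  (forall p, U p -> exists2 c, A c & dom c p) /\
  (forall c, A c -> open (cimg c U)).

(* A is the maximal atlas of a Hausdorff, second countable smooth n-manifold
   with set of points T; the topology is the one defined by the charts. *)
Definition smooth_manifold (R : realType) n T (A : set (chart R n T)) : Prop :=
  [/\ forall p, exists2 c, A c & dom c p,
      forall c, A c <-> is_chart c /\
        (forall c', A c' -> compatible c c' /\ compatible c' c),
      forall p q, p <> q -> exists U V,
        [/\ mopen A U, mopen A V, U p, V q & U `&` V = set0]
    & exists B : nat -> set T, (forall k, mopen A (B k)) /\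
        (forall U p, mopen A U -> U p -> exists k, B k p /\ B k `<=` U)].

Definition smooth_map (R : realType) n n' T T' (A : set (chart R n T))
    (A' : set (chart R n' T')) (U : set T) (f : T -> T') : Prop :=
  forall c c' p, A c -> A' c' -> U p -> dom c p -> dom c' (f p) ->
    exists O : set 'rV[R]_n,
      [/\ open O, O (fwd c p), O `<=` cimg c U,
          forall y, O y -> dom c' (f (bwd c y))
        & smooth_on O (fun y => fwd c' (f (bwd c y)))].

Definition diffeo (R : realType) n n' T T' (A : set (chart R n T))
    (A' : set (chart R n' T')) (U : set T) (V : set T') (f : T -> T') : Prop :=
  [/\ mopen A U, mopen A' V, smooth_map A A' U f
    & exists g : T' -> T,
      [/\ smooth_map A' A V g,
          forall p, U p -> V (f p) /\ g (f p) = p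
        & forall q, V q -> U (g q) /\ f (g q) = q]].

(* A tangent vector is the family of its coordinates in all charts around its
   base point; it is set to 0 in the other charts so that equality of tangent
   vectors is equality of families. *)
Definition tvec (R : realType) n T := chart R n T -> 'rV[R]_n.

Definition tangent (R : realType) n T (A : set (chart R n T)) (p : T) :
    set (tvec R n T) :=
  [set v | (forall c c', A c -> A c' -> dom c p -> dom c' p ->
              v c' = v c *m jacobian (transition c c') (fwd c p)) /\
           (forall c, ~ (A c /\ dom c p) -> v c = 0)].

(** * Almost complex structures *)

(* a field of endomorphisms of the tangent spaces: its matrix in each chart *)
Definition endo (R : realType) n T := chart R n T -> T -> 'M[R]_n.

Definition app_endo (R : realType) n T (J : endo R n T) (p : T)
    (v : tvec R n T) : tvec R n T := fun c => v c *m J c p.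

Definition almost_complex (R : realType) n T (A : set (chart R n T))
    (U : set T) (J : endo R n T) : Prop :=
  [/\ forall c, A c -> smooth_on (cimg c U) (fun y => J c (bwd c y)),
      forall c c' p, A c -> A c' -> U p -> dom c p -> dom c' p ->
        J c p *m jacobian (transition c c') (fwd c p) =
        jacobian (transition c c') (fwd c p) *m J c' p
    & forall c p, A c -> U p -> dom c p -> J c p *m J c p = - 1%:M].

(* df o J = J' o df on U *)
Definition intertwines (R : realType) n n' T T' (A : set (chart R n T))
    (A' : set (chart R n' T')) (U : set T) (f : T -> T')
    (J : endo R n T) (J' : endo R n' T') : Prop :=
  forall c c' p, A c -> A' c' -> U p -> dom c p -> dom c' (f p) ->
    let D := jacobian (fun y => fwd c' (f (bwd c y))) (fwd c p) in
    J c p *m D = D *m J' c' (f p).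

(** * Surfaces in 4-manifolds *)

Definition fst2 (R : realType) (v : 'rV[R]_4) : 'rV[R]_2 :=
  @lsubmx R 1 2 2 v.
Definition snd2 (R : realType) (v : 'rV[R]_4) : 'rV[R]_2 :=
  @rsubmx R 1 2 2 v.
Definition pair2 (R : realType) (a b : 'rV[R]_2) : 'rV[R]_4 :=
  @row_mx R 1 2 2 a b.

(* charts (x1, x2, y1, y2) in which L is given by y1 = y2 = 0 *)
Definition adapted (R : realType) T (A : set (chart R 4 T)) (L : set T)
    (c : chart R 4 T) : Prop :=
  A c /\ forall p, dom c p -> (L p <-> snd2 (fwd c p) = 0).

Definition surface (R : realType) T (A : set (chart R 4 T)) (L : set T) : Prop :=
  forall x, L x -> exists2 c, adapted A L c & dom c x.

Definition tangent_sub (R : realType) T (A : set (chart R 4 T)) (L : set T)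
    (x : T) : set (tvec R 4 T) :=
  [set v | tangent A x v /\
           forall c, adapted A L c -> dom c x -> snd2 (v c) = 0].

Definition pseudoholomorphic (R : realType) T (A : set (chart R 4 T))
    (L U : set T) (J : endo R 4 T) : Prop :=
  forall x v, L x -> U x -> tangent_sub A L x v ->
    tangent_sub A L x (app_endo J x v).

(** * The normal bundle *)

(* T_x M / T_x L, a coset being a set of tangent vectors *)
Definition normal_space (R : realType) T (A : set (chart R 4 T)) (L : set T)
    (x : T) : set (set (tvec R 4 T)) :=
  [set nu | exists2 v, tangent A x v &
            nu = [set v + u | u in tangent_sub A L x]].

Definition nbpoint (R : realType) T : Type := (T * set (tvec R 4 T))%type.

Definition normal_bundle (R : realType) T (A : set (chart R 4 T)) (L : set T) :
    set (nbpoint R T) :=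
  [set q | L q.1 /\ normal_space A L q.1 q.2].

(* The bundle chart of N_L M defined by an adapted chart (x, y): the class of v
   at p has coordinates (x(p), dy(v)), which do not depend on the
   representative v of the class. *)
Definition normal_chart (R : realType) T (A : set (chart R 4 T)) (L : set T)
    (c : chart R 4 T) : chart R 4 (nbpoint R T) :=
  {| dom := [set q | normal_bundle A L q /\ dom c q.1];
     fwd := fun q => pair2 (fst2 (fwd c q.1))
       (xget 0 [set w | forall v, q.2 v -> snd2 (v c) = w]);
     bwd := fun z => let x := bwd c (pair2 (fst2 z) 0) in
       (x, [set v | tangent A x v /\ snd2 (v c) = snd2 z]) |}.

Definition normal_atlas (R : realType) T (A : set (chart R 4 T)) (L : set T) :
    set (chart R 4 (nbpoint R T)) :=
  [set normal_chart A L c | c in adapted A L].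

Definition zero_section (R : realType) T (A : set (chart R 4 T)) (L : set T) :
    set (nbpoint R T) :=
  [set (x, tangent_sub A L x) | x in L].

(* the fiberwise dilatation; adding T_x L only matters for t = 0 *)
Definition dilatation (R : realType) T (A : set (chart R 4 T)) (L : set T)
    (t : R) (q : nbpoint R T) : nbpoint R T :=
  (q.1, [set t *: v + u | v in q.2 & u in tangent_sub A L q.1]).

(** * Linear connections *)

(* Gam c p i is the matrix of the connection form in the chart c, evaluated on
   the i-th coordinate vector: (Gam c p i) j k = Gamma^k_ij. *)
Definition christoffel (R : realType) n T :=
  chart R n T -> T -> 'I_n -> 'M[R]_n.

Definition connection_on (R : realType) n T (A : set (chart R n T)) (O : set T)
    (Gam : christoffel R n T) : Prop :=
  (forall c i, A c -> smooth_on (cimg c O) (fun y => Gam c (bwd c y) i)) /\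
  (forall c c' p i, A c -> A c' -> O p -> dom c p -> dom c' p ->
     let D := jacobian (transition c c') in
     Gam c p i *m D (fwd c p) =
     'D_(delta_mx 0 i) D (fwd c p) +
     D (fwd c p) *m \sum_j D (fwd c p) i j *: Gam c' p j).

(* nabla_X Y in the coordinates of c *)
Definition nabla (R : realType) n T (Gam : christoffel R n T)
    (c : chart R n T) (X Y : 'rV[R]_n -> 'rV[R]_n) : 'rV[R]_n -> 'rV[R]_n :=
  fun y => 'D_(X y) Y y + Y y *m \sum_i X y 0 i *: Gam c (bwd c y) i.

Definition lie (R : realType) n (X Y : 'rV[R]_n -> 'rV[R]_n) :
    'rV[R]_n -> 'rV[R]_n := fun y => 'D_(X y) Y y - 'D_(Y y) X y.

Definition app_field (R : realType) n T (J : endo R n T) (c : chart R n T)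
    (X : 'rV[R]_n -> 'rV[R]_n) : 'rV[R]_n -> 'rV[R]_n :=
  fun y => X y *m J c (bwd c y).

Definition nijenhuis (R : realType) n T (J : endo R n T) (c : chart R n T)
    (X Y : 'rV[R]_n -> 'rV[R]_n) : 'rV[R]_n -> 'rV[R]_n :=
  fun y => let JJ := app_field J c in
    lie (JJ X) (JJ Y) y - JJ (lie (JJ X) Y) y - JJ (lie X (JJ Y)) y - lie X Y y.

Definition almost_complex_connection (R : realType) n T (A : set (chart R n T))
    (O : set T) (J : endo R n T) (Gam : christoffel R n T) : Prop :=
  forall c X Y y, A c -> smooth_on (cimg c O) X -> smooth_on (cimg c O) Y ->
    cimg c O y ->
    nabla Gam c X (app_field J c Y) y = app_field J c (nabla Gam c X Y) y.

Definition torsion_nijenhuis (R : realType) n T (A : set (chart R n T))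
    (O : set T) (J : endo R n T) (Gam : christoffel R n T) : Prop :=
  forall c X Y y, A c -> smooth_on (cimg c O) X -> smooth_on (cimg c O) Y ->
    cimg c O y ->
    nabla Gam c X Y y - nabla Gam c Y X y - lie X Y y =
    4^-1 *: nijenhuis J c X Y y.

(* nabla_X Y is tangent to L along L whenever X and Y are *)
Definition totally_geodesic (R : realType) T (A : set (chart R 4 T))
    (L O : set T) (Gam : christoffel R 4 T) : Prop :=
  forall c X Y, adapted A L c ->
    smooth_on (cimg c O) X -> smooth_on (cimg c O) Y ->
    (forall y, cimg c (O `&` L) y -> snd2 (X y) = 0 /\ snd2 (Y y) = 0) ->
    forall y, cimg c (O `&` L) y -> snd2 (nabla Gam c X Y y) = 0.

(* a geodesic in O parametrized by (a neighborhood of) [0, 1] *)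
Definition geodesic (R : realType) n T (A : set (chart R n T)) (O : set T)
    (Gam : christoffel R n T) (gam : R -> T) : Prop :=
  forall t : R, 0 <= t <= 1 -> O (gam t) /\
    forall c, A c -> dom c (gam t) ->
    let u := fun s : R => fwd c (gam s) in
    [/\ \forall s \near t, dom c (gam s),
        \forall s \near t, derivable u s 1,
        derivable (derive1 u) t 1
      & derive1 (derive1 u) t +
        derive1 u t *m (\sum_i derive1 u t 0 i *: Gam c (gam t) i) = 0].

(** * The NB-II structure on the normal bundle *)

(* a J-invariant smooth rank 2 subbundle F of TM|_L, complementary to TL *)
Definition invariant_complement (R : realType) T (A : set (chart R 4 T))
    (L : set T) (J : endo R 4 T) (F : T -> set (tvec R 4 T)) : Prop :=
  [/\ forall x, L x -> exists c, exists e : 'rV[R]_4 -> 'M[R]_(2, 4),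
        [/\ A c, dom c x, smooth_on (cimg c setT) e &
            forall x', L x' -> dom c x' -> \rank (e (fwd c x')) = 2%N /\
              F x' = [set v | tangent A x' v /\ (v c <= e (fwd c x'))%MS]],
      forall x, L x -> tangent_sub A L x `&` F x = [set 0],
      forall x, L x ->
        tangent A x = [set u + w | u in tangent_sub A L x & w in F x]
    & forall x v, L x -> F x v -> F x (app_endo J x v)].

(* phi is the exponential map of the connection on F, viewed as a map from the
   neighborhood W of the zero section of N_L M: the vector of F representing
   the class nu at x is the unique element of nu lying in F x. *)
Definition is_exponential (R : realType) T (A : set (chart R 4 T)) (O : set T)
    (Gam : christoffel R 4 T) (F : T -> set (tvec R 4 T))
    (W : set (nbpoint R T)) (phi : nbpoint R T -> T) : Prop :=
  forall x nu, W (x, nu) -> exists v, exists gam : R -> T,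
    [/\ nu v, F x v, geodesic A O Gam gam, gam 0 = x /\ gam 1 = phi (x, nu) &
        forall c, A c -> dom c x -> derive1 (fun s => fwd c (gam s)) 0 = v c].

(* the matrix in the chart b, at q, of R^{1/t}_* J' R^t_* *)
Definition rescaled (R : realType) T (A : set (chart R 4 T)) (L : set T)
    (J' : endo R 4 (nbpoint R T)) (t : R) : endo R 4 (nbpoint R T) :=
  fun b q => let q' := dilatation A L t q in
    jacobian (fun z => fwd b (dilatation A L t (bwd b z))) (fwd b q) *m
    J' b q' *m
    jacobian (fun z => fwd b (dilatation A L t^-1 (bwd b z))) (fwd b q').

(* J' is the pull-back of J by phi; the connection is only needed on a
   neighborhood O of L. *)
Definition is_NBII (R : realType) T (A : set (chart R 4 T)) (L : set T)
    (J : endo R 4 T) (Jc : endo R 4 (nbpoint R T)) : Prop :=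
  let B := normal_atlas A L in
  almost_complex B (normal_bundle A L) Jc /\
  exists F O Gam W phi (J' : endo R 4 (nbpoint R T)),
    [/\ invariant_complement A L J F,
        mopen A O /\ L `<=` O,
        [/\ connection_on A O Gam, almost_complex_connection A O J Gam,
            torsion_nijenhuis A O J Gam & totally_geodesic A L O Gam],
        [/\ zero_section A L `<=` W, diffeo B A W (phi @` W) phi
          & is_exponential A O Gam F W phi]
      & almost_complex B W J' /\ intertwines B A W phi J' J /\
        forall b q, B b -> dom b q ->
          (fun t => rescaled A L J' t b q) @ (0 : R)^' --> Jc b q].

(* the germs of (M, J) along L and of (N_L M, J') along the zero section are
   isomorphic *)
Definition germ_isomorphic (R : realType) T (A : set (chart R 4 T)) (L : set T)
    (J : endo R 4 T) (J' : endo R 4 (nbpoint R T)) : Prop :=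
  exists U V Psi,
    [/\ L `<=` U, zero_section A L `<=` V,
        diffeo A (normal_atlas A L) U V Psi,
        Psi @` L = zero_section A L
      & intertwines A (normal_atlas A L) U Psi J J'].

(** * Jets and codimension *)

(* multi-indices of order at most m in n variables *)
Definition multi_index (n m : nat) : finType :=
  {a : {ffun 'I_n -> 'I_m.+1} | (\sum_(i < n) a i <= m)%N}.

Definition word (n m : nat) (a : multi_index n m) : seq 'I_n :=
  flatten [seq nseq (val a i) i | i <- enum 'I_n].

Definition jet_index (n m : nat) : finType := (multi_index n m * ('I_n * 'I_n))%type.

Definition jet_space (R : realType) (n m : nat) := 'rV[R]_#|jet_index n m|.

(* the m-jet of J at x: all partial derivatives of order at most m of the
   entries of its matrix, in the chart c *)
Definition jet (R : realType) n T (m : nat) (c : chart R n T) (J : endo R n T)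
    (x : T) : jet_space R n m :=
  \row_k let: (a, (i, j)) := enum_val k in
    partials (word a) (fun y => J c (bwd c y) i j) (fwd c x).

(* the space of m-jets at x of the almost complex structures (defined near x)
   for which L is pseudoholomorphic *)
Definition ac_jets (R : realType) T (A : set (chart R 4 T)) (L : set T)
    (m : nat) (c : chart R 4 T) (x : T) : set (jet_space R 4 m) :=
  [set jt | exists U J, [/\ mopen A U, U x, almost_complex A U J,
     pseudoholomorphic A L U J & jt = jet m c J x]].

(* embedded d-dimensional submanifold of R^N: locally diffeomorphic to an open
   subset of R^d, where rho is a local smooth extension of the inverse of psi *)
Definition submanifold (R : realType) N (d : nat) (X : set 'rV[R]_N) : Prop :=
  forall p, X p -> exists (U : set 'rV[R]_N) (V : set 'rV[R]_d) psi rho,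
    [/\ open U /\ U p, open V, smooth_on V psi, smooth_on U rho &
        (forall z, V z -> [/\ X (psi z), U (psi z) & rho (psi z) = z]) /\
        (forall y, X y -> U y -> V (rho y) /\ psi (rho y) = y)].

(* S has dimension at most e: it is contained in the image of a smooth map from
   an e-dimensional manifold, written as a countable union of chart domains *)
Definition dim_le (R : realType) N (e : nat) (S : set 'rV[R]_N) : Prop :=
  exists (V : nat -> set 'rV[R]_e) (f : nat -> 'rV[R]_e -> 'rV[R]_N),
    (forall i, open (V i) /\ smooth_on (V i) (f i)) /\
    S `<=` \bigcup_i (f i @` V i).

Definition codim_ge (R : realType) N (X S : set 'rV[R]_N) (k : nat) : Prop :=
  exists d e, [/\ submanifold d X, dim_le e S & (e + k <= d)%N].

(* The condition P on almost complex structures for which L is pseudoholomorphic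
   has infinite codimension. Jets are written in charts adapted to L. *)
Definition infinite_codimension (R : realType) T (A : set (chart R 4 T))
    (L : set T) (P : endo R 4 T -> Prop) : Prop :=
  forall x c, L x -> adapted A L c -> dom c x ->
  exists S : forall m, set (jet_space R 4 m),
    [/\ forall m, S m `<=` ac_jets A L c x,
        forall m J, almost_complex A setT J -> pseudoholomorphic A L setT J ->
          P J -> S m (jet m c J x)
      & forall k, \forall m \near \oo, codim_ge (ac_jets A L c x) (S m) k].

(* Main.v *)
(* Read in the bundle chart of N_L M defined by an adapted chart, the dilatation
   is (x, w) |-> (x, t w).  If the limit of the rescaled structures exists, its
   diagonal blocks depend on x only, the block mapping TL to the fibers is
   linear in w, and the opposite block vanishes; all its partial derivatives
   involving two fiber directions are therefore zero, and its m-jet has only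
   O(m^2) free coefficients.  If J is conjugate to such a
   structure by a germ of diffeomorphism, then the m-jet of
   J is a smooth function of these coefficients and of the (m+1)-jet of the
   diffeomorphism, hence of 4 C(m+5, 4) + O(m^2) parameters.  On the other hand,
   in a complex frame the structures J form a Cayley chart
   J = J0 (1 - K) (1 + K)^-1 with K antilinear, so the m-jets of structures for
   which L is pseudoholomorphic form a submanifold of dimension
   8 C(m+4, 4) - O(m^2).  The difference of the dimensions grows like m^4 / 6. *)

Require Import Defs.
From mathcomp Require Import all_boot all_order all_algebra.
From mathcomp Require Import all_classical all_reals all_analysis.
From mathcomp Require Import ring lra zify.
Set Implicit Arguments.
Unset Strict Implicit.
Unset Printing Implicit Defensive.
Import Order.TTheory GRing.Theory Num.Theory.
Import numFieldNormedType.Exports.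
Local Open Scope classical_set_scope.
Local Open Scope ring_scope.

(** * Calculus of iterated partial derivatives *)

(** The unknown diffeomorphism germ ranges over an infinite-dimensional space, but an m-jet only
    sees finitely many of its derivatives. Jets are therefore handled by congruence: a germ is
    congruent to its Taylor polynomial, and products, inverses, composites and Jacobians respect the
    congruence. Once every germ is replaced by a polynomial, its coefficients can be treated as
    additional variables beside the point. A jet then consists of partial derivatives, in the point
    variables, of one smooth function on the product space, so its smooth dependence on the
    coefficients needs no explicit formula for the jet of a composite or of an inverse. The same
    device makes the Cayley transform act on jets. This transform is chosen for two reasons: it
    turns the quadratic equation J^2 = -1 into the linear equation of anticommutation with J0, and,
    being rational, it preserves the algebra of matrices that map the tangent plane of L to itself.
    Both conditions on J thus become linear conditions on Taylor coefficients, where dimensions can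
    be counted: an antilinear K has 8 free entries, against 4 components for a map. *)

(** The difference [g - f] vanishes near [x], hence is differentiable there with zero
    differential. *)
Lemma near_eq_differentiable (R : numFieldType) (V W : normedModType R)
    (f g : V -> W) (x : V) :
  (\forall y \near x, f y = g y) -> differentiable f x -> differentiable g x.
Proof.
move=> fg df.
suff d0 : differentiable (g - f) x.
  by rewrite -[g](subrK f); exact: differentiableD.
pose z : {linear V -> W} := \0.
have zc : continuous (z : V -> W) by move=> y; exact: cst_continuous.
have gf0 : (g - f) x = 0 by rewrite !fctE (nbhs_singleton fg) subrr.
have zE : (g - f) \o shift x = cst ((g - f) x) + z +o_ 0 id.
  apply/eqaddoP => e e0; rewrite gf0.
  have : \forall h \near (0 : V), f (h + x) = g (h + x).
    by move: fg; rewrite (near_shift 0 x); apply: filterS => h /=; rewrite subr0.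
  apply: filterS => h hE.
  by rewrite !fctE /= hE subrr addr0 subr0 normr0 mulr_ge0 // ltW.
apply/diff_locallyP; split; rewrite (diff_unique zc zE) //.
Qed.

Lemma open_near (T : topologicalType) (U : set T) (y : T) : open U -> U y -> \near y, U y.
Proof. by move=> oU Uy; exact: open_nbhs_nbhs. Qed.

Section words.
Context {R : realType} {n : nat}.
Implicit Types (f g : 'rV[R]_n -> R) (s t : seq 'I_n) (y : 'rV[R]_n) (U : set 'rV[R]_n).

Lemma partials_cat s t f : partials (s ++ t) f = partials s (partials t f).
Proof. by elim: s => //= i s ->. Qed.

Lemma partials_rcons s i f :
  partials (rcons s i) f = partials s ('D_(delta_mx 0 i) f).
Proof. by rewrite -cats1 partials_cat. Qed.

Lemma derive_on_open (W : normedModType R) U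
    (f g : 'rV[R]_n -> W) (v : 'rV[R]_n) y :
  open U -> U y -> (forall z, U z -> f z = g z) -> 'D_v f y = 'D_v g y.
Proof.
move=> oU Uy fg; apply: near_eq_derive; apply: filterS (open_near oU Uy) => z.
exact: fg.
Qed.

Lemma partials_on_open U f g s y :
  open U -> U y -> (forall z, U z -> f z = g z) -> partials s f y = partials s g y.
Proof.
move=> oU Uy fg; elim: s y Uy => [|i s IHs] y Uy /=; first exact: fg.
exact: (derive_on_open _ oU).
Qed.

End words.

Section smooth_scalar.
Context {R : realType}.

(* Smoothness of order k is what inductions on the derivatives run on. *)
Definition Ck n k (U : set 'rV[R]_n) (f : 'rV[R]_n -> R) : Prop :=
  forall s y, (size s <= k)%N -> U y -> differentiable (partials s f) y.

Definition smooth n (U : set 'rV[R]_n) (f : 'rV[R]_n -> R) : Prop :=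
  forall s y, U y -> differentiable (partials s f) y.

Lemma smoothP n (U : set 'rV[R]_n) (f : 'rV[R]_n -> R) : smooth U f <-> forall k, Ck k U f.
Proof. by split=> [h k s y _|h s y]; [exact: h|exact: (h (size s))]. Qed.

(** [partials] applies the last letter of a word first, so removing that letter replaces [f] by one
    of its first derivatives. The rules for products, inverses and composites are proved by
    induction along this step. *)
Lemma CkS n k (U : set 'rV[R]_n) (f : 'rV[R]_n -> R) : Ck k.+1 U f <->
  (forall y, U y -> differentiable f y) /\
  forall i, Ck k U ('D_(delta_mx 0 i) f).
Proof.
split=> [h|[h0 h]].
  split=> [y|i s y sk]; first exact: (h [::]).
  by rewrite -partials_rcons; apply: h; rewrite size_rcons.
elim/last_ind => [|s i _] y; first by move=> _; exact: h0.
by rewrite size_rcons ltnS partials_rcons; exact: h.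
Qed.

Lemma Ck_weak n k l (U : set 'rV[R]_n) (f : 'rV[R]_n -> R) : (k <= l)%N -> Ck l U f -> Ck k U f.
Proof. by move=> kl h s y sk; apply: h; exact: leq_trans kl. Qed.

Lemma Ck_diff n k (U : set 'rV[R]_n) (f : 'rV[R]_n -> R) (y : 'rV[R]_n) : Ck k U f -> U y -> differentiable f y.
Proof. by move=> h; exact: (h [::]). Qed.

Lemma smooth_diff n (U : set 'rV[R]_n) (f : 'rV[R]_n -> R) (y : 'rV[R]_n) : smooth U f -> U y -> differentiable f y.
Proof. by move=> h; exact: (h [::]). Qed.

Lemma Ck_eq n k (U : set 'rV[R]_n) (f g : 'rV[R]_n -> R) : open U -> (forall y, U y -> f y = g y) ->
  Ck k U f -> Ck k U g.
Proof.
move=> oU fg h s y sk Uy; apply: near_eq_differentiable (h s y sk Uy).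
by apply: filterS (open_near oU Uy) => z Uz; exact: partials_on_open fg.
Qed.

Lemma smooth_eq n (U : set 'rV[R]_n) (f g : 'rV[R]_n -> R) : open U -> (forall y, U y -> f y = g y) ->
  smooth U f -> smooth U g.
Proof.
by move=> oU fg /smoothP h; apply/smoothP => k; apply: Ck_eq (h k).
Qed.

Lemma smooth_sub n (U V : set 'rV[R]_n) (f : 'rV[R]_n -> R) : V `<=` U -> smooth U f -> smooth V f.
Proof. by move=> VU h s y Vy; apply: h; exact: VU. Qed.

Lemma smooth_partials n (U : set 'rV[R]_n) (f : 'rV[R]_n -> R) (s : seq 'I_n) : smooth U f -> smooth U (partials s f).
Proof. by move=> h t y Uy; rewrite -partials_cat; exact: h. Qed.

Lemma smooth_D n (U : set 'rV[R]_n) (f : 'rV[R]_n -> R) (i : 'I_n) :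
  smooth U f -> smooth U ('D_(delta_mx 0 i) f).
Proof. by move=> h; exact: (smooth_partials [:: i]). Qed.

Lemma Ck_cst n k U (a : R) : @Ck n k U (cst a).
Proof.
elim: k a => [|k IHk] a.
  by case=> // y _ _; exact: differentiable_cst.
apply/CkS; split=> [y _|i]; first exact: differentiable_cst.
rewrite (_ : 'D_(delta_mx 0 i) _ = cst 0) //.
by apply/funext => y; rewrite derive_cst.
Qed.

Lemma smooth_cst n U (a : R) : @smooth n (U : set 'rV[R]_n) (fun=> a).
Proof. by apply/smoothP => k; exact: Ck_cst. Qed.

Lemma derive_coord n (v : 'rV[R]_n) (j : 'I_n) (y : 'rV[R]_n) :
  'D_v (fun z : 'rV[R]_n => z 0 j) y = v 0 j.
Proof.
rewrite deriveE; last exact: differentiable_coord.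
have @f : {linear 'rV[R]_n -> R}.
  by exists (fun N : 'rV[R]_n => N 0 j); do 2![eexists]; do ?[constructor];
     rewrite ?mxE// => ? *; rewrite ?mxE//; move=> ?; rewrite !mxE.
by rewrite (_ : (fun _ => _) = f) // diff_lin //; exact: coord_continuous.
Qed.

Lemma smooth_coord n U j : @smooth n (U : set 'rV[R]_n) (fun z => z 0 j).
Proof.
apply/smoothP => -[|k].
  by case=> // y _ _; exact: differentiable_coord.
apply/CkS; split=> [y _|i]; first exact: differentiable_coord.
rewrite (_ : 'D_(delta_mx 0 i) _ = cst (@delta_mx R 1 n 0 i 0 j)); first exact: Ck_cst.
by apply/funext => y; rewrite derive_coord.
Qed.

Section openU.
Context n (U : set 'rV[R]_n) (oU : open U).
Implicit Types (f g : 'rV[R]_n -> R) (v y : 'rV[R]_n).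

Lemma derive_add f g v y : differentiable f y -> differentiable g y ->
  'D_v (fun z => f z + g z) y = 'D_v f y + 'D_v g y.
Proof. by move=> df dg; apply: (@deriveD _ _ _ f g); exact: diff_derivable. Qed.

Lemma derive_mul f g v y : differentiable f y -> differentiable g y ->
  'D_v (fun z => f z * g z) y = 'D_v f y * g y + f y * 'D_v g y.
Proof.
move=> df dg; rewrite [LHS](@deriveM _ _ f g); try exact: diff_derivable.
by rewrite addrC /GRing.scale /= [g y * _]mulrC.
Qed.

Lemma Ck_add k f g : Ck k U f -> Ck k U g -> Ck k U (fun z => f z + g z).
Proof.
elim: k f g => [|k IHk] f g Cf Cg.
  case=> // y _ Uy; apply: (@differentiableD _ _ _ f g); [exact: Ck_diff Cf _|exact: Ck_diff Cg _].
apply/CkS; split=> [y Uy|i].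
  by apply: (@differentiableD _ _ _ f g); [exact: Ck_diff Cf _|exact: Ck_diff Cg _].
move/CkS: Cf => [df Cf]; move/CkS: Cg => [dg Cg].
apply: (Ck_eq oU _ (IHk _ _ (Cf i) (Cg i))) => y Uy.
by rewrite derive_add //; [exact: df|exact: dg].
Qed.

Lemma Ck_mul k f g : Ck k U f -> Ck k U g -> Ck k U (fun z => f z * g z).
Proof.
elim: k f g => [|k IHk] f g Cf Cg.
  case=> // y _ Uy; apply: (@differentiableM _ _ f g); [exact: Ck_diff Cf _|exact: Ck_diff Cg _].
apply/CkS; split=> [y Uy|i].
  by apply: (@differentiableM _ _ f g); [exact: Ck_diff Cf _|exact: Ck_diff Cg _].
have Cf' := Ck_weak (leqnSn k) Cf; have Cg' := Ck_weak (leqnSn k) Cg.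
move/CkS: Cf => [df Cf]; move/CkS: Cg => [dg Cg].
apply: (Ck_eq oU _ (Ck_add (IHk _ _ (Cf i) Cg') (IHk _ _ Cf' (Cg i)))) => y Uy.
by rewrite derive_mul //; [exact: df|exact: dg].
Qed.

Lemma derive_inv f v y : differentiable f y -> f y != 0 ->
  'D_v (fun z => (f z)^-1) y = - 'D_v f y * ((f y)^-1 * (f y)^-1).
Proof.
move=> df f0; rewrite [LHS](@deriveV _ _ f) //; last exact: diff_derivable.
by rewrite /GRing.scale /= -exprVn expr2 mulNr mulrC mulNr.
Qed.

Lemma Ck_inv k f : (forall y, U y -> f y != 0) -> Ck k U f ->
  Ck k U (fun z => (f z)^-1).
Proof.
move=> f0; elim: k => [|k IHk] Cf.
  by case=> // y _ Uy; apply: differentiableV; [exact: Ck_diff Cf _|exact: f0].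
apply/CkS; split=> [y Uy|i].
  by apply: differentiableV; [exact: Ck_diff Cf _|exact: f0].
have CV := IHk (Ck_weak (leqnSn k) Cf).
move/CkS: Cf => [df Cf].
apply: (Ck_eq oU _ (Ck_mul (Ck_mul (@Ck_cst n k U (-1)) (Cf i)) (Ck_mul CV CV))) => y Uy.
by rewrite derive_inv ?mulN1r; [|exact: df|exact: f0].
Qed.

Lemma smooth_add f g : smooth U f -> smooth U g -> smooth U (fun z => f z + g z).
Proof. by move=> /smoothP hf /smoothP hg; apply/smoothP => k; exact: Ck_add. Qed.

Lemma smooth_mul f g : smooth U f -> smooth U g -> smooth U (fun z => f z * g z).
Proof. by move=> /smoothP hf /smoothP hg; apply/smoothP => k; exact: Ck_mul. Qed.

Lemma smooth_inv f : (forall y, U y -> f y != 0) -> smooth U f ->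
  smooth U (fun z => (f z)^-1).
Proof. by move=> f0 /smoothP hf; apply/smoothP => k; exact: Ck_inv. Qed.

Lemma smooth_opp f : smooth U f -> smooth U (fun z => - f z).
Proof.
move=> /(smooth_mul (@smooth_cst _ U (-1))); apply: smooth_eq => // y _.
by rewrite mulN1r.
Qed.

Lemma Ck_sum k I (r : seq I) (P : pred I) (F : I -> 'rV[R]_n -> R) :
  (forall i, P i -> Ck k U (F i)) -> Ck k U (fun z => \sum_(i <- r | P i) F i z).
Proof.
move=> sF; elim: r => [|i r IHr].
  by apply: (Ck_eq oU _ (@Ck_cst n k U 0)) => y _; rewrite big_nil.
have [Pi|nPi] := boolP (P i).
  by apply: (Ck_eq oU _ (Ck_add (sF _ Pi) IHr)) => y _; rewrite big_cons Pi.
by apply: (Ck_eq oU _ IHr) => y _; rewrite big_cons (negbTE nPi).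
Qed.

Lemma smooth_sum I (r : seq I) (P : pred I) (F : I -> 'rV[R]_n -> R) :
  (forall i, P i -> smooth U (F i)) -> smooth U (fun z => \sum_(i <- r | P i) F i z).
Proof.
move=> sF; apply/smoothP => k; apply: Ck_sum => i Pi.
by have /smoothP := sF _ Pi; exact.
Qed.

Lemma smooth_prod I (r : seq I) (P : pred I) (F : I -> 'rV[R]_n -> R) :
  (forall i, P i -> smooth U (F i)) -> smooth U (fun z => \prod_(i <- r | P i) F i z).
Proof.
move=> sF; elim: r => [|i r IHr].
  by apply: (smooth_eq oU _ (@smooth_cst _ U 1)) => y _; rewrite big_nil.
have [Pi|nPi] := boolP (P i).
  by apply: (smooth_eq oU _ (smooth_mul (sF _ Pi) IHr)) => y _; rewrite big_cons Pi.
by apply: (smooth_eq oU _ IHr) => y _; rewrite big_cons (negbTE nPi).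
Qed.

Lemma smooth_exp f k : smooth U f -> smooth U (fun z => f z ^+ k).
Proof.
move=> sf; elim: k => [|k IHk]; first exact: smooth_cst.
by apply: (smooth_eq oU _ (smooth_mul sf IHk)) => y _; rewrite exprS.
Qed.

End openU.
End smooth_scalar.

(** * Chain rule and Jacobians *)

Section chain_rule.
Context {R : realType}.

Lemma differentiable_row (V : normedModType R) n (f : V -> 'rV[R]_n) (x : V) :
  (forall j, differentiable (fun z => f z 0 j) x) -> differentiable f x.
Proof.
move=> df.
have -> : f = \sum_(j < n) (fun z => f z 0 j *: delta_mx 0 j).
  by apply/funext => z; rewrite fct_sumE -row_sum_delta.
by apply: differentiable_sum => j; apply: differentiableZl; exact: df.
Qed.

Lemma derive_row m n (f : 'rV[R]_m -> 'rV[R]_n) (v y : 'rV[R]_m) j : differentiable f y ->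
  'D_v f y 0 j = 'D_v (fun z => f z 0 j) y.
Proof. by move=> df; rewrite (derive_mx (diff_derivable df)) mxE. Qed.

Lemma jacobianE m n (f : 'rV[R]_m -> 'rV[R]_n) (y : 'rV[R]_m) (i : 'I_m) (j : 'I_n) : differentiable f y ->
  jacobian f y i j = 'D_(delta_mx 0 i) (fun z => f z 0 j) y.
Proof. by move=> df; rewrite -(derive_row _ _ df) (deriveEjacobian _ df) -rowE [RHS]mxE. Qed.

Lemma derive_sum_delta n (f : 'rV[R]_n -> R) (v y : 'rV[R]_n) : differentiable f y ->
  'D_v f y = \sum_j v 0 j * 'D_(delta_mx 0 j) f y.
Proof.
move=> df; rewrite deriveE // {1}(row_sum_delta v) linear_sum.
by apply: eq_bigr => j _; rewrite linearZ deriveE.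
Qed.

Lemma derive_comp m n (f : 'rV[R]_n -> R) (g : 'rV[R]_m -> 'rV[R]_n) (v y : 'rV[R]_m) :
  differentiable g y -> differentiable f (g y) ->
  'D_v (fun z => f (g z)) y =
  \sum_j 'D_(delta_mx 0 j) f (g y) * 'D_v (fun z => g z 0 j) y.
Proof.
move=> dg df.
have dfg : differentiable (f \o g) y by exact: differentiable_comp.
rewrite [LHS](deriveE _ dfg) diff_comp //= -(deriveE _ df) (derive_sum_delta _ df).
by apply: eq_bigr => j _; rewrite -(deriveE _ dg) derive_row // mulrC.
Qed.

Lemma jacobian_comp m n p (f : 'rV[R]_n -> 'rV[R]_p) (g : 'rV[R]_m -> 'rV[R]_n) (y : 'rV[R]_m) :
  differentiable g y -> differentiable f (g y) ->
  jacobian (fun z => f (g z)) y = jacobian g y *m jacobian f (g y).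
Proof.
move=> dg df; apply/row_matrixP => i; rewrite row_mul !rowE -mulmxA.
have dfg : differentiable (f \o g) y by exact: differentiable_comp.
rewrite -[LHS](deriveEjacobian _ dfg) (deriveE _ dfg) diff_comp //.
by rewrite mulmxA -!deriveEjacobian // !deriveE.
Qed.

Lemma jacobian_on_open m n (U : set 'rV[R]_m) (f g : 'rV[R]_m -> 'rV[R]_n) (y : 'rV[R]_m) : open U -> U y ->
  differentiable f y -> (forall z, U z -> f z = g z) -> jacobian f y = jacobian g y.
Proof.
move=> oU Uy df fg.
have dg : differentiable g y.
  by apply: near_eq_differentiable df; apply: filterS (open_near oU Uy).
apply/matrixP => i j; apply: etrans (jacobianE i j df) _.
apply: etrans _ (esym (jacobianE i j dg)).
by apply: (derive_on_open _ oU) => // z Uz; rewrite fg.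
Qed.

Lemma jacobian_id n (y : 'rV[R]_n) : jacobian id y = 1%:M.
Proof.
by apply/matrixP => i j; rewrite jacobianE // derive_coord !mxE eqxx eq_sym.
Qed.

(** The induction generalizes [f] and keeps [g]: by the chain rule, a derivative of the composite is
    a sum of products of a derivative of [f] composed with [g], covered by the induction hypothesis,
    and a derivative of a component of [g]. *)
Lemma Ck_comp m n k (U : set 'rV[R]_m) (V : set 'rV[R]_n) (f : 'rV[R]_n -> R) (g : 'rV[R]_m -> 'rV[R]_n) :
  open U -> open V -> (forall y, U y -> V (g y)) ->
  Ck k V f -> (forall j, Ck k U (fun z => g z 0 j)) -> Ck k U (fun z => f (g z)).
Proof.
move=> oU oV gUV; elim: k f => [|k IHk] f Cf Cg.
  case=> // y _ Uy; apply: (@differentiable_comp _ _ _ _ g f).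
    by apply: differentiable_row => j; exact: Ck_diff (Cg j) Uy.
  exact: Ck_diff Cf (gUV _ Uy).
have dg y : U y -> differentiable g y.
  by move=> Uy; apply: differentiable_row => j; exact: Ck_diff (Cg j) Uy.
have Cg' j := Ck_weak (leqnSn k) (Cg j).
have Cg1 j := ((CkS _ _ _).1 (Cg j)).2.
move/CkS: Cf => [df Cf].
apply/CkS; split=> [y Uy|i].
  by apply: (@differentiable_comp _ _ _ _ g f); [exact: dg|apply/df/gUV].
suff : Ck k U (fun y => \sum_j 'D_(delta_mx 0 j) f (g y) *
     'D_(delta_mx 0 i) (fun z => g z 0 j) y).
  apply: Ck_eq => // y Uy; rewrite derive_comp //; first exact: dg.
  by apply/df/gUV.
apply: (Ck_sum oU) => j _; apply: (Ck_mul oU); last exact: Cg1.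
by apply: (IHk ('D_(delta_mx 0 j) f)); [exact: Cf|exact: Cg'].
Qed.

Lemma smooth_comp m n (U : set 'rV[R]_m) (V : set 'rV[R]_n) (f : 'rV[R]_n -> R) (g : 'rV[R]_m -> 'rV[R]_n) :
  open U -> open V -> (forall y, U y -> V (g y)) ->
  smooth V f -> smooth_on U g -> smooth U (fun z => f (g z)).
Proof.
move=> oU oV gUV /smoothP sf sg; apply/smoothP => k.
by apply: (Ck_comp oU oV) => // j; have /smoothP := (sg 0 j : smooth _ _); exact.
Qed.

End chain_rule.

(** * Symmetry of second derivatives *)

Section schwarz.
Context {R : realType} {n : nat}.
Implicit Types (f : 'rV[R]_n -> R) (u v w y : 'rV[R]_n) (s t h : R) (U : set 'rV[R]_n) (i j : 'I_n).

Lemma is_derive_line f u w s : derivable f (s *: u + w) u ->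
  is_derive s 1 (fun t : R => f (t *: u + w)) ('D_u f (s *: u + w)).
Proof.
have E : (fun h : R => h^-1 *: (f ((h *: 1 + s) *: u + w) - f (s *: u + w))) =
         (fun h => h^-1 *: (f (h *: u + (s *: u + w)) - f (s *: u + w))).
  by apply/funext => h; rewrite scalerDl addrA [h *: 1]mulr1.
move=> df; apply: DeriveDef; rewrite /derivable /derive /= ?E //.
Qed.

Lemma MVT_line f u w h : 0 < h ->
  (forall s, 0 <= s <= h -> derivable f (s *: u + w) u) ->
  exists2 s, 0 <= s <= h & f (h *: u + w) - f w = h * 'D_u f (s *: u + w).
Proof.
move=> h0 df.
have dg s : s \in `[0, h]%R -> is_derive s 1 (fun t : R => f (t *: u + w)) ('D_u f (s *: u + w)).
  by rewrite in_itv /= => sh; apply/is_derive_line/df.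
pose F (t : R) := f (t *: u + w); pose dF (s : R) := 'D_u f (s *: u + w).
have dF0 s : s \in `]0, h[%R -> is_derive s 1 F (dF s).
  by move=> sh; apply: dg; apply: subset_itv_oo_cc sh.
have cF : {within `[0, h], continuous F}.
  by apply: derivable_within_continuous => s sh; have [] := dg s sh.
have [s sh E] := MVT h0 dF0 cF.
exists s; first by move: (subset_itv_oo_cc sh); rewrite in_itv.
by rewrite mulrC -/(dF s) -[X in _ * X](subr0 h) -E /F scale0r add0r.
Qed.

(** The mean value theorem is applied twice: along [u] to the increment [f (z + h *: v) - f z], then
    along [v] to ['D_u f]. *)
Lemma second_difference f u v y h : 0 < h ->
  (forall s t, 0 <= s <= h -> 0 <= t <= h ->
     derivable f (s *: u + (t *: v + y)) u /\
     differentiable ('D_u f) (s *: u + (t *: v + y))) ->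
  exists s t, [/\ 0 <= s <= h, 0 <= t <= h &
    f (h *: u + (h *: v + y)) - f (h *: u + y) - f (h *: v + y) + f y =
    h ^+ 2 * 'D_v ('D_u f) (s *: u + (t *: v + y))].
Proof.
move=> h0 df.
have h0h : 0 <= h <= h by rewrite lexx ltW.
have z0h : 0 <= (0 : R) <= h by rewrite lexx ltW.
pose g z := f (z + h *: v) - f z.
have dfv s (sh : 0 <= s <= h) : derivable (fun z => f (z + h *: v)) (s *: u + y) u.
  have [+ _] := df s h sh h0h; rewrite /derivable.
  rewrite (_ : (fun k => _) = (fun k => k^-1 *: (f (k *: u + (s *: u + y) + h *: v) - f (s *: u + y + h *: v)))) //.
  by apply/funext => k; rewrite -!addrA [h *: v + y]addrC.
have df0 s (sh : 0 <= s <= h) : derivable f (s *: u + y) u.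
  by have [] := df s 0 sh z0h; rewrite scale0r add0r.
have DE s (sh : 0 <= s <= h) : 'D_u g (s *: u + y) =
    'D_u f (h *: v + (s *: u + y)) - 'D_u f (s *: u + y).
  rewrite /g (@deriveB _ _ _ (fun z => f (z + h *: v)) f); [|exact: dfv|exact: df0].
  congr (_ - _); rewrite /derive.
  rewrite (_ : (fun k => _) = (fun k => k^-1 *: (f (k *: u + (h *: v + (s *: u + y))) - f (h *: v + (s *: u + y))))) //.
  by apply/funext => k; rewrite /= [s *: u + y + h *: v]addrC -[k *: u + _ + h *: v]addrA
    [s *: u + y + h *: v]addrC.
have [s sh E] : exists2 s, 0 <= s <= h & g (h *: u + y) - g y = h * 'D_u g (s *: u + y).
  apply: (MVT_line (f := g) h0) => s sh.
  by apply: (@derivableB _ _ _ (fun z => f (z + h *: v)) f); [exact: dfv|exact: df0].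
have [t th E'] : exists2 t, 0 <= t <= h & 'D_u f (h *: v + (s *: u + y)) - 'D_u f (s *: u + y) =
    h * 'D_v ('D_u f) (t *: v + (s *: u + y)).
  apply: (MVT_line (f := 'D_u f) h0) => t th; rewrite addrCA.
  by have [_ /diff_derivable] := df s t sh th; exact.
exists s, t; split; [exact: sh|exact: th|].
rewrite (DE s sh) E' /g in E.
rewrite (addrCA (s *: u) (t *: v) y) expr2 -mulrA.
apply: etrans _ E; rewrite -(addrA (h *: u) y (h *: v)) (addrC y (h *: v)).
by rewrite opprB [RHS]addrA [RHS]addrAC.
Qed.

Lemma eq_at_of_close_values (F G : 'rV[R]_n -> R) y :
  {for y, continuous F} -> {for y, continuous G} ->
  (forall V, nbhs y V -> exists z z', [/\ V z, V z' & F z = G z']) -> F y = G y.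
Proof.
move=> cF cG close; apply/eqP; rewrite -subr_eq0 -normr_le0.
apply/ler_addgt0Pl => e e0; rewrite addr0.
have e2 : 0 < e / 2 by rewrite divr_gt0.
move/cvgrPdist_lt: cF => /(_ _ e2) cF; move/cvgrPdist_lt: cG => /(_ _ e2) cG.
have [z [z' [[Fz _] [_ Gz'] E]]] := close _ (filterI cF cG).
move: Fz Gz'; rewrite /= E distrC => Fz Gz'.
have -> : F y - G y = (F y - G z') - (G y - G z') by rewrite opprB addrA subrK.
rewrite (le_trans (ler_normB _ _)) // (splitr e) ltW //.
by rewrite ltrD // distrC.
Qed.

(** The second difference is symmetric in its two directions. Hence each mixed derivative takes,
    arbitrarily close to [y], a value that the other one also takes, and continuity concludes. *)
Lemma schwarz U f i j y : open U -> U y -> smooth U f ->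
  'D_(delta_mx 0 i) ('D_(delta_mx 0 j) f) y = 'D_(delta_mx 0 j) ('D_(delta_mx 0 i) f) y.
Proof.
move=> oU Uy sf.
have sDD k l : smooth U ('D_(delta_mx 0 k) ('D_(delta_mx 0 l) f)).
  exact: smooth_D _ (smooth_D _ sf).
have sD k : smooth U ('D_(delta_mx 0 k) f) by exact: smooth_D _ sf.
have cDD k l : {for y, continuous ('D_(delta_mx 0 k) ('D_(delta_mx 0 l) f))}.
  exact: differentiable_continuous (smooth_diff (sDD k l) Uy).
apply: (eq_at_of_close_values (cDD i j) (cDD j i)) => V.
move: sD; clear sDD cDD.
pose u : 'rV[R]_n := delta_mx 0 j; pose v : 'rV[R]_n := delta_mx 0 i.
rewrite -/u -/v => sD yV.
have [r r0 Hr] := (nbhs_ballP y (V `&` U)).1 (filterI yV (open_near oU Uy)).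
pose N := 1 + `|u| + `|v|; have N0 : 0 < N by rewrite /N -addrA ltr_wpDr ?addr_ge0.
(* [N] exceeds the sum of the norms of [u] and [v], so a displacement [s *: u + t *: v] with [s] and
   [t] at most [h] has norm at most [h * N = r / 2]. *)
pose h := r / 2 / N.
have h0 : 0 < h by rewrite !divr_gt0.
have inb s t : 0 <= s <= h -> 0 <= t <= h -> ball y r (s *: u + (t *: v + y)).
  move=> /andP[s0 sh] /andP[t0 th]; rewrite -ball_normE /ball_ /=.
  rewrite addrA opprD addrCA subrr addr0 normrN.
  rewrite (le_lt_trans (ler_normD _ _)) // !normrZ !ger0_norm //.
  have stN : s * `|u| + t * `|v| <= h * N.
    rewrite /N !mulrDr mulr1 -addrA ler_wpDl //; first exact: ltW.
    by apply: lerD; apply: ler_wpM2r.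
  rewrite (le_lt_trans stN) //.
  by rewrite /h divfK ?gt_eqF // ltr_pdivrMr // ltr_pMr // ltr1n.
have Df w s t : 0 <= s <= h -> 0 <= t <= h -> derivable f (s *: u + (t *: v + y)) w.
  by move=> sh th; have [_ Uz] := Hr _ (inb s t sh th); exact: diff_derivable (smooth_diff sf Uz).
have [|s [t [sh th E]]] := @second_difference f u v y h h0.
  move=> s t sh th; split; first exact: Df.
  by have [_ Uz] := Hr _ (inb s t sh th); exact: (smooth_diff (sD j) Uz).
have [|s' [t' [sh' th' E']]] := @second_difference f v u y h h0.
  move=> t' s' th' sh'; rewrite addrCA; split; first exact: Df.
  by have [_ Uz] := Hr _ (inb s' t' sh' th'); exact: (smooth_diff (sD i) Uz).
exists (s *: u + (t *: v + y)), (t' *: u + (s' *: v + y)); split.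
- by have [] := Hr _ (inb s t sh th).
- by have [] := Hr _ (inb t' s' th' sh').
apply: (mulfI (lt0r_neq0 (exprn_gt0 2 h0))); apply: etrans (esym E) _.
rewrite (addrCA (t' *: u)); apply: etrans _ E'.
rewrite (addrCA (h *: u)) -!addrA; congr (_ + _).
by rewrite addrCA.
Qed.

End schwarz.

(** * Smooth matrix-valued functions *)

Section smooth_matrix.
Context {R : realType} {n : nat} {U : set 'rV[R]_n}.
Hypothesis oU : open U.

Lemma smooth_on_eq p q (f g : 'rV[R]_n -> 'M[R]_(p, q)) :
  (forall y, U y -> f y = g y) -> smooth_on U f -> smooth_on U g.
Proof.
move=> fg sf i j; apply: (smooth_eq oU _ (sf i j : smooth _ _)) => y Uy.
by rewrite fg.
Qed.

Lemma smooth_on_sub p q (V : set 'rV[R]_n) (f : 'rV[R]_n -> 'M[R]_(p, q)) :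
  V `<=` U -> smooth_on U f -> smooth_on V f.
Proof. by move=> VU sf i j; exact: smooth_sub VU (sf i j). Qed.

Lemma smooth_on_diff p (f : 'rV[R]_n -> 'rV[R]_p) (y : 'rV[R]_n) :
  smooth_on U f -> U y -> differentiable f y.
Proof. by move=> sf Uy; apply: differentiable_row => j; exact: (sf 0 j [::]). Qed.

Lemma smooth_on_id : smooth_on U (id : 'rV[R]_n -> 'rV[R]_n).
Proof. by move=> i j; rewrite (ord1 i); exact: smooth_coord. Qed.

Lemma smooth_on_cst p q (A : 'M[R]_(p, q)) : smooth_on U (fun=> A).
Proof. by move=> i j; exact: smooth_cst. Qed.

Lemma smooth_on_add p q (f g : 'rV[R]_n -> 'M[R]_(p, q)) :
  smooth_on U f -> smooth_on U g -> smooth_on U (fun y => f y + g y).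
Proof.
move=> sf sg i j.
by apply: (smooth_eq oU _ (smooth_add oU (sf i j) (sg i j))) => y _; rewrite mxE.
Qed.

Lemma smooth_on_opp p q (f : 'rV[R]_n -> 'M[R]_(p, q)) :
  smooth_on U f -> smooth_on U (fun y => - f y).
Proof.
move=> sf i j.
by apply: (smooth_eq oU _ (smooth_opp oU (sf i j))) => y _; rewrite mxE.
Qed.

Lemma smooth_on_scale p q (a : 'rV[R]_n -> R) (f : 'rV[R]_n -> 'M[R]_(p, q)) :
  smooth U a -> smooth_on U f -> smooth_on U (fun y => a y *: f y).
Proof.
move=> sa sf i j.
by apply: (smooth_eq oU _ (smooth_mul oU sa (sf i j))) => y _; rewrite mxE.
Qed.

Lemma smooth_on_mulmx p q r (f : 'rV[R]_n -> 'M[R]_(p, q)) (g : 'rV[R]_n -> 'M[R]_(q, r)) :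
  smooth_on U f -> smooth_on U g -> smooth_on U (fun y => f y *m g y).
Proof.
move=> sf sg i j.
have sm k : smooth U (fun y => f y i k * g y k j) := smooth_mul oU (sf i k) (sg k j).
apply: (smooth_eq oU (f := fun y => \sum_k f y i k * g y k j)).
  by move=> y _; rewrite mxE.
by apply: smooth_sum.
Qed.

Lemma smooth_det p (f : 'rV[R]_n -> 'M[R]_p) :
  smooth_on U f -> smooth U (fun y => \det (f y)).
Proof.
move=> sf; apply: smooth_sum => // s _; apply: smooth_mul => //; first exact: smooth_cst.
by apply: smooth_prod => // i _; exact: sf.
Qed.

(** By the adjugate formula, the inverse is polynomial in the entries up to the inverse of the
    determinant. *)
Lemma smooth_on_invmx p (f : 'rV[R]_n -> 'M[R]_p) :
  (forall y, U y -> f y \in unitmx) -> smooth_on U f ->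
  smooth_on U (fun y => invmx (f y)).
Proof.
move=> uf sf.
have sV : smooth U (fun y => (\det (f y))^-1).
  apply: smooth_inv => //; last exact: smooth_det.
  by move=> y Uy; have := uf y Uy; rewrite unitmxE unitfE.
suff : smooth_on U (fun y => (\det (f y))^-1 *: \adj (f y)).
  by apply: smooth_on_eq => y Uy; rewrite /invmx uf.
apply: smooth_on_scale => // i j.
apply: (smooth_eq oU (f := fun y => (-1) ^+ (j + i) * \det (row' j (col' i (f y))))).
  by move=> y _; rewrite mxE.
apply: smooth_mul => //; first exact: smooth_cst.
apply: smooth_det => k l.
by apply: (smooth_eq oU _ (sf (lift j k) (lift i l) : smooth _ _)) => y _; rewrite !mxE.
Qed.

Lemma smooth_on_comp m p q (V : set 'rV[R]_m) (f : 'rV[R]_m -> 'M[R]_(p, q))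
    (g : 'rV[R]_n -> 'rV[R]_m) :
  open V -> (forall y, U y -> V (g y)) -> smooth_on V f -> smooth_on U g ->
  smooth_on U (fun y => f (g y)).
Proof.
move=> oV gUV sf sg i j.
by apply: (@smooth_comp _ _ _ U V (fun z => f z i j) g) => //; exact: sf.
Qed.

Lemma smooth_on_jacobian p (f : 'rV[R]_n -> 'rV[R]_p) :
  smooth_on U f -> smooth_on U (jacobian f).
Proof.
move=> sf i j.
apply: (smooth_eq oU _ (smooth_D i (sf 0 j : smooth U (fun y => f y 0 j)))) => y Uy.
by apply: esym; apply: jacobianE; exact: smooth_on_diff.
Qed.

Lemma partials_jacobian p (f : 'rV[R]_n -> 'rV[R]_p) s i j (y : 'rV[R]_n) :
  smooth_on U f -> U y ->
  partials s (fun z => jacobian f z i j) y = partials (rcons s i) (fun z => f z 0 j) y.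
Proof.
move=> sf Uy; rewrite partials_rcons; apply: (partials_on_open s oU Uy) => z Uz.
by apply: jacobianE; exact: smooth_on_diff.
Qed.

Lemma open_preimage_open p (V : set 'rV[R]_p) (f : 'rV[R]_n -> 'rV[R]_p) :
  smooth_on U f -> open V -> open [set y | U y /\ V (f y)].
Proof.
move=> sf oV; rewrite openE => y [Uy Vfy].
have cf : {for y, continuous f} by apply/differentiable_continuous/smooth_on_diff.
have h1 := open_near oU Uy; have h2 := cf _ (open_near oV Vfy).
by near=> z; split; [near: z; exact: h1|near: z; exact: h2].
Unshelve. all: by end_near. Qed.

Lemma open_unitmx p (f : 'rV[R]_n -> 'M[R]_p) :
  smooth_on U f -> open [set y | U y /\ f y \in unitmx].
Proof.
move=> sf; rewrite openE => y [Uy ufy].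
have sd := smooth_det sf.
have cd : {for y, continuous (fun y => \det (f y))}.
  by apply/differentiable_continuous/(smooth_diff sd).
have h1 := open_near oU Uy.
have d0 : \det (f y) != 0 by move: ufy; rewrite unitmxE unitfE.
have h2 := cd _ (open_near (@open_neq R 0) d0).
near=> z; split; first by near: z; exact: h1.
by rewrite unitmxE unitfE; near: z; exact: h2.
Unshelve. all: by end_near. Qed.

(** The first letter of [s] is located in [t] and brought to the front by successive applications of
    [schwarz]. *)
Lemma partials_perm (f : 'rV[R]_n -> R) s t (y : 'rV[R]_n) :
  smooth U f -> U y -> perm_eq s t -> partials s f y = partials t f y.
Proof.
move=> sf Uy; elim: s t y Uy => [|i s IHs] t y Uy st.
  by case: t st => // j t /perm_size.
have ti : i \in t by rewrite -(perm_mem st) mem_head.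
case/path.splitPr: ti st => t1 t2 st.
have st' : perm_eq s (t1 ++ t2).
  by rewrite -(perm_cons i) (permPl st) -cat1s perm_catCA.
have -> : partials (i :: s) f y = partials (i :: t1 ++ t2) f y.
  by apply: (derive_on_open _ oU Uy) => z Uz; exact: IHs.
have {st st' IHs} : U y by [].
elim: t1 y {Uy} => [|j t1 IHt] y Uy //=.
rewrite (schwarz i j oU Uy (smooth_partials _ sf)).
by apply: (derive_on_open _ oU Uy) => z Uz; exact: IHt.
Qed.

End smooth_matrix.

(** * Jets *)

Section multi_indices.
Context {n m : nat}.

Lemma sum_count_mem (s : seq 'I_n) : (\sum_(i < n) count_mem i s)%N = size s.
Proof.
elim: s => [|j s IHs] /=; first by rewrite big1.
rewrite big_split /= IHs -add1n; congr (_ + _)%N.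
rewrite (bigD1 j) //= eqxx big1 // => i.
by rewrite eq_sym => /negbTE->.
Qed.

Lemma count_word (a : multi_index n m) i : count_mem i (word a) = val a i.
Proof.
rewrite /word count_flatten -map_comp sumnE big_map big_enum /=.
rewrite (bigD1 i) //= count_nseq /= eqxx mul1n big1 ?addn0 // => j.
by rewrite count_nseq /= => /negbTE->.
Qed.

Lemma size_word (a : multi_index n m) : (size (word a) <= m)%N.
Proof.
rewrite -sum_count_mem; under eq_bigr do rewrite count_word.
exact: valP a.
Qed.

(** Words are the natural index of iterated derivatives, multi-indices that of jets. A multi-index
    records only how often each letter occurs, so the passage is up to a permutation. *)
Lemma words_multi_index (s : seq 'I_n) : (size s <= m)%N ->
  exists a : multi_index n m, perm_eq s (word a).
Proof.
move=> sm.
have cm i : (count_mem i s < m.+1)%N by rewrite ltnS (leq_trans (count_size _ _)).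
pose a : {ffun 'I_n -> 'I_m.+1} := [ffun i => Ordinal (cm i)].
have aP : (\sum_(i < n) a i <= m)%N.
  by under eq_bigr do rewrite ffunE /=; rewrite sum_count_mem.
exists (Sub a aP); apply/allP => i _ /=.
by rewrite count_word SubK ffunE.
Qed.

End multi_indices.

(** * Congruence of germs up to order m *)

Section jet_congruence.
Context {R : realType}.

(** Equality of m-jets is stated on words rather than on multi-indices: the recursion [jeqS] then
    removes one letter at a time without appeal to the symmetry of derivatives. *)
Definition jeq n m (y : 'rV[R]_n) (f g : 'rV[R]_n -> R) : Prop :=
  forall s, (size s <= m)%N -> partials s f y = partials s g y.

Definition mjeq n m p q (y : 'rV[R]_n) (f g : 'rV[R]_n -> 'M[R]_(p, q)) : Prop :=
  forall i j, jeq m y (fun z => f z i j) (fun z => g z i j).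

Lemma jeqS n m (y : 'rV[R]_n) (f g : 'rV[R]_n -> R) : jeq m.+1 y f g <->
  f y = g y /\ forall i, jeq m y ('D_(delta_mx 0 i) f) ('D_(delta_mx 0 i) g).
Proof.
split=> [h|[h0 h]].
  split=> [|i s sm]; first exact: (h [::]).
  by rewrite -!partials_rcons; apply: h; rewrite size_rcons.
elim/last_ind => [|s i _]; first by move=> _; exact: h0.
by rewrite size_rcons ltnS !partials_rcons; exact: h.
Qed.

Lemma jeq_trans n m (y : 'rV[R]_n) (f g h : 'rV[R]_n -> R) :
  jeq m y f g -> jeq m y g h -> jeq m y f h.
Proof. by move=> fg gh s sm; rewrite fg // gh. Qed.

Lemma jeq_sym n m (y : 'rV[R]_n) (f g : 'rV[R]_n -> R) : jeq m y f g -> jeq m y g f.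
Proof. by move=> fg s sm; rewrite fg. Qed.

Lemma jeq_weak n m k (y : 'rV[R]_n) (f g : 'rV[R]_n -> R) : (k <= m)%N ->
  jeq m y f g -> jeq k y f g.
Proof. by move=> km h s sk; apply: h; exact: leq_trans km. Qed.

Lemma jeq_on n m (U : set 'rV[R]_n) (y : 'rV[R]_n) (f g : 'rV[R]_n -> R) :
  open U -> U y -> (forall z, U z -> f z = g z) -> jeq m y f g.
Proof. by move=> oU Uy fg s _; exact: partials_on_open fg. Qed.

Lemma mjeq_trans n m p q (y : 'rV[R]_n) (f g h : 'rV[R]_n -> 'M[R]_(p, q)) :
  mjeq m y f g -> mjeq m y g h -> mjeq m y f h.
Proof. by move=> fg gh i j; exact: jeq_trans (fg i j) (gh i j). Qed.

Lemma mjeq_sym n m p q (y : 'rV[R]_n) (f g : 'rV[R]_n -> 'M[R]_(p, q)) :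
  mjeq m y f g -> mjeq m y g f.
Proof. by move=> fg i j; exact: jeq_sym (fg i j). Qed.

Lemma mjeq_weak n m k p q (y : 'rV[R]_n) (f g : 'rV[R]_n -> 'M[R]_(p, q)) :
  (k <= m)%N -> mjeq m y f g -> mjeq k y f g.
Proof. by move=> km fg i j; exact: jeq_weak km (fg i j). Qed.

Lemma mjeq_val n m p q (y : 'rV[R]_n) (f g : 'rV[R]_n -> 'M[R]_(p, q)) :
  mjeq m y f g -> f y = g y.
Proof. by move=> fg; apply/matrixP => i j; exact: (fg i j [::]). Qed.

Lemma mjeq_on n m p q (U : set 'rV[R]_n) (y : 'rV[R]_n) (f g : 'rV[R]_n -> 'M[R]_(p, q)) :
  open U -> U y -> (forall z, U z -> f z = g z) -> mjeq m y f g.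
Proof. by move=> oU Uy fg i j; apply: (jeq_on oU Uy) => z Uz; rewrite fg. Qed.

Section onU.
Context n (U : set 'rV[R]_n).
Hypothesis oU : open U.
Variable y : 'rV[R]_n.
Hypothesis Uy : U y.
Implicit Types (f g : 'rV[R]_n -> R).

Lemma jeq_of_multi_index m f g : smooth U f -> smooth U g ->
  (forall a : multi_index n m, partials (word a) f y = partials (word a) g y) ->
  jeq m y f g.
Proof.
move=> sf sg fg s /words_multi_index[a sa].
by rewrite (partials_perm oU sf Uy sa) fg (partials_perm oU sg Uy sa).
Qed.

Lemma partials_add f g s : smooth U f -> smooth U g ->
  partials s (fun z => f z + g z) y = partials s f y + partials s g y.
Proof.
move=> sf sg; elim: s y Uy => [//|i s IHs] z Uz /=.
apply: etrans (derive_on_open (g := fun w => partials s f w + partials s g w) _ oU Uz _) _.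
  by move=> w Uw; exact: IHs.
by apply: derive_add; [exact: (smooth_partials s sf [::])|exact: (smooth_partials s sg [::])].
Qed.

Lemma partials_scale a f s : smooth U f ->
  partials s (fun z => a * f z) y = a * partials s f y.
Proof.
move=> sf; elim: s y Uy => [//|i s IHs] z Uz /=.
apply: etrans (derive_on_open (g := fun w => a * partials s f w) _ oU Uz _) _.
  by move=> w Uw; exact: IHs.
rewrite derive_mul; [|exact: differentiable_cst|exact: (smooth_partials s sf [::])].
by rewrite (derive_cst a) mul0r add0r.
Qed.

Lemma partials_cst a i s : partials (i :: s) (fun=> a) y = 0 :> R.
Proof.
elim: s i y Uy => [|j s IHs] i z Uz; first by rewrite /= (derive_cst a).
apply: etrans (derive_on_open (f := partials (j :: s) (fun=> a)) (g := cst 0) _ oU Uz _) _.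
  by move=> w Uw; exact: IHs.
exact: derive_cst.
Qed.

Lemma partials_sum I (r : seq I) (P : pred I) (F : I -> 'rV[R]_n -> R) s :
  (forall i, smooth U (F i)) ->
  partials s (fun z => \sum_(i <- r | P i) F i z) y =
  \sum_(i <- r | P i) partials s (F i) y.
Proof.
move=> sF; elim: r => [|i r IHr].
  rewrite big_nil (@partials_on_open _ _ U _ (fun=> 0)) //; last first.
    by move=> z _; rewrite big_nil.
  by case: s => [|i s] //; exact: partials_cst.
rewrite big_cons -IHr; case: ifP => Pi.
  rewrite -partials_add //; last by apply: smooth_sum.
  by apply: (partials_on_open _ oU Uy) => z _; rewrite big_cons Pi.
by apply: (partials_on_open _ oU Uy) => z _; rewrite big_cons Pi.
Qed.

Lemma jeq_add m f g f' g' : smooth U f -> smooth U g -> smooth U f' -> smooth U g' ->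
  jeq m y f f' -> jeq m y g g' -> jeq m y (fun z => f z + g z) (fun z => f' z + g' z).
Proof.
move=> sf sg sf' sg' ff gg s sm.
by rewrite !partials_add // ff // gg.
Qed.

Lemma jeq_sum m I (r : seq I) (P : pred I) (F G : I -> 'rV[R]_n -> R) :
  (forall i, smooth U (F i)) -> (forall i, smooth U (G i)) ->
  (forall i, jeq m y (F i) (G i)) ->
  jeq m y (fun z => \sum_(i <- r | P i) F i z) (fun z => \sum_(i <- r | P i) G i z).
Proof.
move=> sF sG FG s sm; rewrite !partials_sum //.
by apply: eq_bigr => i _; exact: FG.
Qed.

Lemma jeq_mul m f g f' g' : smooth U f -> smooth U g -> smooth U f' -> smooth U g' ->
  jeq m y f f' -> jeq m y g g' -> jeq m y (fun z => f z * g z) (fun z => f' z * g' z).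
Proof.
elim: m f g f' g' => [|m IHm] f g f' g' sf sg sf' sg' ff gg.
  by case=> // _; move: (ff [::] isT) (gg [::] isT) => /= -> ->.
have ff0 := jeq_weak (leqnSn m) ff; have gg0 := jeq_weak (leqnSn m) gg.
apply/jeqS; move/jeqS: ff => [f0 ff]; move/jeqS: gg => [g0 gg].
split=> [|i]; first by rewrite f0 g0.
have H (k l : 'rV[R]_n -> R) (sk : smooth U k) (sl : smooth U l) :
    jeq m y ('D_(delta_mx 0 i) (fun z => k z * l z))
      (fun z => 'D_(delta_mx 0 i) k z * l z + k z * 'D_(delta_mx 0 i) l z).
  apply: (jeq_on oU Uy) => z Uz.
  by apply: derive_mul; [exact: (sk [::])|exact: (sl [::])].
apply: jeq_trans (H _ _ sf sg) _; apply: jeq_trans _ (jeq_sym (H _ _ sf' sg')).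
have d k (sk : smooth U k) : smooth U ('D_(delta_mx 0 i) k) := smooth_D i sk.
apply: jeq_add; try by apply: smooth_mul => //; apply: d.
- exact: (IHm _ _ _ _ (d _ sf) sg (d _ sf') sg' (ff i) gg0).
- exact: (IHm _ _ _ _ sf (d _ sg) sf' (d _ sg') ff0 (gg i)).
Qed.

Lemma mjeq_mulmx m p q r (f f' : 'rV[R]_n -> 'M[R]_(p, q)) (g g' : 'rV[R]_n -> 'M[R]_(q, r)) :
  smooth_on U f -> smooth_on U g -> smooth_on U f' -> smooth_on U g' ->
  mjeq m y f f' -> mjeq m y g g' ->
  mjeq m y (fun z => f z *m g z) (fun z => f' z *m g' z).
Proof.
move=> sf sg sf' sg' ff gg i j.
have E (k : 'rV[R]_n -> 'M[R]_(p, q)) (l : 'rV[R]_n -> 'M[R]_(q, r)) :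
  jeq m y (fun z => (k z *m l z) i j) (fun z => \sum_h k z i h * l z h j).
  by apply: (jeq_on oU Uy) => z _; rewrite mxE.
apply: jeq_trans (E _ _) _; apply: jeq_trans _ (jeq_sym (E _ _)).
apply: jeq_sum => h.
- by apply: smooth_mul => //; [exact: sf|exact: sg].
- by apply: smooth_mul => //; [exact: sf'|exact: sg'].
- by apply: jeq_mul; [exact: sf|exact: sg|exact: sf'|exact: sg'|exact: ff|exact: gg].
Qed.

Lemma mjeq_refl m p q (f : 'rV[R]_n -> 'M[R]_(p, q)) : mjeq m y f f.
Proof. by move=> i j s. Qed.

Lemma mjeq_add m p q (f f' g g' : 'rV[R]_n -> 'M[R]_(p, q)) :
  smooth_on U f -> smooth_on U g -> smooth_on U f' -> smooth_on U g' ->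
  mjeq m y f f' -> mjeq m y g g' ->
  mjeq m y (fun z => f z + g z) (fun z => f' z + g' z).
Proof.
move=> sf sg sf' sg' ff gg i j.
have E (k l : 'rV[R]_n -> 'M[R]_(p, q)) :
  jeq m y (fun z => (k z + l z) i j) (fun z => k z i j + l z i j).
  by apply: (jeq_on oU Uy) => z _; rewrite mxE.
apply: jeq_trans (E _ _) _; apply: jeq_trans _ (jeq_sym (E _ _)).
by apply: jeq_add; [exact: sf|exact: sg|exact: sf'|exact: sg'|exact: ff|exact: gg].
Qed.

(** Insert [g *m invmx g], replace [g] by the congruent [f], and cancel [invmx f *m f]. Congruence
    of inverses thus reduces to that of products. *)
Lemma mjeq_invmx m p (f g : 'rV[R]_n -> 'M[R]_p) :
  smooth_on U f -> smooth_on U g ->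
  (forall z, U z -> f z \in unitmx) -> (forall z, U z -> g z \in unitmx) ->
  mjeq m y f g -> mjeq m y (fun z => invmx (f z)) (fun z => invmx (g z)).
Proof.
move=> sf sg uf ug fg.
have sfi := smooth_on_invmx oU uf sf; have sgi := smooth_on_invmx oU ug sg.
have h1 : mjeq m y (fun z => invmx (f z)) (fun z => invmx (f z) *m (g z *m invmx (g z))).
  by apply: (mjeq_on oU Uy) => z Uz; rewrite mulmxV ?mulmx1 ?ug.
have h2 : mjeq m y (fun z => invmx (f z) *m (f z *m invmx (g z))) (fun z => invmx (g z)).
  by apply: (mjeq_on oU Uy) => z Uz; rewrite mulmxA mulVmx ?mul1mx ?uf.
apply: mjeq_trans h1 _; apply: mjeq_trans _ h2.
apply: mjeq_mulmx => //; try exact: mjeq_refl; try exact: smooth_on_mulmx.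
by apply: mjeq_mulmx => //; exact: mjeq_sym.
Qed.

(** Induction on the order through the chain rule; [f] and [f'] are generalized since their first
    derivatives, congruent to one order less, replace them. *)
Lemma jeq_comp m p (V : set 'rV[R]_p) (f f' : 'rV[R]_p -> R)
    (g g' : 'rV[R]_n -> 'rV[R]_p) :
  open V -> smooth V f -> smooth V f' -> smooth_on U g -> smooth_on U g' ->
  (forall z, U z -> V (g z)) -> (forall z, U z -> V (g' z)) ->
  jeq m (g y) f f' -> mjeq m y g g' ->
  jeq m y (fun z => f (g z)) (fun z => f' (g' z)).
Proof.
move=> oV sf sf' sg sg' gV gV'.
elim: m f f' sf sf' => [|m IHm] f f' sf sf' ff gg.
  by case=> // _; move: (ff [::] isT) => /= ->; rewrite (mjeq_val gg).
have gg0 := mjeq_weak (leqnSn m) gg.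
move/jeqS: ff => [f0 ff].
apply/jeqS; split=> [|i]; first by rewrite -(mjeq_val gg) f0.
have H (k : 'rV[R]_p -> R) (l : 'rV[R]_n -> 'rV[R]_p) (sk : smooth V k)
    (sl : smooth_on U l) (lV : forall z, U z -> V (l z)) :
    jeq m y ('D_(delta_mx 0 i) (fun z => k (l z)))
      (fun z => \sum_j 'D_(delta_mx 0 j) k (l z) * 'D_(delta_mx 0 i) (fun w => l w 0 j) z).
  apply: (jeq_on oU Uy) => z Uz; apply: derive_comp; first exact: smooth_on_diff sl Uz.
  exact: (sk [::] _ (lV z Uz)).
have H' (k : 'rV[R]_p -> R) (l : 'rV[R]_n -> 'rV[R]_p) (sk : smooth V k)
    (sl : smooth_on U l) (lV : forall z, U z -> V (l z)) j :
    smooth U (fun z => 'D_(delta_mx 0 j) k (l z)).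
  by apply: (smooth_comp oU oV lV (smooth_D j sk) sl).
apply: jeq_trans (H _ _ sf sg gV) _; apply: jeq_trans _ (jeq_sym (H _ _ sf' sg' gV')).
have D (l : 'rV[R]_n -> 'rV[R]_p) (sl : smooth_on U l) j :
  smooth U ('D_(delta_mx 0 i) (fun w => l w 0 j)) := smooth_D i (sl 0 j).
apply: jeq_sum => j.
- by apply: (smooth_mul oU); [exact: H'|exact: D].
- by apply: (smooth_mul oU); [exact: H'|exact: D].
- apply: jeq_mul; [exact: H'|exact: D|exact: H'|exact: D| |].
    apply: (IHm ('D_(delta_mx 0 j) f) ('D_(delta_mx 0 j) f')); last exact: gg0.
    + exact: smooth_D.
    + exact: smooth_D.
    + exact: ff.
  by have /jeqS[_] := gg 0 j; exact.
Qed.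

Lemma mjeq_jacobian m p (f g : 'rV[R]_n -> 'rV[R]_p) :
  smooth_on U f -> smooth_on U g -> mjeq m.+1 y f g ->
  mjeq m y (jacobian f) (jacobian g).
Proof.
move=> sf sg fg i j s sm.
apply: etrans (partials_jacobian oU s i j sf Uy) _.
apply: etrans _ (esym (partials_jacobian oU s i j sg Uy)).
by apply: (fg 0 j); rewrite size_rcons.
Qed.

End onU.
End jet_congruence.

Section derivatives_along_lines.
Context {R : realType} {n : nat}.

Lemma derive_cst_line (W : normedModType R) (g : 'rV[R]_n -> W) (v y : 'rV[R]_n) :
  (forall h : R, g (h *: v + y) = g y) -> 'D_v g y = 0.
Proof.
move=> gE; rewrite /derive (_ : (fun h => _) = cst 0); first exact: lim_cst.
by apply/funext => h; rewrite /= gE subrr scaler0.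
Qed.

Lemma derive_expr_coord (c : R) e (v y : 'rV[R]_n) j :
  'D_v (fun z : 'rV[R]_n => (z 0 j - c) ^+ e) y = e%:R * (y 0 j - c) ^+ e.-1 * v 0 j.
Proof.
have dc : differentiable (fun z : 'rV[R]_n => z 0 j - c) y.
  apply: (@differentiableB _ _ _ (fun z : 'rV[R]_n => z 0 j) (cst c)).
    exact: differentiable_coord.
  exact: differentiable_cst.
have Dc : 'D_v (fun z : 'rV[R]_n => z 0 j - c) y = v 0 j.
  rewrite (derive_add _ (g := cst (- c))); first by rewrite derive_coord derive_cst addr0.
    exact: differentiable_coord.
  exact: differentiable_cst.
elim: e => [|e IHe].
  by rewrite mul0r mul0r; apply: derive_cst_line => h; rewrite !expr0.
have dX : differentiable (fun z : 'rV[R]_n => (z 0 j - c) ^+ e) y.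
  elim: (e) => [|k IHk].
    by rewrite (_ : (fun _ => _) = cst 1) //; exact: differentiable_cst.
  rewrite (_ : (fun _ => _) = (fun z : 'rV[R]_n => z 0 j - c) * (fun z => (z 0 j - c) ^+ k)).
    exact: differentiableM.
  by apply/funext => z; rewrite exprS.
rewrite (_ : (fun z => _) = (fun z : 'rV[R]_n => (z 0 j - c) * (z 0 j - c) ^+ e)); last first.
  by apply/funext => z; rewrite exprS.
rewrite derive_mul // Dc IHe /= mulrC.
case: e {IHe dX} => [|e] /=; first by rewrite expr0; ring.
by rewrite exprS -[e.+2%:R]natr1; ring.
Qed.

End derivatives_along_lines.

(** * Taylor polynomials *)

Section taylor.
Context {R : realType} {n : nat}.

Definition monomial (a : 'I_n -> nat) (y z : 'rV[R]_n) : R :=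
  \prod_i (z 0 i - y 0 i) ^+ a i.

Lemma smooth_monomial N (U : set 'rV[R]_N) a (w v : 'rV[R]_N -> 'rV[R]_n) :
  open U -> smooth_on U w -> smooth_on U v -> smooth U (fun z => monomial a (w z) (v z)).
Proof.
move=> oU sw sv; apply: smooth_prod => // i _; apply: smooth_exp => //.
by apply: smooth_add => //; [exact: sv|apply: smooth_opp => //; exact: sw].
Qed.

Lemma derive_monomial a (y z : 'rV[R]_n) j :
  'D_(delta_mx 0 j) (monomial a y) z =
  (a j)%:R * monomial (fun i => a i - (j == i))%N y z.
Proof.
have E : monomial a y = fun z : 'rV[R]_n => (z 0 j - y 0 j) ^+ a j *
    \prod_(i | i != j) (z 0 i - y 0 i) ^+ a i.
  by apply/funext => w; rewrite /monomial (bigD1 j).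
have s1 : smooth setT (fun z : 'rV[R]_n => (z 0 j - y 0 j) ^+ a j).
  apply: smooth_exp; first exact: openT.
  by apply: smooth_add; [exact: openT|exact: smooth_coord|exact: smooth_cst].
have s2 : smooth setT (fun z : 'rV[R]_n => \prod_(i | i != j) (z 0 i - y 0 i) ^+ a i).
  apply: smooth_prod => [|i _]; first exact: openT.
  apply: smooth_exp; first exact: openT.
  by apply: smooth_add; [exact: openT|exact: smooth_coord|exact: smooth_cst].
rewrite E derive_mul; [|exact: (s1 [::])|exact: (s2 [::])].
have D0 : 'D_(delta_mx 0 j) (fun z : 'rV[R]_n => \prod_(i | i != j) (z 0 i - y 0 i) ^+ a i) z = 0.
  apply: derive_cst_line => h; apply: eq_bigr => i ij.
  by rewrite !mxE eqxx (negbTE ij) mulr0 add0r.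
rewrite derive_expr_coord D0 mulr0 addr0 mxE !eqxx mulr1 -mulrA; congr (_ * _).
rewrite /monomial [RHS](bigD1 j) //= eqxx subn1; congr (_ * _).
by apply: eq_bigr => i ij; rewrite eq_sym (negbTE ij) subn0.
Qed.

(** When [count_mem i s] exceeds [a i] the falling factorial vanishes, which makes the truncated
    subtraction in the exponent harmless. *)
Lemma partials_monomial s a (y z : 'rV[R]_n) :
  partials s (monomial a y) z =
  (\prod_i (a i ^_ count_mem i s))%:R * monomial (fun i => a i - count_mem i s)%N y z.
Proof.
elim: s z => [|j s IHs] z /=.
  rewrite big1 ?mul1r; last by move=> i _; rewrite ffactn0.
  by congr (monomial _ _ _); apply/funext => i; rewrite subn0.
rewrite (_ : partials s _ = fun z => (\prod_i (a i ^_ count_mem i s))%:R *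
  monomial (fun i => a i - count_mem i s)%N y z); last by apply/funext.
set k := (X in X%:R * _).
have sm : smooth setT (monomial (fun i => a i - count_mem i s)%N y).
  apply: smooth_monomial; [exact: openT|exact: smooth_on_cst|exact: smooth_on_id].
rewrite derive_mul; [|exact: differentiable_cst|exact: (sm [::])].
have -> : 'D_(delta_mx 0 j) (fun=> (\prod_i (a i ^_ count_mem i s))%:R : R) z = 0.
  exact: derive_cst.
rewrite mul0r add0r derive_monomial mulrA -natrM; congr (_%:R * _).
  rewrite /k (bigD1 j) //= [RHS](bigD1 j) //= eqxx add1n ffactnSr mulnAC.
  congr (_ * _)%N; apply: eq_bigr => i ij.
  by rewrite eq_sym (negbTE ij).
by congr (monomial _ _ _); apply/funext => i; rewrite subnDA subnAC.
Qed.

(** If the multi-indices differ at [i], either the monomial is differentiated too often in that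
    variable and the falling factorial is 0, or a positive power of [z 0 i - y 0 i] remains and
    vanishes at [y]. *)
Lemma partials_monomial_word m (a b : multi_index n m) (y : 'rV[R]_n) :
  partials (word b) (monomial (fun i => val a i) y) y =
  if a == b then (\prod_i (val a i)`!)%:R else 0.
Proof.
rewrite partials_monomial /monomial; case: eqVneq => [->|ab].
  rewrite [X in _ * X]big1 ?mulr1 => [|i _]; last by rewrite count_word subnn expr0.
  by congr _%:R; apply: eq_bigr => i _; rewrite count_word ffactnn.
have [i abi] : exists i, val a i != val b i.
  apply/existsP; apply: contraNT ab => /existsPn ab; apply/eqP/val_inj/ffunP => i.
  by apply/eqP; rewrite -[_ == _]negbK; exact: ab.
have [aib|bia|aib] := ltngtP (val a i) (val b i); last first.
- by case/eqP: abi; exact: val_inj.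
- rewrite [X in _ * X](bigD1 i) //= subrr count_word.
  by rewrite expr0n subn_eq0 leqNgt bia mul0r mulr0.
- by rewrite (bigD1 i) //= count_word ffact_small // mul0n mul0r.
Qed.

(** The coefficient [c a] stands for a derivative; the division by factorials is part of the
    polynomial, so that [partials_taylor] returns [c a] unchanged. *)
Definition taylor m p q (y : 'rV[R]_n) (c : multi_index n m -> 'M[R]_(p, q))
    (z : 'rV[R]_n) : 'M[R]_(p, q) :=
  \sum_(a : multi_index n m) (monomial (fun i => val a i) y z / (\prod_i (val a i)`!)%:R) *: c a.

(** Center, argument and coefficients vary together, because all three depend on the parameters with
    respect to which jets are differentiated below. *)
Lemma smooth_taylor N m p q (U : set 'rV[R]_N) (w v : 'rV[R]_N -> 'rV[R]_n)
    (c : 'rV[R]_N -> multi_index n m -> 'M[R]_(p, q)) :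
  open U -> smooth_on U w -> smooth_on U v -> (forall a, smooth_on U (c ^~ a)) ->
  smooth_on U (fun z => taylor (w z) (c z) (v z)).
Proof.
move=> oU sw sv sc i j.
apply: (smooth_eq oU (f := fun z => \sum_(a : multi_index n m) (monomial (fun i => val a i) (w z) (v z) /
   (\prod_i (val a i)`!)%:R) * c z a i j)).
  by move=> z _; rewrite /taylor summxE; apply: eq_bigr => a _; rewrite !mxE.
apply: smooth_sum => // a _; apply: smooth_mul => //; last exact: sc.
by apply: smooth_mul => //; [exact: smooth_monomial|exact: smooth_cst].
Qed.

Lemma smooth_on_taylor m p q (U : set 'rV[R]_n) (y : 'rV[R]_n)
    (c : multi_index n m -> 'M[R]_(p, q)) : open U -> smooth_on U (taylor y c).
Proof.
move=> oU; apply: smooth_taylor => //.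
- exact: smooth_on_cst.
- exact: smooth_on_id.
- by move=> a; exact: smooth_on_cst.
Qed.

Lemma partials_taylor m p q (y : 'rV[R]_n) (c : multi_index n m -> 'M[R]_(p, q)) b i j :
  partials (word b) (fun z => taylor y c z i j) y = c b i j.
Proof.
pose F (a : multi_index n m) (z : 'rV[R]_n) := (c a i j / (\prod_i (val a i)`!)%:R) * monomial (fun i => val a i) y z.
have sm a : smooth setT (monomial (fun i => (val (a : multi_index n m)) i) y).
  apply: smooth_monomial; [exact: openT|exact: smooth_on_cst|exact: smooth_on_id].
have sF a : smooth setT (F a).
  by apply: smooth_mul; [exact: openT|exact: smooth_cst|exact: sm].
have -> : (fun z => taylor y c z i j) = (fun z => \sum_a F a z).
  apply/funext => z; rewrite /taylor summxE; apply: eq_bigr => a _.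
  by rewrite mxE /F mulrC mulrA mulrAC.
rewrite (partials_sum openT) // (bigD1 b) //= big1 => [|a ab].
  rewrite addr0 /F (partials_scale openT) // partials_monomial_word eqxx divfK //.
  by rewrite pnatr_eq0 -lt0n prodn_gt0 // => k; exact: fact_gt0.
by rewrite /F (partials_scale openT) // partials_monomial_word (negbTE ab) mulr0.
Qed.

Lemma mjeq_taylor m p q (U : set 'rV[R]_n) (y : 'rV[R]_n) (f : 'rV[R]_n -> 'M[R]_(p, q)) :
  open U -> U y -> smooth_on U f ->
  mjeq m y f (taylor y (fun a : multi_index n m =>
    \matrix_(i, j) partials (word a) (fun z => f z i j) y)).
Proof.
move=> oU Uy sf i j; apply: (jeq_of_multi_index oU Uy); first exact: sf.
  exact: smooth_on_taylor.
by move=> a; rewrite partials_taylor mxE.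
Qed.

End taylor.

(** * Jets of functions depending on parameters *)

Section parametric_jets.
Context {R : realType} {n d : nat}.

Lemma derive_row_mx (H : 'rV[R]_(n + d) -> R) (i : 'I_n) (y : 'rV[R]_n) (u : 'rV[R]_d) :
  'D_(delta_mx 0 i) (fun z => H (row_mx z u)) y =
  'D_(delta_mx 0 (lshift d i)) H (row_mx y u).
Proof.
rewrite /derive (_ : (fun h => _) = (fun h : R => h^-1 *: (H (h *: delta_mx 0 (lshift d i) + row_mx y u) - H (row_mx y u)))) //.
apply/funext => h /=; congr (_ *: (H _ - _)).
rewrite (_ : delta_mx 0 (lshift d i) = row_mx (delta_mx 0 i) 0).
  by rewrite scale_row_mx add_row_mx scaler0 add0r.
apply/rowP => k; case: (split_ordP k) => l ->.
  by rewrite row_mxEl !mxE (inj_eq (@lshift_inj _ _)).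
by rewrite row_mxEr !mxE eq_rlshift.
Qed.

Lemma smooth_on_row_mxr (U : set 'rV[R]_d) (y : 'rV[R]_n) :
  open U -> smooth_on U (fun u : 'rV[R]_d => row_mx y u).
Proof.
move=> oU i k; rewrite (ord1 i); case: (split_ordP k) => l ->.
  by apply: (smooth_eq oU _ (@smooth_cst _ _ U (y 0 l))) => u _; rewrite row_mxEl.
by apply: (smooth_eq oU _ (@smooth_coord _ _ U l)) => u _; rewrite row_mxEr.
Qed.

Lemma smooth_on_row_mxl (U : set 'rV[R]_n) (u : 'rV[R]_d) :
  open U -> smooth_on U (fun y : 'rV[R]_n => row_mx y u).
Proof.
move=> oU i k; rewrite (ord1 i); case: (split_ordP k) => l ->.
  by apply: (smooth_eq oU _ (@smooth_coord _ _ U l)) => y _; rewrite row_mxEl.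
by apply: (smooth_eq oU _ (@smooth_cst _ _ U (u 0 l))) => y _; rewrite row_mxEr.
Qed.

Lemma partials_row_mx (O : set 'rV[R]_(n + d)) (G : 'rV[R]_(n + d) -> R) s (y : 'rV[R]_n) (u : 'rV[R]_d) :
  open O -> O (row_mx y u) ->
  partials s (fun z => G (row_mx z u)) y = partials [seq lshift d i | i <- s] G (row_mx y u).
Proof.
move=> oO; have oU : open [set z : 'rV[R]_n | setT z /\ O (row_mx z u)].
  by apply: open_preimage_open => //; [exact: openT|apply: smooth_on_row_mxl; exact: openT].
elim: s y => [//|i s IHs] y Oy /=.
apply: etrans (derive_on_open (g := fun z => partials [seq lshift d i | i <- s] G (row_mx z u)) _ oU _ _) _.
- by [].
- by move=> z [_ Oz]; exact: IHs.
exact: derive_row_mx.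
Qed.

(** With the parameter frozen, derivatives in the point variables are partial derivatives of [G] on
    the product space. These are smooth in both arguments, hence in [u] for fixed [y]. *)
Lemma smooth_parametric_partials (O : set 'rV[R]_(n + d)) (V : set 'rV[R]_d)
    (G : 'rV[R]_(n + d) -> R) s (y : 'rV[R]_n) :
  open O -> open V -> smooth O G -> (forall u, V u -> O (row_mx y u)) ->
  smooth V (fun u => partials s (fun z => G (row_mx z u)) y).
Proof.
move=> oO oV sG VO.
apply: (smooth_eq oV (f := fun u => partials [seq lshift d i | i <- s] G (row_mx y u))).
  by move=> u Vu; rewrite (partials_row_mx _ _ oO) //; exact: VO.
apply: (@smooth_comp _ _ _ V O _ (fun u => row_mx y u)) => //; last exact: smooth_on_row_mxr.
exact: smooth_partials.
Qed.

End parametric_jets.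

(** * Jets of matrix functions and their polynomial representatives *)

Section jets_of_matrix_functions.
Context {R : realType} {n m : nat}.

Definition partials_mx p q (s : seq 'I_n) (f : 'rV[R]_n -> 'M[R]_(p, q)) (y : 'rV[R]_n) :
  'M[R]_(p, q) := \matrix_(i, j) partials s (fun z => f z i j) y.

Lemma partials_mx_lmul p q r (U : set 'rV[R]_n) s (A : 'M[R]_(p, q))
    (f : 'rV[R]_n -> 'M[R]_(q, r)) (y : 'rV[R]_n) : open U -> U y -> smooth_on U f ->
  partials_mx s (fun z => A *m f z) y = A *m partials_mx s f y.
Proof.
move=> oU Uy sf; apply/matrixP => i j; rewrite !mxE.
apply: etrans (partials_on_open (g := fun z => \sum_k A i k * f z k j) s oU Uy _) _.
  by move=> z _; rewrite mxE.
rewrite (partials_sum oU Uy) => [|k]; last first.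
  by apply: smooth_mul => //; [exact: smooth_cst|exact: sf].
apply: eq_bigr => k _; rewrite mxE.
by apply: (partials_scale oU Uy); exact: sf.
Qed.

Lemma partials_mx_rmul p q r (U : set 'rV[R]_n) s (B : 'M[R]_(q, r))
    (f : 'rV[R]_n -> 'M[R]_(p, q)) (y : 'rV[R]_n) : open U -> U y -> smooth_on U f ->
  partials_mx s (fun z => f z *m B) y = partials_mx s f y *m B.
Proof.
move=> oU Uy sf; apply/matrixP => i j; rewrite !mxE.
apply: etrans (partials_on_open (g := fun z => \sum_k B k j * f z i k) s oU Uy _) _.
  by move=> z _; rewrite mxE; apply: eq_bigr => k _; rewrite mulrC.
rewrite (partials_sum oU Uy) => [|k]; last first.
  by apply: smooth_mul => //; [exact: smooth_cst|exact: sf].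
apply: eq_bigr => k _; rewrite mxE mulrC.
by apply: (partials_scale oU Uy); exact: sf.
Qed.

Lemma partials_mx_on p q (U : set 'rV[R]_n) s (f g : 'rV[R]_n -> 'M[R]_(p, q)) (y : 'rV[R]_n) :
  open U -> U y -> (forall z, U z -> f z = g z) -> partials_mx s f y = partials_mx s g y.
Proof.
move=> oU Uy fg; apply/matrixP => i j; rewrite !mxE.
by apply: (partials_on_open s oU Uy) => z Uz; rewrite fg.
Qed.

Definition jet_coef (u : jet_space R n m) (a : multi_index n m) : 'M[R]_n :=
  \matrix_(i, j) u 0 (enum_rank (a, (i, j))).

Definition jet_of_coef (c : multi_index n m -> 'M[R]_n) : jet_space R n m :=
  \row_k c (enum_val k).1 (enum_val k).2.1 (enum_val k).2.2.

Lemma jet_of_coefK (c : multi_index n m -> 'M[R]_n) a : jet_coef (jet_of_coef c) a = c a.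
Proof. by apply/matrixP => i j; rewrite !mxE enum_rankK. Qed.

Lemma jet_coefK (u : jet_space R n m) : jet_of_coef (jet_coef u) = u.
Proof.
apply/rowP => k; rewrite !mxE; case E : (enum_val k) => [a [i j]] /=.
by rewrite -E enum_valK.
Qed.

Lemma jet_coef_inj (u v : jet_space R n m) : (forall a, jet_coef u a = jet_coef v a) -> u = v.
Proof.
move=> uv; rewrite -[u]jet_coefK -[v]jet_coefK; apply/rowP => k.
by rewrite !mxE; have /matrixP := uv (enum_val k).1; move=> /(_ (enum_val k).2.1 (enum_val k).2.2); rewrite !mxE.
Qed.

Definition jet_poly (y : 'rV[R]_n) (u : jet_space R n m) : 'rV[R]_n -> 'M[R]_n :=
  taylor y (jet_coef u).

Definition jet_at (y : 'rV[R]_n) (f : 'rV[R]_n -> 'M[R]_n) : jet_space R n m :=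
  jet_of_coef (fun a => partials_mx (word a) f y).

Lemma jet_coef_at y f a : jet_coef (jet_at y f) a = partials_mx (word a) f y.
Proof. exact: jet_of_coefK. Qed.

Lemma mjeq_jet_poly (U : set 'rV[R]_n) (y : 'rV[R]_n) f : open U -> U y -> smooth_on U f ->
  mjeq m y f (jet_poly y (jet_at y f)).
Proof.
move=> oU Uy sf; have := mjeq_taylor (m := m) oU Uy sf.
rewrite /jet_poly; congr (mjeq _ _ _ (taylor _ _)).
by apply/funext => a; rewrite jet_coef_at.
Qed.

Lemma jet_at_poly y (u : jet_space R n m) : jet_at y (jet_poly y u) = u.
Proof.
by apply: jet_coef_inj => a; rewrite jet_coef_at; apply/matrixP => i j; rewrite mxE partials_taylor.
Qed.

Lemma jet_at_mjeq y f g : mjeq m y f g -> jet_at y f = jet_at y g.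
Proof.
move=> fg; apply: jet_coef_inj => a; rewrite !jet_coef_at; apply/matrixP => i j.
by rewrite !mxE; apply: (fg i j); exact: size_word.
Qed.

Lemma jet_at_on (U : set 'rV[R]_n) (y : 'rV[R]_n) f g : open U -> U y ->
  (forall z, U z -> f z = g z) -> jet_at y f = jet_at y g.
Proof. by move=> oU Uy fg; apply/jet_at_mjeq/(mjeq_on oU Uy). Qed.

Lemma jet_poly_val (U : set 'rV[R]_n) (y : 'rV[R]_n) f : open U -> U y -> smooth_on U f ->
  jet_poly y (jet_at y f) y = f y.
Proof. by move=> oU Uy sf; rewrite -(mjeq_val (mjeq_jet_poly oU Uy sf)). Qed.

Lemma smooth_on_jet_poly (U : set 'rV[R]_n) y u : open U -> smooth_on U (jet_poly y u).
Proof. exact: smooth_on_taylor. Qed.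

Lemma smooth_on_jet_of_coef N (V : set 'rV[R]_N) (c : 'rV[R]_N -> multi_index n m -> 'M[R]_n) :
  open V -> (forall a, smooth_on V (c ^~ a)) -> smooth_on V (fun u => jet_of_coef (c u)).
Proof.
move=> oV sc i k; rewrite (ord1 i).
by apply: (smooth_eq oV _ (sc _ _ _ : smooth _ _)) => u _; rewrite mxE.
Qed.

Lemma smooth_on_jet_coef N (V : set 'rV[R]_N) (g : 'rV[R]_N -> jet_space R n m) a :
  open V -> smooth_on V g -> smooth_on V (fun u => jet_coef (g u) a).
Proof.
move=> oV sg i j.
by apply: (smooth_eq oV _ (sg 0 _ : smooth _ _)) => u _; rewrite mxE.
Qed.

End jets_of_matrix_functions.

(** * Action of matrix operations on jets *)

Section prolongation.
Context {R : realType} {n : nat}.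

(* F acts on smooth germs of D-valued maps, and on their jets. *)
Record jet_operation (D : set 'M[R]_n) (F : 'M[R]_n -> 'M[R]_n) : Prop := JetOperation {
  jet_op_open : forall N (U : set 'rV[R]_N) (f : 'rV[R]_N -> 'M[R]_n),
    open U -> smooth_on U f -> open [set y | U y /\ D (f y)];
  jet_op_smooth : forall N (U : set 'rV[R]_N) (f : 'rV[R]_N -> 'M[R]_n),
    open U -> smooth_on U f -> (forall y, U y -> D (f y)) -> smooth_on U (fun y => F (f y));
  jet_op_mjeq : forall N m (U : set 'rV[R]_N) (y : 'rV[R]_N) (f g : 'rV[R]_N -> 'M[R]_n),
    open U -> U y -> smooth_on U f -> smooth_on U g ->
    (forall z, U z -> D (f z)) -> (forall z, U z -> D (g z)) ->
    mjeq m y f g -> mjeq m y (fun z => F (f z)) (fun z => F (g z)) }.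

(** The action on a jet is computed on its Taylor representative; [prolong_jet_at] shows that any
    smooth representative gives the same result. *)
Definition prolong m (y : 'rV[R]_n) (F : 'M[R]_n -> 'M[R]_n) (u : jet_space R n m) :
  jet_space R n m := jet_at y (fun z => F (jet_poly y u z)).

Lemma prolong_jet_at D F m (U : set 'rV[R]_n) (y : 'rV[R]_n) (f : 'rV[R]_n -> 'M[R]_n) :
  jet_operation D F -> open U -> U y -> smooth_on U f -> D (f y) ->
  prolong y F (jet_at y f : jet_space R n m) = jet_at y (fun z => F (f z)).
Proof.
move=> hF oU Uy sf Df; apply/esym/jet_at_mjeq.
pose g := jet_poly y (jet_at y f : jet_space R n m).
have sg : smooth_on U g by exact: smooth_on_jet_poly.
have fg : mjeq m y f g by exact: mjeq_jet_poly sf.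
(* Congruence is preserved by [F] only for germs with values in [D]. Since [f] and its Taylor
   polynomial [g] agree at [y], both take values in [D] on a common neighborhood. *)
pose U1 := [set z | U z /\ D (f z)]; have oU1 : open U1 := jet_op_open hF oU sf.
have sg1 : smooth_on U1 g by apply: smooth_on_sub sg => z [].
pose U2 := [set z | U1 z /\ D (g z)]; have oU2 : open U2 := jet_op_open hF oU1 sg1.
have U2y : U2 y by split; [split|rewrite -(mjeq_val fg)].
apply: (jet_op_mjeq hF oU2 U2y) => //.
- by apply: smooth_on_sub sf => z [[]].
- by apply: smooth_on_sub sg => z [[]].
- by move=> z [[]].
- by move=> z [].
Qed.

Definition jet_dom m (y : 'rV[R]_n) (D : set 'M[R]_n) : set (jet_space R n m) :=
  [set u | D (jet_poly y u y)].

Lemma open_jet_dom D F m (y : 'rV[R]_n) : jet_operation D F -> open (jet_dom (m := m) y D).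
Proof.
move=> hF; rewrite (_ : jet_dom _ _ = [set u | setT u /\ D (jet_poly y u y)]).
  apply: (jet_op_open hF); first exact: openT.
  apply: smooth_taylor; [exact: openT|exact: smooth_on_cst|exact: smooth_on_cst|].
  by move=> a; apply: smooth_on_jet_coef; [exact: openT|exact: smooth_on_id].
by apply/seteqP; split=> u //= [].
Qed.

Lemma smooth_prolong D F m (y : 'rV[R]_n) : jet_operation D F ->
  smooth_on (jet_dom (m := m) y D) (prolong y F).
Proof.
move=> hF; have oV : open (jet_dom (m := m) y D) := open_jet_dom hF.
set V := jet_dom y D in oV *.
(* The jet becomes a variable: [P] is a polynomial jointly in the point and in the coefficients. *)
pose P (z : 'rV[R]_(n + #|jet_index n m|)) : 'M[R]_n := jet_poly y (rsubmx z) (lsubmx z).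
have sl : smooth_on setT (fun z : 'rV[R]_(n + #|jet_index n m|) => lsubmx z).
  move=> i j; rewrite (ord1 i).
  by apply: (smooth_eq openT _ (@smooth_coord _ _ setT _)) => z _; rewrite mxE.
have sr : smooth_on setT (fun z : 'rV[R]_(n + #|jet_index n m|) => rsubmx z).
  move=> i j; rewrite (ord1 i).
  by apply: (smooth_eq openT _ (@smooth_coord _ _ setT _)) => z _; rewrite mxE.
have sP : smooth_on setT P.
  apply: smooth_taylor; [exact: openT|exact: smooth_on_cst|exact: sl|].
  by move=> a; apply: smooth_on_jet_coef; [exact: openT|exact: sr].
pose O := [set z | setT z /\ D (P z)].
have oO : open O by apply: (jet_op_open hF) => //; exact: openT.
have sFP : smooth_on O (fun z => F (P z)).
  apply: (jet_op_smooth hF oO); last by move=> z [].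
  by apply: smooth_on_sub sP => z _.
apply: smooth_on_jet_of_coef => // a i j.
have VO u : V u -> O (row_mx y u).
  by move=> Vu; split => //; rewrite /P row_mxKl row_mxKr.
have := smooth_parametric_partials (word a) oO oV (sFP i j) VO.
apply: smooth_eq => // u Vu; rewrite mxE; congr (partials _ _ _).
by apply/funext => z; rewrite /P row_mxKl row_mxKr.
Qed.

End prolongation.

(** * The Cayley chart of almost complex structures *)

Section cayley_transform.
Context {R : realType} {n : nat}.
Implicit Types (A Q S : 'M[R]_n).

Definition cayley A : 'M[R]_n := (1%:M - A) *m invmx (1%:M + A).

Lemma cayleyD A : 1%:M + A \in unitmx -> 1%:M + cayley A = 2 *: invmx (1%:M + A).
Proof.
move=> uA; rewrite /cayley -{1}(mulmxV uA) -mulmxDl.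
by rewrite addrACA subrr addr0 -mulr2n -scaler_nat -scalemxAl mul1mx.
Qed.

Lemma cayley_unit A : 1%:M + A \in unitmx -> 1%:M + cayley A \in unitmx.
Proof.
move=> uA; rewrite cayleyD // -mul_scalar_mx unitmx_mul unitmx_inv uA andbT.
by rewrite unitmxE det_scalar unitfE expf_neq0 // pnatr_eq0.
Qed.

(** The identity [1 + cayley A = 2 (1 + A)^-1] gives both the denominator of the second transform
    and, after subtracting 1, its numerator. *)
Lemma cayleyK A : 1%:M + A \in unitmx -> cayley (cayley A) = A.
Proof.
move=> uA; have ucA := cayley_unit uA.
apply: (can_inj (mulmxK ucA)); rewrite /cayley mulmxKV //.
rewrite -/(cayley A) cayleyD // -scalemxAr.
have {1}-> : cayley A = 2 *: invmx (1%:M + A) - 1%:M by rewrite -cayleyD // addrC addKr.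
have -> : A *m invmx (1%:M + A) = 1%:M - invmx (1%:M + A).
  apply/eqP; rewrite eq_sym subr_eq; apply/eqP.
  by rewrite -{1}(mulmxV uA) mulmxDl mul1mx addrC.
by move: (invmx _) => X; apply/matrixP => i j; rewrite !mxE; ring.
Qed.

(** When [S *m S = - 1], the right-hand condition says that [S *m Q] squares to [- 1]. Clearing the
    denominators on both sides turns anticommutation into [V *m S *m U + U *m S *m V = 0], where the
    terms of degree one in [Q] cancel and [2 (S - Q *m S *m Q)] is left. *)
Lemma cayley_anticommute S Q : 1%:M + Q \in unitmx ->
  cayley Q *m S = - (S *m cayley Q) <-> Q *m S *m Q = S.
Proof.
move=> uQ; set U := 1%:M + Q; set V := 1%:M - Q.
have UV : U *m V = V *m U.
  rewrite /U /V mulmxDl mulmxBl !mul1mx mulmxBr mulmxDr !mulmx1.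
  by move: (Q *m Q) => X; apply/matrixP => i j; rewrite !mxE; ring.
have UcU : U *m cayley Q = V by rewrite /cayley mulmxA -/U -/V UV mulmxK.
have cU : cayley Q *m U = V by rewrite /cayley mulmxKV.
have E1 : (cayley Q *m S = - (S *m cayley Q)) <-> V *m S *m U = - (U *m S *m V).
  split=> [h|h].
    have -> : V *m S *m U = U *m (cayley Q *m S) *m U by rewrite mulmxA UcU.
    by rewrite h mulmxN mulNmx mulmxA -(mulmxA _ (cayley Q) U) cU.
  apply: (can_inj (mulmxK uQ)); rewrite mulNmx -(mulmxA S) cU.
  apply: (can_inj (mulKmx uQ)); rewrite -/U mulmxN (mulmxA U (cayley Q *m S) U).
  rewrite (mulmxA U (cayley Q) S) UcU (mulmxA U S V).
  exact: h.
have E2 : V *m S *m U = S + S *m Q - Q *m S - Q *m S *m Q.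
  rewrite /V /U mulmxBl mul1mx mulmxDr mulmx1 mulmxBl.
  by move: (S *m Q) (Q *m S) (Q *m S *m Q) => X Y Z; apply/matrixP => i j; rewrite !mxE; ring.
have E3 : U *m S *m V = S - S *m Q + Q *m S - Q *m S *m Q.
  rewrite /V /U mulmxDl mul1mx mulmxBr mulmx1 mulmxDl.
  by move: (S *m Q) (Q *m S) (Q *m S *m Q) => X Y Z; apply/matrixP => i j; rewrite !mxE; ring.
apply: iff_trans E1 _; rewrite E2 E3.
move: (S *m Q) (Q *m S) (Q *m S *m Q) => X Y Z; split=> h; apply/matrixP => i j.
  by move/matrixP/(_ i j): h; rewrite !mxE; lra.
by move/matrixP/(_ i j): h; rewrite !mxE; lra.
Qed.

(** The four constant matrices make both directions of the Cayley chart, [fwd_op] and [bwd_op],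
    instances of one operation. *)
Definition cayley_op (A B C D : 'M[R]_n) (X : 'M[R]_n) : 'M[R]_n :=
  C *m cayley (A *m X *m B) *m D.

Definition cayley_dom (A B : 'M[R]_n) : set 'M[R]_n :=
  [set X | 1%:M + A *m X *m B \in unitmx].

Lemma jet_operation_cayley A B (C D : 'M[R]_n) :
  jet_operation (cayley_dom A B) (cayley_op A B C D).
Proof.
have sc N (U : set 'rV[R]_N) (M : 'M[R]_n) : smooth_on U (fun=> M) by exact: smooth_on_cst.
have sAB N (U : set 'rV[R]_N) f : open U -> smooth_on U f ->
    smooth_on U (fun y => A *m f y *m B).
  by move=> oU sf; do 2![apply: smooth_on_mulmx => //].
have sp N (U : set 'rV[R]_N) f : open U -> smooth_on U f ->
    smooth_on U (fun y => 1%:M + A *m f y *m B).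
  by move=> oU sf; apply: smooth_on_add => //; exact: sAB.
have sm N (U : set 'rV[R]_N) f : open U -> smooth_on U f ->
    smooth_on U (fun y => 1%:M - A *m f y *m B).
  by move=> oU sf; apply: smooth_on_add => //; apply: smooth_on_opp => //; exact: sAB.
split.
- by move=> N U f oU sf; apply: open_unitmx => //; exact: sp.
- move=> N U f oU sf Df; do 2!apply: smooth_on_mulmx => //.
  apply: smooth_on_mulmx => //; first exact: sm.
  by apply: smooth_on_invmx => //; exact: sp.
- move=> N m U y f g oU Uy sf sg Df Dg fg.
  have jAB : mjeq m y (fun z => A *m f z *m B) (fun z => A *m g z *m B).
    apply: (mjeq_mulmx oU Uy) => //; try by apply: smooth_on_mulmx.
    by apply: (mjeq_mulmx oU Uy).
  have jp : mjeq m y (fun z => 1%:M + A *m f z *m B) (fun z => 1%:M + A *m g z *m B).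
    by apply: (mjeq_add oU Uy) => //; exact: sAB.
  have jm : mjeq m y (fun z => 1%:M - A *m f z *m B) (fun z => 1%:M - A *m g z *m B).
    apply: (mjeq_add oU Uy) => //; try by apply: smooth_on_opp => //; exact: sAB.
    have E h : smooth_on U h -> mjeq m y (fun z => - (A *m h z *m B)) (fun z => - 1%:M *m (A *m h z *m B)).
      by move=> _; apply: (mjeq_on oU Uy) => z _; rewrite mulNmx mul1mx.
    apply: mjeq_trans (E f sf) _; apply: mjeq_trans _ (mjeq_sym (E g sg)).
    by apply: (mjeq_mulmx oU Uy) => //; exact: sAB.
  have sVf : smooth_on U (fun z => invmx (1%:M + A *m f z *m B)).
    by apply: smooth_on_invmx => //; exact: sp.
  have sVg : smooth_on U (fun z => invmx (1%:M + A *m g z *m B)).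
    by apply: smooth_on_invmx => //; exact: sp.
  have jc : mjeq m y (fun z => cayley (A *m f z *m B)) (fun z => cayley (A *m g z *m B)).
    apply: (mjeq_mulmx oU Uy) => //; try exact: sm.
    by apply: (mjeq_invmx oU Uy) => //; exact: sp.
  have scf : smooth_on U (fun z => cayley (A *m f z *m B)).
    by apply: smooth_on_mulmx => //; exact: sm.
  have scg : smooth_on U (fun z => cayley (A *m g z *m B)).
    by apply: smooth_on_mulmx => //; exact: sm.
  apply: (mjeq_mulmx oU Uy) => //; try by apply: smooth_on_mulmx.
  by apply: (mjeq_mulmx oU Uy).
Qed.

End cayley_transform.

(** * Antilinear and block triangular matrices in dimension 4 *)

Section linear_algebra_in_dimension_4.
Context {R : realType}.
Implicit Types (A B K J : 'M[R]_4).

(** Acting on row vectors, it sends e_0 to e_1, e_1 to - e_0, e_2 to e_3 and e_3 to - e_2; the first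
    two coordinates span a complex line. *)
Definition Jstd : 'M[R]_4 := \matrix_(i, j)
  ((((i == 0 :> nat) && (j == 1 :> nat)) || ((i == 2 :> nat) && (j == 3 :> nat)))%:R -
   (((i == 1 :> nat) && (j == 0 :> nat)) || ((i == 3 :> nat) && (j == 2 :> nat)))%:R).

(* the rows of [evens *m Jstd] are those of index 1 and 3 *)
Definition evens : 'M[R]_(2, 4) := \matrix_(i, j) (j == i.*2 :> nat)%:R.

Let P := evens.
Let S := Jstd.

Lemma ord4P (Q : 'I_4 -> Prop) : Q (inord 0) -> Q (inord 1) -> Q (inord 2) -> Q (inord 3) ->
  forall i, Q i.
Proof.
move=> Q0 Q1 Q2 Q3 i.
have [k ki ->] : exists2 k, (k < 4)%N & i = inord k by exists i => //; rewrite inord_val.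
by case: k ki => [|[|[|[|]]]].
Qed.

Lemma sum4 (f : 'I_4 -> R) :
  \sum_i f i = f (inord 0) + f (inord 1) + f (inord 2) + f (inord 3).
Proof.
rewrite !big_ord_recr big_ord0 /= add0r.
by congr (f _ + f _ + f _ + f _); apply: val_inj; rewrite /= inordK.
Qed.

Lemma sum2 (f : 'I_2 -> R) : \sum_i f i = f (inord 0) + f (inord 1).
Proof.
rewrite !big_ord_recr big_ord0 /= add0r.
by congr (f _ + f _); apply: val_inj; rewrite /= inordK.
Qed.

Lemma ord2P (Q : 'I_2 -> Prop) : Q (inord 0) -> Q (inord 1) -> forall i, Q i.
Proof.
move=> Q0 Q1 i.
have [k ki ->] : exists2 k, (k < 2)%N & i = inord k by exists i => //; rewrite inord_val.
by case: k ki => [|[|]].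
Qed.

Lemma Jstd_sq : S *m S = - 1%:M.
Proof.
apply/matrixP; elim/ord4P; elim/ord4P;
by rewrite !mxE sum4 !mxE -?val_eqE /= !inordK //= ?subr0 ?sub0r ?mulr0 ?mul0r ?mulr1 ?mul1r ?addr0 ?add0r ?oppr0.
Qed.

Lemma Jstd_tr : S^T = - S.
Proof.
apply/matrixP; elim/ord4P; elim/ord4P;
by rewrite !mxE !inordK //= ?subr0 ?sub0r ?opprK ?oppr0.
Qed.

Lemma evens_mul_tr : P *m P^T = 1%:M.
Proof.
apply/matrixP; elim/ord2P; elim/ord2P;
by rewrite !mxE sum4 !mxE -?val_eqE /= !inordK //= ?mulr0 ?mul0r ?mulr1 ?addr0 ?add0r.
Qed.

Lemma evens_Jstd_tr : P *m S *m P^T = 0.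
Proof.
apply/matrixP; elim/ord2P; elim/ord2P;
by rewrite !mxE !sum4 !mxE !sum4 !mxE !inordK //= ?(subr0, sub0r, mulr0, mul0r, mulr1, mul1r, addr0, add0r, oppr0).
Qed.

Lemma evens_odds : P^T *m P + (P *m S)^T *m (P *m S) = 1%:M.
Proof.
apply/matrixP; elim/ord4P; elim/ord4P;
by rewrite !mxE !sum2 !mxE !sum4 !mxE -?val_eqE /= !inordK //= ?(subr0, sub0r, mulr0, mul0r, mulr1, addr0, add0r, mulrNN, oppr0).
Qed.

Lemma Jstd_evens_tr : S *m P^T = - (P *m S)^T.
Proof. by rewrite trmx_mul -/S Jstd_tr mulNmx opprK. Qed.

Lemma Jstd_odds_tr : S *m (P *m S)^T = P^T.
Proof. by rewrite trmx_mul -/S Jstd_tr mulNmx mulmxN mulmxA Jstd_sq mulNmx opprK mul1mx. Qed.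

(* the matrix anticommuting with [Jstd] whose rows of even index are those of H *)
Definition antilinear (H : 'M[R]_(2, 4)) : 'M[R]_4 := P^T *m H - (P *m S)^T *m H *m S.

Lemma antilinear_anticommute H : antilinear H *m S = - (S *m antilinear H).
Proof.
rewrite /antilinear mulmxBl mulmxBr !mulmxA Jstd_odds_tr Jstd_evens_tr.
rewrite -[_ *m H *m S *m S]mulmxA Jstd_sq mulmxN mulmx1 opprK mulNmx opprB opprK addrC.
by rewrite addrC [RHS]addrC addrC.
Qed.

Lemma antilinear_evens H : P *m antilinear H = H.
Proof.
rewrite /antilinear mulmxBr !mulmxA evens_mul_tr mul1mx trmx_mul -/S Jstd_tr.
by rewrite mulNmx mulmxN mulmxA evens_Jstd_tr oppr0 !mul0mx subr0.
Qed.

(** By [evens_odds], the basis vectors of even index and their images under [Jstd] resolve the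
    identity; anticommutation determines [K] on the latter from its values on the former. *)
Lemma anticommute_antilinear K : K *m S = - (S *m K) -> K = antilinear (P *m K).
Proof.
move=> KS; rewrite /antilinear -!mulmxA KS !mulmxN opprK !mulmxA.
by rewrite -[(P *m S)^T *m P *m S]mulmxA -mulmxDl evens_odds mul1mx.
Qed.

(** For row vectors this says that [B] maps the plane of the first two coordinates to itself. In an
    adapted chart that plane is the tangent space of L. *)
Definition lower B : Prop := forall i j : 'I_4, (i < 2)%N -> (2 <= j)%N -> B i j = 0.

Definition firsts : 'M[R]_(2, 4) := \matrix_(i, j) (j == i :> nat)%:R.

Lemma sub_firsts p (A : 'M[R]_(p, 4)) :
  reflect (forall i (j : 'I_4), (2 <= j)%N -> A i j = 0) (A <= firsts)%MS.
Proof.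
apply: (iffP submxP) => [[D ->] i j j2|A0].
  rewrite mxE big1 // => k _; rewrite mxE; case: eqP => [jk|]; last by rewrite mulr0.
  by move: (ltn_ord k); rewrite -jk ltnNge j2.
exists (A *m firsts^T); apply/matrixP => i j; rewrite mxE sum2.
rewrite !mxE !sum4 !mxE; move: j; apply: ord4P; rewrite !inordK //=;
by rewrite ?(mulr0, mulr1, addr0, add0r) // A0 // inordK.
Qed.

Lemma lowerP B : lower B <-> (firsts *m B <= firsts)%MS.
Proof.
have E (i : 'I_2) (j : 'I_4) : (firsts *m B) i j = B (widen_ord (isT : 2 <= 4)%N i) j.
  rewrite mxE (bigD1 (widen_ord (isT : 2 <= 4)%N i)) //= big1 => [|k ki].
    by rewrite mxE eqxx mul1r addr0.
  rewrite mxE (_ : (k == i :> nat) = false) ?mul0r //.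
  by apply: contraNF ki => /eqP ki; apply/eqP/val_inj.
split=> [lB|/sub_firsts h i j i2 j2]; first by apply/sub_firsts => i j j2; rewrite E lB //=; exact: ltn_ord.
by rewrite -(h (Ordinal i2) j j2) E; congr (B _ _); apply: val_inj.
Qed.

Lemma lower_mul A B : lower A -> lower B -> lower (A *m B).
Proof.
move=> /lowerP lA /lowerP lB; apply/lowerP; rewrite mulmxA.
exact: submx_trans (submxMr _ lA) lB.
Qed.

Lemma lower_add A B : lower A -> lower B -> lower (A + B).
Proof. by move=> lA lB i j i2 j2; rewrite mxE lA // lB // addr0. Qed.

Lemma lower_opp A : lower A -> lower (- A).
Proof. by move=> lA i j i2 j2; rewrite mxE lA // oppr0. Qed.

Lemma lower1 : lower 1%:M.
Proof.
move=> i j i2 j2; rewrite mxE -val_eqE (_ : _ == _ = false) //.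
by apply/negbTE; rewrite neq_ltn (leq_trans i2 j2).
Qed.

Lemma lower_Jstd : lower S.
Proof.
by elim/ord4P; elim/ord4P; rewrite !inordK // => _ _; rewrite !mxE !inordK //= subr0.
Qed.

(** An invertible matrix that maps the plane [firsts] into itself maps it onto itself by equality of
    ranks, so the inverse preserves the plane too. *)
Lemma lower_inv A : A \in unitmx -> lower A -> lower (invmx A).
Proof.
move=> uA /lowerP lA; apply/lowerP.
have : (firsts <= firsts *m A)%MS.
  have /leqifP := mxrank_leqif_eq lA.
  rewrite mxrankMfree ?row_free_unit // ltnn; case: ifP => // /eqmxP h _.
  by rewrite h.
by move=> /(submxMr (invmx A)); rewrite mulmxK.
Qed.

Lemma lower_cayley A : 1%:M + A \in unitmx -> lower A -> lower (cayley A).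
Proof.
move=> uA lA; apply: lower_mul; first by apply: lower_add; [exact: lower1|exact: lower_opp].
by apply: lower_inv => //; apply: lower_add => //; exact: lower1.
Qed.

(* the rows of the frame are e_0, e_0 J, e_2, e_2 J *)
Definition complex_frame J : 'M[R]_4 := P^T *m P + (P *m S)^T *m P *m J.

Lemma complex_frameE J : J *m J = - 1%:M -> complex_frame J *m J = S *m complex_frame J.
Proof.
move=> JJ; rewrite /complex_frame mulmxDl mulmxDr -!mulmxA JJ mulmxN mulmx1.
rewrite !(mulmxA S) Jstd_evens_tr Jstd_odds_tr mulNmx mulmxN.
by rewrite [RHS]addrC mulmxA.
Qed.

Lemma evens_tr_mul i j : (P^T *m P) i j = (~~ odd i && (i == j))%:R.
Proof.
move: i j; elim/ord4P; elim/ord4P;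
by rewrite !mxE !sum2 !mxE -?val_eqE /= !inordK //= ?(mulr0, mul0r, mulr1, addr0, add0r).
Qed.

Lemma odds_tr_mul i j : ((P *m S)^T *m P) i j = (odd i && (j == i.-1 :> nat))%:R.
Proof.
move: i j; elim/ord4P; elim/ord4P;
by rewrite !mxE !sum2 !mxE !sum4 !mxE !inordK //= ?(subr0, sub0r, mulr0, mul0r, mulr1, mul1r, addr0, add0r, oppr0).
Qed.

Lemma complex_frame_entries J i j : complex_frame J i j =
  if odd i then J (inord i.-1) j else (i == j)%:R.
Proof.
rewrite /complex_frame mxE evens_tr_mul mxE.
under eq_bigr do rewrite odds_tr_mul.
case: (odd i) => /=; last first.
  by rewrite big1 ?addr0 // => k _; rewrite mul0r.
have i4 : (i.-1 < 4)%N by rewrite (leq_ltn_trans (leq_pred i)).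
rewrite add0r (bigD1 (inord i.-1)) //= inordK // eqxx mul1r big1 ?addr0 // => k ki.
rewrite (_ : (k == i.-1 :> nat) = false) ?mul0r //.
by apply: contraNF ki => /eqP <-; rewrite inord_val.
Qed.

Lemma lower_complex_frame J : lower J -> lower (complex_frame J).
Proof.
move=> lJ; elim/ord4P; elim/ord4P; rewrite !inordK // => _ _;
rewrite complex_frame_entries inordK //= -?val_eqE /= ?inordK //.
all: by apply: lJ; rewrite inordK.
Qed.

(** The frame is triangular with diagonal 1, J_01, 1, J_23. If J_01 or J_23 vanished, the block form
    of [J] would reduce a diagonal entry of [J *m J = - 1] to a real square equal to -1. *)
Lemma complex_frame_unit J : lower J -> J *m J = - 1%:M -> complex_frame J \in unitmx.
Proof.
move=> lJ JJ.
have sq (x : R) : x * x = -1 -> False by move=> h; have := sqr_ge0 x; rewrite expr2 h; lra.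
have J01 : J (inord 0) (inord 1) != 0.
  apply/eqP => h; have /matrixP/(_ (inord 0) (inord 0)) := JJ.
  rewrite !mxE sum4 eqxx h (lJ (inord 0) (inord 2)) ?inordK // (lJ (inord 0) (inord 3)) ?inordK //.
  by rewrite !mul0r !addr0 => /sq.
have J23 : J (inord 2) (inord 3) != 0.
  apply/eqP => h; have /matrixP/(_ (inord 2) (inord 2)) := JJ.
  rewrite !mxE sum4 eqxx h (lJ (inord 0) (inord 2)) ?inordK // (lJ (inord 1) (inord 2)) ?inordK //.
  by rewrite !mul0r !mulr0 !addr0 !add0r => /sq.
have trig : is_trig_mx (complex_frame J).
  apply/is_trig_mxP; elim/ord4P; elim/ord4P; rewrite !inordK // => _;
  rewrite complex_frame_entries inordK //= -?val_eqE /= ?inordK //;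
  by apply: lJ; rewrite inordK.
rewrite unitmxE unitfE det_trig //.
apply/prodf_neq0; elim/ord4P => _; rewrite complex_frame_entries inordK //= ?eqxx ?oner_eq0 //.
Qed.

End linear_algebra_in_dimension_4.

(** * The Cayley chart in a frame adapted to L *)

Section adapted_cayley_chart.
Context {R : realType}.
Variable G : 'M[R]_4.
Hypotheses (uG : G \in unitmx) (lG : lower G).
Implicit Types (X K : 'M[R]_4).

Let S : 'M[R]_4 := Jstd.

(* X is read in the frame G, where [Jstd] is the origin of the chart. *)
Definition fwd_op : 'M[R]_4 -> 'M[R]_4 := cayley_op (- S *m G) (invmx G) 1%:M 1%:M.
Definition fwd_dom : set 'M[R]_4 := cayley_dom (- S *m G) (invmx G).
Definition bwd_op : 'M[R]_4 -> 'M[R]_4 := cayley_op 1%:M 1%:M (invmx G *m S) G.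
Definition bwd_dom : set 'M[R]_4 := cayley_dom 1%:M 1%:M.

Lemma bwd_domE K : bwd_dom K <-> 1%:M + K \in unitmx.
Proof. by rewrite /bwd_dom /cayley_dom /= mul1mx mulmx1. Qed.

Lemma fwd_opE X : fwd_op X = cayley (- S *m G *m X *m invmx G).
Proof. by rewrite /fwd_op /cayley_op mul1mx mulmx1. Qed.

Lemma bwd_opE K : bwd_op K = invmx G *m S *m cayley K *m G.
Proof. by rewrite /bwd_op /cayley_op mul1mx mulmx1. Qed.

Lemma frame_bwd Q : - S *m G *m (invmx G *m S *m Q *m G) *m invmx G = Q.
Proof.
have -> : - S *m G *m (invmx G *m S *m Q *m G) *m invmx G =
    - S *m (G *m invmx G) *m S *m Q *m (G *m invmx G) by rewrite !mulmxA.
by rewrite !mulmxV // !mulmx1 mulNmx Jstd_sq opprK mul1mx.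
Qed.

Lemma frame_fwd X : invmx G *m S *m (- S *m G *m X *m invmx G) *m G = X.
Proof.
have -> : invmx G *m S *m (- S *m G *m X *m invmx G) *m G =
    invmx G *m (S *m - S) *m G *m X *m (invmx G *m G) by rewrite !mulmxA.
by rewrite mulVmx // mulmx1 mulmxN Jstd_sq opprK mulmx1 mulVmx // mul1mx.
Qed.

Lemma fwd_op_dom X : fwd_dom X -> bwd_dom (fwd_op X).
Proof. by move=> dX; apply/bwd_domE; rewrite fwd_opE; exact: cayley_unit. Qed.

Lemma bwd_op_dom K : bwd_dom K -> fwd_dom (bwd_op K).
Proof.
move=> /bwd_domE dK; rewrite /fwd_dom /cayley_dom /= bwd_opE frame_bwd.
exact: cayley_unit.
Qed.

Lemma fwd_opK X : fwd_dom X -> bwd_op (fwd_op X) = X.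
Proof. by move=> dX; rewrite bwd_opE fwd_opE cayleyK // frame_fwd. Qed.

Lemma bwd_opK K : bwd_dom K -> fwd_op (bwd_op K) = K.
Proof. by move=> /bwd_domE dK; rewrite fwd_opE bwd_opE frame_bwd cayleyK. Qed.

(** With [Q = - S *m G *m X *m invmx G], the equation [X *m X = - 1] becomes [Q *m S *m Q = S], to
    which [cayley_anticommute] applies. *)
Lemma fwd_op_anticommute X : fwd_dom X -> X *m X = - 1%:M ->
  fwd_op X *m S = - (S *m fwd_op X).
Proof.
move=> dX XX; rewrite fwd_opE; apply/cayley_anticommute => //.
have -> : - S *m G *m X *m invmx G *m S *m (- S *m G *m X *m invmx G) =
  - S *m G *m X *m invmx G *m (S *m - S) *m G *m X *m invmx G by rewrite !mulmxA.
rewrite mulmxN Jstd_sq opprK mulmx1.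
have -> : - S *m G *m X *m invmx G *m G *m X *m invmx G =
  - S *m G *m X *m (invmx G *m G) *m X *m invmx G by rewrite !mulmxA.
rewrite mulVmx // mulmx1 -(mulmxA _ X X) XX mulmxN mulmx1 mulNmx.
by rewrite -mulmxA mulmxV // mulmx1 opprK.
Qed.

Lemma bwd_op_sq K : bwd_dom K -> K *m S = - (S *m K) ->
  bwd_op K *m bwd_op K = - 1%:M.
Proof.
move=> /bwd_domE dK KS; rewrite bwd_opE; set Q := cayley K.
have QSQ : Q *m S *m Q = S.
  by apply/cayley_anticommute; [exact: cayley_unit|rewrite cayleyK].
have -> : invmx G *m S *m Q *m G *m (invmx G *m S *m Q *m G) =
  invmx G *m S *m Q *m (G *m invmx G) *m S *m Q *m G by rewrite !mulmxA.
rewrite mulmxV // mulmx1.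
have -> : invmx G *m S *m Q *m S *m Q *m G = invmx G *m S *m (Q *m S *m Q) *m G.
  by rewrite !mulmxA.
by rewrite QSQ -(mulmxA _ S S) Jstd_sq mulmxN mulmx1 mulNmx mulVmx.
Qed.

Lemma lower_fwd_op X : fwd_dom X -> lower X -> lower (fwd_op X).
Proof.
move=> dX lX; rewrite fwd_opE; apply: lower_cayley => //.
do 3?[apply: lower_mul => //]; last exact: lower_inv.
exact/lower_opp/lower_Jstd.
Qed.

Lemma lower_bwd_op K : bwd_dom K -> lower K -> lower (bwd_op K).
Proof.
move=> /bwd_domE dK lK; rewrite bwd_opE; apply: lower_mul => //.
apply: lower_mul; last exact: lower_cayley.
by apply: lower_mul; [exact: lower_inv|exact: lower_Jstd].
Qed.

(** If [G] conjugates [X] to [Jstd], the matrix to be transformed is the identity, and [1 + 1] is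
    invertible. *)
Lemma fwd_dom_center X : G *m X = S *m G -> fwd_dom X.
Proof.
move=> GX; rewrite /fwd_dom /cayley_dom /= -(mulmxA _ G X) GX mulmxA mulNmx Jstd_sq opprK.
rewrite mul1mx mulmxV // -mulr2n -scaler_nat -mul_scalar_mx mulmx1.
by rewrite unitmxE det_scalar unitfE expf_neq0 // pnatr_eq0.
Qed.

End adapted_cayley_chart.

(** * Free coordinates on antilinear jets *)

Section free_coordinates.
Context {R : realType} {m : nat}.

(** These multi-indices differentiate along L only; the corresponding derivatives of a function that
    vanishes on L vanish at its points. *)
Definition tangential (a : multi_index 4 m) : bool :=
  [forall i : 'I_4, (2 <= i)%N ==> (val a i == 0 :> nat)].

(* entries of the rows of even index of the coefficients of an antilinear jet
   which are not forced to vanish by the condition along [snd2 y = 0] *)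
Definition free_coord (x : multi_index 4 m * ('I_2 * 'I_4)) : bool :=
  ~~ [&& x.2.1 == 0 :> nat, (2 <= x.2.2)%N & tangential x.1].

Definition free_index : finType := {x | free_coord x}.

Definition jet_of_free (v : 'rV[R]_#|free_index|) : jet_space R 4 m :=
  jet_of_coef (fun a => antilinear (\matrix_(i, l)
    oapp (fun x : free_index => v 0 (enum_rank x)) 0 (insub (a, (i, l))))).

Definition free_of_jet (u : jet_space R 4 m) : 'rV[R]_#|free_index| :=
  \row_k let x := val (enum_val k : free_index) in
    (evens *m jet_coef u x.1) x.2.1 x.2.2.

(** Both conditions are linear in the coefficients: this is the linear space to which the Cayley
    chart maps the jets of structures. *)
Definition antilinear_jet (u : jet_space R 4 m) : Prop := forall a,
  jet_coef u a *m Jstd = - (Jstd *m jet_coef u a) /\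
  (tangential a -> lower (jet_coef u a)).

Lemma evens_mulE (K : 'M[R]_4) i l : (evens *m K) i l = K (inord i.*2) l.
Proof.
move: i; apply: ord2P; rewrite mxE sum4 !mxE !inordK //=;
by rewrite ?(mul0r, mul1r, addr0, add0r).
Qed.

Lemma antilinearE (H : 'M[R]_(2, 4)) i j : antilinear H i j =
  if odd i then (if odd j then - H (inord i./2) (inord j.-1) else H (inord i./2) (inord j.+1))
  else H (inord i./2) j.
Proof.
have E1 k : (evens^T *m H) i k = if odd i then 0 else H (inord i./2) k.
  rewrite mxE sum2 !mxE; move: i; apply: ord4P; rewrite !inordK //=;
  by rewrite ?(mul0r, mul1r, addr0, add0r).
have E2 k : ((evens *m Jstd)^T *m H) i k = if odd i then H (inord i./2) k else 0.
  rewrite mxE sum2 !mxE !sum4 !mxE; move: i E1; apply: ord4P => _; rewrite !inordK //=;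
  by rewrite ?(subr0, sub0r, mulr0, mul0r, mulr1, mul1r, addr0, add0r, oppr0).
have E3 : ((evens *m Jstd)^T *m H *m Jstd) i j =
   if odd i then (if odd j then H (inord i./2) (inord j.-1) else - H (inord i./2) (inord j.+1)) else 0.
  rewrite mxE sum4 !E2 !mxE; move: j; apply: ord4P; rewrite !inordK //=;
  by case: (odd i); rewrite ?(subr0, sub0r, mulr0, mul0r, mulr1, mulrN1, addr0, add0r, oppr0).
rewrite mxE E1 mxE E3; case: (odd i); last by rewrite subr0.
by case: (odd j); rewrite sub0r ?opprK.
Qed.

(** Row 1 of [antilinear H] is minus its row 0 times [Jstd], and [Jstd] exchanges the last two
    columns up to sign. Vanishing of row 0 there is thus enough, and each tangential multi-index
    costs two coordinates. *)
Lemma lower_antilinear (H : 'M[R]_(2, 4)) :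
  (forall (i : 'I_2) (l : 'I_4), i == 0 :> nat -> (2 <= l)%N -> H i l = 0) -> lower (antilinear H).
Proof.
move=> H0; elim/ord4P; elim/ord4P; rewrite !inordK // => _ _;
by rewrite antilinearE !inordK //= ?H0 ?oppr0 ?inordK.
Qed.

Lemma antilinear_jet_of_free v : antilinear_jet (jet_of_free v).
Proof.
move=> a; rewrite /jet_of_free jet_of_coefK; split; first exact: antilinear_anticommute.
move=> ta; apply: lower_antilinear => i l i0 l2; rewrite mxE insubF //.
by rewrite /free_coord /= i0 l2 ta.
Qed.

Lemma jet_of_freeK v : free_of_jet (jet_of_free v) = v.
Proof.
apply/rowP => k; rewrite mxE; set x := enum_val k.
rewrite /jet_of_free jet_of_coefK antilinear_evens mxE -!surjective_pairing.
by rewrite valK /= /x enum_valK.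
Qed.

Lemma free_of_jetK u : antilinear_jet u -> jet_of_free (free_of_jet u) = u.
Proof.
move=> au; apply: jet_coef_inj => a; rewrite /jet_of_free jet_of_coefK.
have [aa lu] := au a; rewrite [RHS](anticommute_antilinear aa); congr (antilinear _).
apply/matrixP => i l; rewrite mxE; case: insubP => [x _ xE|] /=.
  by rewrite mxE enum_rankK xE.
rewrite /free_coord negbK /= => /and3P[/eqP i0 l2 ta].
by rewrite evens_mulE lu // inordK i0.
Qed.

Lemma smooth_jet_of_free : smooth_on setT jet_of_free.
Proof.
apply: smooth_on_jet_of_coef; first exact: openT.
have oT := @openT 'rV[R]_#|free_index|.
move=> a.
have sH : smooth_on setT (fun v : 'rV[R]_#|free_index| => \matrix_(i < 2, l < 4)
    oapp (fun x : free_index => v 0 (enum_rank x)) 0 (insub (a, (i, l)))).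
  move=> i l; case E : (insub (a, (i, l)) : option free_index) => [x|].
    by apply: (smooth_eq oT _ (@smooth_coord _ _ setT (enum_rank x))) => v _; rewrite mxE E.
  by apply: (smooth_eq oT _ (@smooth_cst _ _ setT 0)) => v _; rewrite mxE E.
apply: smooth_on_add => //; first by apply: smooth_on_mulmx => //; exact: smooth_on_cst.
apply: smooth_on_opp => //; apply: smooth_on_mulmx => //; last exact: smooth_on_cst.
by apply: smooth_on_mulmx => //; exact: smooth_on_cst.
Qed.

Lemma smooth_free_of_jet (U : set (jet_space R 4 m)) : open U -> smooth_on U free_of_jet.
Proof.
move=> oU i k; rewrite (ord1 i).
have sE a : smooth_on U (fun u => evens *m jet_coef u a).
  apply: smooth_on_mulmx => //; first exact: smooth_on_cst.
  by apply: smooth_on_jet_coef => //; exact: smooth_on_id.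
pose x := val (enum_val k : free_index).
by apply: (smooth_eq oU _ (sE x.1 x.2.1 x.2.2 : smooth _ _)) => u _; rewrite [RHS]mxE.
Qed.

End free_coordinates.

(** * The submanifold of jets of structures preserving L *)

Section local_structures.
Context {R : realType}.

Definition local_structure (y : 'rV[R]_4) (Om : set 'rV[R]_4) (f : 'rV[R]_4 -> 'M[R]_4) : Prop :=
  [/\ open Om, Om y, smooth_on Om f, forall z, Om z -> f z *m f z = - 1%:M
    & forall z, Om z -> snd2 z = 0 -> lower (f z)].

Definition local_jets m (y : 'rV[R]_4) : set (jet_space R 4 m) :=
  [set u | exists Om f, local_structure y Om f /\ u = jet_at y f].

Lemma snd2_eq0 (y : 'rV[R]_4) : snd2 y = 0 <-> forall i : 'I_4, (2 <= i)%N -> y 0 i = 0.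
Proof.
split=> [/rowP h i i2|h].
  have i4 : (i - 2 < 2)%N by rewrite ltn_subLR // ltn_ord.
  have := h (Ordinal i4); rewrite !mxE => <-; congr (y _ _).
  by apply: val_inj; rewrite /= subnKC.
by apply/rowP => i; rewrite !mxE h.
Qed.

Lemma derive_cst_line_on (Om : set 'rV[R]_4) (g : 'rV[R]_4 -> R) (v y : 'rV[R]_4) :
  open Om -> Om y -> (forall h : R, Om (h *: v + y) -> g (h *: v + y) = g y) -> 'D_v g y = 0.
Proof.
(* Extending [g] by the constant [g y] outside [Om] keeps its germ at [y] and makes it constant on
   the whole line. *)
move=> oOm Omy gE; pose g' z := if `[< Om z >] then g z else g y.
apply: etrans (derive_on_open (g := g') v oOm Omy _) _.
  by move=> z Omz; rewrite /g' asboolT.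
apply: derive_cst_line => h; rewrite /g'; case: asboolP => [/gE ->|_]; by rewrite asboolT.
Qed.

Lemma partials_tangential (Om : set 'rV[R]_4) (g : 'rV[R]_4 -> R) (s : seq 'I_4) (y : 'rV[R]_4) :
  open Om -> (forall z, Om z -> snd2 z = 0 -> g z = 0) -> Om y -> snd2 y = 0 ->
  (forall i, i \in s -> (i < 2)%N) -> partials s g y = 0.
Proof.
move=> oOm g0; elim: s y => [|i s IHs] y Omy y0 si; first exact: g0.
have hs j : j \in s -> (j < 2)%N by move=> js; apply: si; rewrite inE js orbT.
apply: (derive_cst_line_on (g := partials s g) oOm Omy) => h Omh.
rewrite (IHs _ Omy) // (IHs _ Omh) //.
apply/snd2_eq0 => j j2; rewrite !mxE eqxx /= ((snd2_eq0 y).1 y0) // addr0.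
rewrite (_ : j == i = false) ?mulr0 //; apply/negP => /eqP ji.
by have := si i (mem_head _ _); rewrite -ji ltnNge j2.
Qed.

Lemma tangential_word m (a : multi_index 4 m) i : tangential a -> i \in word a -> (i < 2)%N.
Proof.
move=> /forallP ta; rewrite -has_pred1 has_count count_word => ai.
rewrite ltnNge; apply/negP => i2; have := ta i; rewrite i2 /= => /eqP E.
by rewrite E in ai.
Qed.

Variable m : nat.

Lemma antilinear_jet_at (Om : set 'rV[R]_4) (K : 'rV[R]_4 -> 'M[R]_4) (y : 'rV[R]_4) :
  open Om -> Om y -> smooth_on Om K -> snd2 y = 0 ->
  (forall z, Om z -> K z *m Jstd = - (Jstd *m K z)) ->
  (forall z, Om z -> snd2 z = 0 -> lower (K z)) ->
  antilinear_jet (jet_at y K : jet_space R 4 m).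
Proof.
move=> oOm Omy sK y0 aK lK a; rewrite jet_coef_at; split.
  rewrite -(partials_mx_rmul _ _ oOm Omy sK).
  apply: etrans (partials_mx_on (g := fun z => (- Jstd) *m K z) _ oOm Omy _) _.
    by move=> z Omz; rewrite aK // mulNmx.
  by rewrite (partials_mx_lmul _ _ oOm Omy sK) mulNmx.
move=> ta i j i2 j2; rewrite mxE; apply: (partials_tangential oOm) => //.
  by move=> z Omz z0; exact: lK.
by move=> k; exact: tangential_word.
Qed.

Lemma antilinear_jet_poly (y z : 'rV[R]_4) (u : jet_space R 4 m) : antilinear_jet u ->
  jet_poly y u z *m Jstd = - (Jstd *m jet_poly y u z).
Proof.
move=> au; rewrite /jet_poly /taylor mulmx_suml mulmx_sumr -sumrN.
by apply: eq_bigr => a _; rewrite -scalemxAl (au a).1 -scalemxAr scalerN.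
Qed.

(** At a point of L, a monomial involving a normal coordinate vanishes; the other coefficients are
    tangential, hence [lower]. *)
Lemma lower_jet_poly (y z : 'rV[R]_4) (u : jet_space R 4 m) : antilinear_jet u ->
  snd2 y = 0 -> snd2 z = 0 -> lower (jet_poly y u z).
Proof.
move=> au y0 z0 i j i2 j2; rewrite /jet_poly /taylor summxE big1 // => a _.
rewrite mxE; have [ta|] := boolP (tangential a); first by rewrite (au a).2 ?mulr0.
rewrite negb_forall => /existsP[k]; rewrite negb_imply => /andP[k2 ak].
rewrite /monomial (bigD1 k) //= ((snd2_eq0 y).1 y0) // ((snd2_eq0 z).1 z0) //.
by rewrite subrr expr0n (negbTE ak) !mul0r.
Qed.

(** The prolonged Cayley chart identifies jets of structures near [p] with an open part of the
    linear space of antilinear jets, parametrized by the free coordinates. *)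
Lemma submanifold_local_jets (y : 'rV[R]_4) : snd2 y = 0 ->
  submanifold #|free_index (m := m)| (local_jets (m := m) y).
Proof.
move=> y0 p [Om0 [f0 [[oOm0 Omy0 sf0 sq0 low0] pE]]].
have sq := sq0 _ Omy0; have low := low0 _ Omy0 y0.
(* [G] is a constant matrix, taken from the value of the structure at [y], which it conjugates to
   [Jstd]; a different [p] gets a different chart. *)
pose G := complex_frame (f0 y).
have uG : G \in unitmx by exact: complex_frame_unit.
have lG : lower G by exact: lower_complex_frame.
have jF : jet_operation (fwd_dom G) (fwd_op G) := jet_operation_cayley _ _ _ _.
have jB : jet_operation (bwd_dom (R := R)) (bwd_op G) := jet_operation_cayley _ _ _ _.
pose U : set (jet_space R 4 m) := jet_dom y (fwd_dom G).
pose V := [set v : 'rV[R]_#|free_index (m := m)| | setT v /\ jet_dom y (bwd_dom (R := R)) (jet_of_free v)].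
have oU : open U := open_jet_dom jF.
have oV : open V.
  apply: open_preimage_open; [exact: openT|exact: smooth_jet_of_free|exact: open_jet_dom jB].
exists U, V, (fun v => prolong y (bwd_op G) (jet_of_free v)),
  (fun u => free_of_jet (prolong y (fwd_op G) u)); split.
- split=> //; rewrite /U /jet_dom /= pE (jet_poly_val oOm0 Omy0 sf0).
  by apply: fwd_dom_center => //; exact: complex_frameE.
- exact: oV.
- apply: (@smooth_on_comp _ _ V oV _ _ _ (jet_dom y (bwd_dom (R := R)))).
  + exact: open_jet_dom jB.
  + by move=> v [].
  + exact: smooth_prolong.
  + by apply: smooth_on_sub smooth_jet_of_free.
- apply: (@smooth_on_comp _ _ U oU _ _ _ setT).
  + exact: openT.
  + by [].
  + by apply: smooth_free_of_jet; exact: openT.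
  + exact: smooth_prolong.
split=> [v [_ Vv]|u [Om [f [[oOm Omy sf sqf lowf] uE]]] Uu].
  (* Every parameter is realized by a genuine structure: the inverse Cayley image of the polynomial
     [K], on the open set where it is defined. *)
  pose K := jet_poly y (jet_of_free v).
  pose Om := [set z | setT z /\ bwd_dom (R := R) (K z)].
  have sK W : open W -> smooth_on W K by exact: smooth_on_jet_poly.
  have oOm : open Om by apply: (jet_op_open jB); [exact: openT|apply: sK; exact: openT].
  have Omy : Om y by [].
  have sf : smooth_on Om (fun z => bwd_op G (K z)).
    by apply: (jet_op_smooth jB oOm); [exact: sK|move=> z []].
  have av := antilinear_jet_of_free v.
  have psiE : prolong y (bwd_op G) (jet_of_free v) = jet_at y (fun z => bwd_op G (K z)) by [].
  have vE : jet_poly y (jet_at y (fun z => bwd_op G (K z)) : jet_space R 4 m) y = bwd_op G (K y).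
    by rewrite (jet_poly_val oOm Omy sf).
  have domK : fwd_dom G (bwd_op G (K y)) by apply: bwd_op_dom.
  split.
  - exists Om, (fun z => bwd_op G (K z)); split=> //; split=> //.
      by move=> z [_ Kz]; apply: bwd_op_sq => //; exact: antilinear_jet_poly.
    by move=> z [_ Kz] z0; apply: lower_bwd_op => //; exact: lower_jet_poly.
  - by rewrite psiE /U /jet_dom /= vE.
  - rewrite psiE (prolong_jet_at m jF oOm Omy sf) //.
    rewrite (jet_at_on (U := Om) (g := K)) //; last first.
      by move=> z [_ Kz]; rewrite bwd_opK.
    by rewrite /K jet_at_poly jet_of_freeK.
(* Conversely, [f] itself lies in the domain of the chart near [y], and its image there is an
   antilinear function that is [lower] along L. *)
pose Om' := [set z | Om z /\ fwd_dom G (f z)].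
have oOm' : open Om' := jet_op_open jF oOm sf.
have fy : fwd_dom G (f y) by move: Uu; rewrite /U /jet_dom /= uE (jet_poly_val oOm Omy sf).
have Omy' : Om' y by [].
have sf' : smooth_on Om' f by apply: smooth_on_sub sf => z [].
pose K z := fwd_op G (f z).
have sK : smooth_on Om' K by apply: (jet_op_smooth jF oOm') => // z [].
have rhoE : prolong y (fwd_op G) u = jet_at y K.
  by rewrite uE (prolong_jet_at m jF oOm Omy sf).
have aK : antilinear_jet (jet_at y K : jet_space R 4 m).
  apply: (antilinear_jet_at oOm' Omy' sK y0).
    by move=> z [Omz fz]; apply: fwd_op_anticommute => //; exact: sqf.
  by move=> z [Omz fz] z0; apply: lower_fwd_op => //; exact: lowf.
have dK : bwd_dom (R := R) (K y) by exact: fwd_op_dom.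
rewrite rhoE /V /= free_of_jetK //; split.
  by split=> //; rewrite /jet_dom /= (jet_poly_val oOm' Omy' sK).
rewrite (prolong_jet_at m jB oOm' Omy' sK) // uE.
by apply: (jet_at_on oOm' Omy') => z [_ fz]; rewrite /K fwd_opK.
Qed.

End local_structures.

(** * Tangent vectors in charts *)

Section transitions.
Context {R : realType} {n : nat} {T : Type} {A : set (chart R n T)}.
Hypothesis hM : smooth_manifold A.
Implicit Types (c : chart R n T) (p : T).

Definition tjac c c' p : 'M[R]_n := jacobian (transition c c') (fwd c p).

Lemma chartP c : A c -> is_chart c.
Proof. by case: hM => _ h _ _ /h[]. Qed.

Lemma compatibleP c c' : A c -> A c' -> compatible c c'.
Proof. by case: hM => _ h _ _ /h[_ h'] /h'[]. Qed.

Lemma bwd_fwd c p : A c -> dom c p -> bwd c (fwd c p) = p.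
Proof. by move=> /chartP[_]; exact. Qed.

Lemma cimg_fwd c (U : set T) p : U p -> dom c p -> cimg c U (fwd c p).
Proof. by move=> Up cp; exists p. Qed.

Lemma cimgP c (U : set T) y : A c -> cimg c U y ->
  [/\ U (bwd c y), dom c (bwd c y) & fwd c (bwd c y) = y].
Proof. by move=> Ac [p [Up cp] <-]; rewrite bwd_fwd. Qed.

Lemma open_cimg_dom c c' : A c -> A c' -> open (cimg c (dom c')).
Proof. by move=> Ac Ac'; have [] := compatibleP Ac Ac'. Qed.

Lemma smooth_transition c c' : A c -> A c' ->
  smooth_on (cimg c (dom c')) (transition c c').
Proof. by move=> Ac Ac'; have [] := compatibleP Ac Ac'. Qed.

Lemma differentiable_transition c c' p : A c -> A c' -> dom c p -> dom c' p ->
  differentiable (transition c c') (fwd c p).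
Proof.
move=> Ac Ac' cp c'p; apply: smooth_on_diff (smooth_transition Ac Ac') _.
exact: cimg_fwd.
Qed.

Lemma tjac_id c p : A c -> dom c p -> tjac c c p = 1%:M.
Proof.
move=> Ac cp; rewrite /tjac -(jacobian_id (fwd c p)).
apply: (jacobian_on_open (open_cimg_dom Ac Ac)); first exact: cimg_fwd.
  exact: differentiable_transition.
by move=> z /(cimgP Ac)[].
Qed.

Lemma tjac_comp c c' c'' p : A c -> A c' -> A c'' -> dom c p -> dom c' p -> dom c'' p ->
  tjac c c' p *m tjac c' c'' p = tjac c c'' p.
Proof.
move=> Ac Ac' Ac'' cp c'p c''p.
have E : transition c c' (fwd c p) = fwd c' p by rewrite /transition bwd_fwd.
have d1 := differentiable_transition Ac Ac' cp c'p.
have d2 : differentiable (transition c' c'') (transition c c' (fwd c p)).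
  by rewrite E; exact: differentiable_transition.
have := jacobian_comp d1 d2; rewrite E => <-.
have oW : open (cimg c (dom c') `&` cimg c (dom c'')).
  by apply: openI; exact: open_cimg_dom.
apply: (jacobian_on_open oW); first by split; exact: cimg_fwd.
  exact: (@differentiable_comp _ _ _ _ (transition c c') (transition c' c'')).
move=> z [/(cimgP Ac)[c'z cz zE] _].
by rewrite /transition bwd_fwd.
Qed.

Lemma mopen_setT : mopen A setT.
Proof.
split=> [p _|c Ac]; first by case: hM => h _ _ _; exact: h.
by have [] := chartP Ac.
Qed.

Lemma mopen_chart c (Om : set 'rV[R]_n) : A c -> open Om ->
  mopen A [set p | dom c p /\ Om (fwd c p)].
Proof.
move=> Ac oOm; split=> [p [cp _]|c' Ac']; first by exists c.
rewrite (_ : cimg _ _ = [set y | cimg c' (dom c) y /\ Om (transition c' c y)]).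
  by apply: open_preimage_open => //; [exact: open_cimg_dom|exact: smooth_transition].
apply/seteqP; split=> [y [p [[cp Op] c'p] <-]|y [[p [cp c'p] <-]]].
  by split; [exact: cimg_fwd|rewrite /transition bwd_fwd].
by rewrite /transition bwd_fwd // => Op; apply: cimg_fwd.
Qed.

(** The value [0] away from the charts around [p] is the convention of [tangent]. *)
Definition vec_of c p (w : 'rV[R]_n) : tvec R n T :=
  fun c' => if `[< A c' /\ dom c' p >] then w *m tjac c c' p else 0.

Lemma vec_ofE c p w : A c -> dom c p -> vec_of c p w c = w.
Proof. by move=> Ac cp; rewrite /vec_of asboolT // tjac_id // mulmx1. Qed.

Lemma tangent_vec_of c p w : A c -> dom c p -> tangent A p (vec_of c p w).
Proof.
move=> Ac cp; split=> [c1 c2 A1 A2 p1 p2|c1 h]; last by rewrite /vec_of asboolF.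
have E c3 : A c3 -> dom c3 p -> vec_of c p w c3 = w *m tjac c c3 p.
  by move=> A3 p3; rewrite /vec_of asboolT.
rewrite (E c2 A2 p2) (E c1 A1 p1) -/(tjac c1 c2 p) -(tjac_comp Ac A1 A2 cp p1 p2).
exact: mulmxA.
Qed.

Lemma tangentE c c' p v : A c -> A c' -> dom c p -> dom c' p -> tangent A p v ->
  v c' = v c *m tjac c c' p.
Proof. by move=> Ac Ac' cp c'p [h _]; exact: h. Qed.

End transitions.

(** * Adapted charts and structures preserving L *)

Section surfaces.
Context {R : realType} {T : Type} {A : set (chart R 4 T)} {L : set T}.
Hypothesis hM : smooth_manifold A.
Implicit Types (c : chart R 4 T) (p x : T).

Lemma lower_snd2P (B : 'M[R]_4) :
  lower B <-> forall w : 'rV[R]_4, snd2 w = 0 -> snd2 (w *m B) = 0.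
Proof.
split=> [lB w /snd2_eq0 w0|h i j i2 j2].
  apply/snd2_eq0 => j j2; rewrite mxE big1 // => i _.
  have [i2|i2] := ltnP i 2; first by rewrite lB ?mulr0.
  by rewrite w0 ?mul0r.
have /snd2_eq0/(_ j j2) : snd2 (delta_mx 0 i *m B) = 0.
  apply: h; apply/snd2_eq0 => k k2; rewrite mxE eqxx /=.
  by case: eqP => // ki; move: k2; rewrite ki leqNgt i2.
by rewrite -rowE mxE.
Qed.

(** Both charts being adapted, the last two components of the transition vanish where [snd2] does,
    so their derivatives in the first two directions vanish as well. *)
Lemma lower_tjac c c' x : adapted A L c -> adapted A L c' -> dom c x -> dom c' x -> L x ->
  lower (tjac c c' x).
Proof.
move=> [Ac cL] [Ac' c'L] cx c'x Lx i j i2 j2.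
apply: etrans (jacobianE i j (differentiable_transition hM Ac Ac' cx c'x)) _.
apply: (@partials_tangential _ (cimg c (dom c')) (fun z => transition c c' z 0 j) [:: i]).
- exact: (open_cimg_dom hM).
- move=> z /(cimgP hM Ac)[c'z cz zE] z0.
  apply: (snd2_eq0 _).1 => //; apply/(c'L _ c'z).
  by apply/(cL _ cz); rewrite zE.
- exact: cimg_fwd.
- exact/cL.
- by move=> k; rewrite inE => /eqP->.
Qed.

Lemma tangent_subP c x v : adapted A L c -> dom c x -> L x ->
  tangent_sub A L x v <-> tangent A x v /\ snd2 (v c) = 0.
Proof.
move=> ac cx Lx; split=> [[tv h]|[tv v0]]; first by split=> //; exact: h.
split=> // c' ac' c'x; rewrite (tangentE ac.1 ac'.1 cx c'x tv).
exact: (lower_snd2P _).1 (lower_tjac ac ac' cx c'x Lx) _ v0.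
Qed.

Lemma tangent_app_endo (U : set T) J x v : almost_complex A U J -> U x ->
  tangent A x v -> tangent A x (app_endo J x v).
Proof.
move=> [_ comp _] Ux [tv v0]; split=> [c c' Ac Ac' cx c'x|c nc]; last first.
  by rewrite /app_endo v0 // mul0mx.
by rewrite /app_endo (tv c c') // -mulmxA -comp // mulmxA.
Qed.

(** An [endo] has a matrix in every chart of the atlas; conjugation by transition Jacobians supplies
    the others from the one in [c]. *)
Definition spread c (f : 'rV[R]_4 -> 'M[R]_4) : endo R 4 T :=
  fun c' p => tjac c' c p *m f (fwd c p) *m tjac c c' p.

Lemma spreadE c f p : A c -> dom c p -> spread c f c p = f (fwd c p).
Proof. by move=> Ac cp; rewrite /spread (tjac_id hM) // mul1mx mulmx1. Qed.

Lemma almost_complex_spread c (Om : set 'rV[R]_4) (f : 'rV[R]_4 -> 'M[R]_4) :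
  A c -> open Om -> smooth_on Om f -> (forall z, Om z -> f z *m f z = - 1%:M) ->
  almost_complex A [set p | dom c p /\ Om (fwd c p)] (spread c f).
Proof.
move=> Ac oOm sf ff; set U := [set p | _].
split=> [c' Ac'|c1 c2 p A1 A2 [cp Op] p1 p2|c' p Ac' [cp Op] c'p].
- have oU : open (cimg c' U) by have [_] := mopen_chart hM Ac oOm; exact.
  have sub : cimg c' U `<=` cimg c' (dom c).
    by move=> y [p [[cp _] c'p] <-]; exact: cimg_fwd.
  have st : smooth_on (cimg c' U) (transition c' c).
    by apply: smooth_on_sub sub _; exact: (smooth_transition hM).
  have UOm y : cimg c' U y -> Om (transition c' c y).
    by move=> [p [[cp Op] c'p] <-]; rewrite /transition (bwd_fwd hM).
  have UO y : cimg c' U y -> cimg c (dom c') (transition c' c y).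
    by move=> [p [[cp Op] c'p] <-]; rewrite /transition (bwd_fwd hM) //; exact: cimg_fwd.
  have s1 : smooth_on (cimg c' U) (jacobian (transition c' c)) by exact: smooth_on_jacobian.
  have s2 : smooth_on (cimg c' U) (fun y => f (transition c' c y)).
    by apply: (smooth_on_comp oU oOm UOm).
  have s3 : smooth_on (cimg c' U) (fun y => jacobian (transition c c') (transition c' c y)).
    apply: (smooth_on_comp (f := jacobian (transition c c')) oU (open_cimg_dom hM Ac Ac') UO _ st).
    apply: smooth_on_jacobian; first exact: (open_cimg_dom hM).
    exact: (smooth_transition hM).
  apply: (smooth_on_eq oU _ (smooth_on_mulmx oU (smooth_on_mulmx oU s1 s2) s3)) => y Uy.
  by have [_ _ yE] := cimgP hM Ac' Uy; rewrite /spread /tjac yE.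
- change (spread c f c1 p *m tjac c1 c2 p = tjac c1 c2 p *m spread c f c2 p).
  rewrite /spread; move: (tjac_comp hM Ac A1 A2 cp p1 p2) (tjac_comp hM A1 A2 Ac p1 p2 cp).
  move: (tjac c1 c2 p) (tjac c c1 p) (tjac c c2 p) (tjac c1 c p) (tjac c2 c p) (f _).
  by move=> X Y Z V W F <- <-; rewrite !mulmxA.
- rewrite /spread.
  have := tjac_comp hM Ac Ac' Ac cp c'p cp; rewrite (tjac_id hM Ac cp).
  have := tjac_comp hM Ac' Ac Ac' c'p cp c'p; rewrite (tjac_id hM Ac' c'p).
  move: (tjac c' c p) (tjac c c' p) => X Y XY YX.
  have -> : X *m f (fwd c p) *m Y *m (X *m f (fwd c p) *m Y) =
            X *m (f (fwd c p) *m (Y *m X) *m f (fwd c p)) *m Y by rewrite !mulmxA.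
  by rewrite YX mulmx1 ff // mulmxN mulmx1 mulNmx XY.
Qed.

Lemma pseudoholomorphic_spread c (Om : set 'rV[R]_4) (f : 'rV[R]_4 -> 'M[R]_4) :
  adapted A L c -> open Om -> smooth_on Om f -> (forall z, Om z -> f z *m f z = - 1%:M) ->
  (forall z, Om z -> snd2 z = 0 -> lower (f z)) ->
  pseudoholomorphic A L [set p | dom c p /\ Om (fwd c p)] (spread c f).
Proof.
move=> ac oOm sf ff lf x v Lx Ux tv; have [Ac cL] := ac; have [cx Ox] := Ux.
have [tv1 v0] := (tangent_subP v ac cx Lx).1 tv.
apply/(tangent_subP _ ac cx Lx); split.
  exact: tangent_app_endo (almost_complex_spread Ac oOm sf ff) Ux tv1.
rewrite /app_endo spreadE //; apply: (lower_snd2P _).1 v0.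
by apply: lf => //; exact/cL.
Qed.

Lemma jetE m c (J : endo R 4 T) x : jet m c J x = jet_at (fwd c x) (fun y => J c (bwd c y)).
Proof.
apply/rowP => k; rewrite !mxE; by case: (enum_val k) => a [i j].
Qed.

Lemma local_structure_endo c (U : set T) J x : adapted A L c -> dom c x -> mopen A U -> U x ->
  almost_complex A U J -> pseudoholomorphic A L U J ->
  local_structure (fwd c x) (cimg c U) (fun y => J c (bwd c y)).
Proof.
move=> ac cx [_ oU] Ux aJ pJ; have [Ac cL] := ac; have [sJ _ sqJ] := aJ.
split; [exact: oU|exact: cimg_fwd|exact: sJ| |].
  by move=> z /(cimgP hM Ac)[Uz cz _]; exact: sqJ.
move=> z /(cimgP hM Ac)[Uz cz zE] z0; apply/lower_snd2P => w w0.
have Lz : L (bwd c z) by apply/(cL _ cz); rewrite zE.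
have tw : tangent_sub A L (bwd c z) (vec_of (A := A) c (bwd c z) w).
  apply/(tangent_subP _ ac cz Lz); split; first exact: (tangent_vec_of hM).
  by rewrite (vec_ofE hM).
have /(tangent_subP _ ac cz Lz)[_] := pJ _ _ Lz Uz tw.
by rewrite /app_endo (vec_ofE hM).
Qed.

(** [ac_jets] allows structures that are defined only near [x], so [spread] turns any local
    structure in coordinates into an admissible one. *)
Lemma ac_jets_local m c x : adapted A L c -> dom c x -> L x ->
  ac_jets A L c x = local_jets (m := m) (fwd c x).
Proof.
move=> ac cx Lx; have [Ac cL] := ac; apply/seteqP; split=> jt.
  move=> [U [J [mU Ux aJ pJ ->]]]; exists (cimg c U), (fun y => J c (bwd c y)).
  by split; [exact: local_structure_endo|exact: jetE].
move=> [Om [f [[oOm Omy sf ff lf] ->]]].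
exists [set p | dom c p /\ Om (fwd c p)], (spread c f); split.
- exact: (mopen_chart hM).
- by [].
- exact: almost_complex_spread.
- exact: pseudoholomorphic_spread.
rewrite jetE; have [_ oU] := mopen_chart hM Ac oOm.
apply: (jet_at_on (oU c Ac)); first by apply: cimg_fwd.
by move=> z /(cimgP hM Ac)[[cz _] _ zE]; rewrite spreadE // zE.
Qed.

End surfaces.

(** * The limit of the rescaled structures *)

Section normal_charts.
Context {R : realType} {T : Type} {A : set (chart R 4 T)} {L : set T}.
Hypothesis hM : smooth_manifold A.
Variable c : chart R 4 T.
Hypothesis ac : adapted A L c.

Let b := normal_chart A L c.
Let Ac : A c := ac.1.

(** Both projections keep their values in ['rV_4], so that the dilatation reads
    [t *: fiber z + base z]. *)
Definition base (z : 'rV[R]_4) : 'rV[R]_4 := \row_j if (j < 2)%N then z 0 j else 0.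
Definition fiber (z : 'rV[R]_4) : 'rV[R]_4 := \row_j if (j < 2)%N then 0 else z 0 j.

Lemma fst2_pair (u w : 'rV[R]_2) : fst2 (pair2 u w) = u.
Proof. exact: row_mxKl. Qed.

Lemma snd2_pair (u w : 'rV[R]_2) : snd2 (pair2 u w) = w.
Proof. exact: row_mxKr. Qed.

Lemma pair2K (z : 'rV[R]_4) : pair2 (fst2 z) (snd2 z) = z.
Proof. exact: (@hsubmxK R 1 2 2). Qed.

Lemma fst2E (z : 'rV[R]_4) i : fst2 z 0 i = z 0 (lshift 2 i).
Proof. by rewrite mxE. Qed.

Lemma snd2E (z : 'rV[R]_4) i : snd2 z 0 i = z 0 (rshift 2 i).
Proof. by rewrite mxE. Qed.

Lemma pair2E (u w : 'rV[R]_2) (j : 'I_4) : pair2 u w 0 j =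
  match fintype.split (j : 'I_(2 + 2)) with inl i => u 0 i | inr i => w 0 i end.
Proof. by rewrite mxE; case: (fintype.split _). Qed.

Lemma pair_base z : pair2 (fst2 z) 0 = base z.
Proof.
apply/rowP => j; rewrite pair2E [RHS]mxE; case: fintype.splitP => k jk.
  by rewrite jk ltn_ord fst2E; congr (z _ _); apply: val_inj.
by rewrite jk mxE.
Qed.

Lemma fst2_base z : fst2 (base z) = fst2 z.
Proof. by rewrite -pair_base fst2_pair. Qed.

Lemma snd2_base z : snd2 (base z) = 0.
Proof. by rewrite -pair_base snd2_pair. Qed.

Lemma snd2_fiber z : snd2 (fiber z) = snd2 z.
Proof. by apply/rowP => j; rewrite !snd2E mxE. Qed.

Lemma fiber_lin t u z : fiber (t *: u + z) = t *: fiber u + fiber z.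
Proof. by apply/rowP => j; rewrite !mxE; case: ifP => //; rewrite mulr0 addr0. Qed.

Lemma base_line t (k : 'I_4) z : (2 <= k)%N -> base (t *: delta_mx 0 k + z) = base z.
Proof.
move=> k2; apply/rowP => j; rewrite !mxE; case: ifP => // j2.
rewrite (_ : j == k = false) ?andbF ?mulr0 ?add0r //.
by apply/negP => /eqP jk; move: j2; rewrite jk ltnNge k2.
Qed.

Lemma base_base z : base (base z) = base z.
Proof. by apply/rowP => j; rewrite !mxE; case: (j < 2)%N. Qed.

Lemma base_fiber_line t z : base (t *: fiber z + base z) = base z.
Proof. by apply/rowP => j; rewrite !mxE; case: (j < 2)%N; rewrite ?mulr0 ?add0r. Qed.

Lemma smooth_on_base U : open U -> smooth_on U base.
Proof.
move=> oU i j; rewrite (ord1 i).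
have [j2|j2] := ltnP j 2.
  by apply: (smooth_eq oU _ (@smooth_coord _ _ U j)) => z _; rewrite mxE j2.
by apply: (smooth_eq oU _ (@smooth_cst _ _ U 0)) => z _; rewrite mxE ltnNge j2.
Qed.

(** The image of the bundle chart is a union of whole fibers: the condition bears on [base z] alone
    and is stable under dilatations. *)
Definition ndom : set 'rV[R]_4 := [set z | cimg c setT (base z)].

Lemma open_ndom : open ndom.
Proof.
rewrite (_ : ndom = [set z | setT z /\ cimg c setT (base z)]); last first.
  by apply/seteqP; split=> z //= [].
apply: open_preimage_open; [exact: openT|by apply: smooth_on_base; exact: openT|].
by have [_] := mopen_setT hM; apply.
Qed.

Lemma tangent_lin x t (u v : tvec R 4 T) : tangent A x u -> tangent A x v ->
  tangent A x (t *: u + v).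
Proof.
move=> [tu u0] [tv v0]; split=> [c1 c2 A1 A2 x1 x2|c1 n1].
  change (t *: u c2 + v c2 = (t *: u c1 + v c1) *m jacobian (transition c1 c2) (fwd c1 x)).
  by rewrite (tu c1 c2) // (tv c1 c2) // mulmxDl -scalemxAl.
by change (t *: u c1 + v c1 = 0); rewrite u0 // v0 // scaler0 addr0.
Qed.

Lemma snd2_lin t (u v : 'rV[R]_4) : snd2 (t *: u + v) = t *: snd2 u + snd2 v.
Proof. by apply/rowP => i; rewrite mxE [in RHS]mxE [in RHS]mxE !mxE. Qed.

Section one_point.
Variable x : T.
Hypotheses (Lx : L x) (cx : dom c x).

(** The cosets of [tangent_sub A L x], seen as level sets of the normal coordinates. *)
Definition class_of (w : 'rV[R]_2) : set (tvec R 4 T) :=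
  [set v | tangent A x v /\ snd2 (v c) = w].

Definition lift_of (w : 'rV[R]_2) : tvec R 4 T := vec_of (A := A) c x (pair2 0 w).

Lemma class_lift w : class_of w (lift_of w).
Proof.
split; first exact: (tangent_vec_of hM).
by rewrite /lift_of (vec_ofE hM) // snd2_pair.
Qed.

Lemma tangent_sub_class : tangent_sub A L x = class_of 0.
Proof.
by apply/seteqP; split=> v /(tangent_subP hM _ ac cx Lx).
Qed.

Lemma class_scale t w w' (u v : tvec R 4 T) : class_of w u -> class_of w' v ->
  class_of (t *: w + w') (t *: u + v).
Proof.
move=> [tu <-] [tv <-]; split; first exact: tangent_lin.
by change (snd2 (t *: u c + v c) = t *: snd2 (u c) + snd2 (v c)); rewrite snd2_lin.
Qed.

Lemma class_sub w w' (u v : tvec R 4 T) : class_of w u -> class_of w' v ->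
  class_of (w - w') (u - v).
Proof.
by move=> hu hv; have := class_scale (-1) hv hu; rewrite !scaleN1r ![- _ + _]addrC.
Qed.

Lemma normal_space_class w : Defs.normal_space A L x (class_of w).
Proof.
have lw := class_lift w; exists (lift_of w); first by case: lw.
apply/seteqP; split=> [v hv|v [u hu <-]].
  exists (v - lift_of w); last by rewrite addrC subrK.
  by rewrite tangent_sub_class; have := class_sub hv lw; rewrite subrr.
rewrite tangent_sub_class in hu; have := class_scale 1 hu lw.
by rewrite scaler0 add0r scale1r addrC.
Qed.

Lemma normal_space_classE nu : Defs.normal_space A L x nu -> exists w, nu = class_of w.
Proof.
move=> [v tv ->]; exists (snd2 (v c)).
have hv : class_of (snd2 (v c)) v by [].
apply/seteqP; split=> [w [u hu <-]|w hw].
  rewrite tangent_sub_class in hu; have := class_scale 1 hu hv.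
  by rewrite scaler0 add0r scale1r addrC.
exists (w - v); last by rewrite addrC subrK.
by rewrite tangent_sub_class; have := class_sub hw hv; rewrite subrr.
Qed.

(** The class contains [lift_of w], so the condition is not vacuous and determines the value that
    [xget] picks. *)
Lemma xget_class w : xget 0 [set w' | forall v, class_of w v -> snd2 (v c) = w'] = w.
Proof.
apply: xget_unique => [v []|w' /(_ _ (class_lift w))] //.
by move=> <-; have [] := class_lift w.
Qed.

Lemma dilate_class t w :
  [set t *: v + u | v in class_of w & u in tangent_sub A L x] = class_of (t *: w).
Proof.
rewrite tangent_sub_class; apply/seteqP; split=> [v [u hu [u' hu' <-]]|v hv].
  by have := class_scale t hu hu'; rewrite addr0.
have lw := class_lift w; exists (lift_of w) => //.
exists (v - t *: lift_of w); last by rewrite addrC subrK.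
have := class_scale (- t) lw hv.
by rewrite scaleNr [- _ + _]addrC subrr scaleNr [- _ + _]addrC.
Qed.

End one_point.

Lemma ndomP z : ndom z -> let x := bwd c (base z) in [/\ L x, dom c x & fwd c x = base z].
Proof.
move=> /(cimgP hM Ac)[_ cx xE]; split=> //.
by apply/(ac.2 _ cx); rewrite xE snd2_base.
Qed.

Lemma normal_bwdE z : bwd b z = (bwd c (base z), class_of (bwd c (base z)) (snd2 z)).
Proof. by rewrite -pair_base. Qed.

Lemma normal_dom z : ndom z -> dom b (bwd b z).
Proof.
move=> /ndomP[Lx cx _]; rewrite normal_bwdE; split; last exact: cx.
by split; [exact: Lx|exact: normal_space_class].
Qed.

Lemma normal_bwdK z : ndom z -> fwd b (bwd b z) = z.
Proof.
move=> /ndomP[Lx cx xE]; rewrite normal_bwdE /b /normal_chart /= xget_class //.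
by rewrite xE fst2_base pair2K.
Qed.

Lemma normal_fwdK q : dom b q -> ndom (fwd b q) /\ bwd b (fwd b q) = q.
Proof.
case: q => x nu [[/= Lx nuN] cx]; have [w nuE] := normal_space_classE Lx cx nuN.
have baseF : base (fwd b (x, nu)) = fwd c x.
  rewrite -pair_base /b /normal_chart /= fst2_pair -[RHS]pair2K.
  by rewrite ((ac.2 _ cx).1 Lx).
split; first by rewrite /ndom /= baseF; apply: cimg_fwd.
apply: etrans (normal_bwdE (fwd b (x, nu))) _.
rewrite baseF (bwd_fwd hM) // nuE; congr (_, class_of _ _).
by rewrite /b /normal_chart /= snd2_pair xget_class.
Qed.

Lemma normal_cimgP U z : cimg b U z <-> ndom z /\ U (bwd b z).
Proof.
split=> [[q [Uq bq] <-]|[nz Uz]].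
  by have [n1 n2] := normal_fwdK bq; rewrite n2.
by exists (bwd b z); [split=> //; exact: normal_dom|exact: normal_bwdK].
Qed.

Lemma dilatation_bwd t z : ndom z -> dilatation A L t (bwd b z) = bwd b (t *: fiber z + base z).
Proof.
move=> /ndomP[Lx cx xE]; apply: etrans _ (esym (normal_bwdE _)).
rewrite normal_bwdE /dilatation base_fiber_line /= dilate_class //; congr (_, class_of _ _).
by rewrite snd2_lin snd2_base addr0 snd2_fiber.
Qed.

Lemma ndom_line t z : ndom z -> ndom (t *: fiber z + base z).
Proof. by rewrite /ndom /= base_fiber_line. Qed.

Definition dil_mx (t : R) : 'M[R]_4 := diag_mx (\row_j if (j < 2)%N then 1 else t).

Lemma dil_mxE t z : z *m dil_mx t = t *: fiber z + base z.
Proof.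
apply/rowP => j; rewrite /dil_mx mul_mx_diag !mxE.
by case: ifP; rewrite ?mulr1 ?mulr0 ?add0r ?addr0 // mulrC.
Qed.

Lemma cvg_punctured_eq (F G : R -> R) (l : R) : (forall t, t != 0 -> F t = G t) ->
  F t @[t --> (0 : R)^'] --> l -> G t @[t --> (0 : R)^'] --> l.
Proof.
move=> FG; apply: cvg_trans; apply: near_eq_cvg; near=> t.
by apply: FG; near: t; exact: nbhs_dnbhs_neq.
Unshelve. all: by end_near. Qed.

Lemma punctured_cvg_unique (F G : R -> R) (l l' : R) :
  (forall t, t != 0 -> F t = G t) -> F t @[t --> (0 : R)^'] --> l ->
  G t @[t --> (0 : R)^'] --> l' -> l = l'.
Proof.
move=> FG /(cvg_punctured_eq FG); apply: cvg_unique; exact: norm_hausdorff.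
Qed.

Lemma derive_affine_line n (g : 'rV[R]_n -> R) (v y : 'rV[R]_n) (d : R) :
  (forall h : R, g (h *: v + y) = g y + h * d) -> 'D_v g y = d.
Proof.
move=> gE; rewrite /derive; apply: cvg_lim; first exact: norm_hausdorff.
apply: (@cvg_punctured_eq (cst d)); last exact: cvg_cst.
by move=> h h0; rewrite /= gE addrC addKr /GRing.scale /= mulKf.
Qed.

Lemma jacobian_linear n p (B : 'M[R]_(n, p)) (y : 'rV[R]_n) :
  jacobian (fun z => z *m B) y = B.
Proof.
have sB : smooth_on setT (fun z : 'rV[R]_n => z *m B).
  apply: smooth_on_mulmx; [exact: openT|exact: smooth_on_id|exact: smooth_on_cst].
have dB : differentiable (fun z : 'rV[R]_n => z *m B) y by exact: smooth_on_diff sB _.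
apply/matrixP => i j; apply: etrans (jacobianE i j dB) _.
apply: derive_affine_line => h; rewrite mulmxDl -scalemxAl -rowE.
by rewrite mxE [X in X + _]mxE mxE addrC.
Qed.

Lemma jacobian_dilatation t z : ndom z ->
  jacobian (fun z => fwd b (dilatation A L t (bwd b z))) z = dil_mx t.
Proof.
move=> nz; rewrite -[RHS](jacobian_linear (dil_mx t) z); apply: esym.
have sB : smooth_on setT (fun z : 'rV[R]_4 => z *m dil_mx t).
  apply: smooth_on_mulmx; [exact: openT|exact: smooth_on_id|exact: smooth_on_cst].
apply: (jacobian_on_open open_ndom nz); first exact: smooth_on_diff sB _.
move=> w nw; rewrite dil_mxE dilatation_bwd //.
by rewrite normal_bwdK //; exact: ndom_line.
Qed.

Lemma rescaledE J' t z : ndom z -> t != 0 ->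
  rescaled A L J' t b (bwd b z) =
  dil_mx t *m J' b (bwd b (t *: fiber z + base z)) *m dil_mx t^-1.
Proof.
move=> nz t0; rewrite /rescaled normal_bwdK // jacobian_dilatation // dilatation_bwd //.
have nz' := ndom_line t nz.
by rewrite normal_bwdK // jacobian_dilatation.
Qed.

Lemma zero_section_base z : ndom z -> zero_section A L (bwd b (base z)).
Proof.
move=> nz; have [Lx cx xE] := ndomP nz; rewrite normal_bwdE base_base snd2_base.
by exists (bwd c (base z)) => //; rewrite tangent_sub_class.
Qed.

(** * Shape of the limit in a bundle chart *)

Section limit_structure.
Variables (Jc J' : endo R 4 (nbpoint R T)) (W : set (nbpoint R T)).
Hypothesis zW : zero_section A L `<=` W.
Hypothesis sJ' : smooth_on (cimg b W) (fun z => J' b (bwd b z)).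
Hypothesis limJ : forall q, dom b q ->
  (fun t => rescaled A L J' t b q) @ (0 : R)^' --> Jc b q.

(** Conjugation by [dil_mx t] multiplies an entry by [1], [t] or [t^-1] according to its block. The
    factor [1] gives the value at [base z] and the factor [t] gives 0. The factor [t^-1] forces the
    value at [base z] to vanish and turns the limit into the derivative along [fiber z], which is
    linear in it. *)
Lemma limit_structure_affine : exists (al : 'I_4 -> 'I_4 -> 'rV[R]_4 -> R)
    (be : 'I_4 -> 'I_4 -> 'I_4 -> 'rV[R]_4 -> R),
  forall z, ndom z -> forall i j, Jc b (bwd b z) i j =
    al i j (base z) + \sum_l fiber z 0 l * be i j l (base z).
Proof.
pose h z := J' b (bwd b z).
pose ur (i j : 'I_4) := (i < 2)%N && (2 <= j)%N.
pose dl (i j : 'I_4) := (2 <= i)%N && (j < 2)%N.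
exists (fun i j y => if ur i j || dl i j then 0 else h y i j).
exists (fun i j l y => if ur i j then 'D_(delta_mx 0 l) (fun w => h w i j) y else 0).
move=> z nz i j.
have Wz : cimg b W (base z).
  apply/normal_cimgP; split; first by rewrite /ndom /= base_base.
  exact/zW/zero_section_base.
pose k (t : R) := h (t *: fiber z + base z) i j.
have dh : differentiable (fun w => h w i j) (base z) := sJ' i j [::] Wz.
have quot : t^-1 * (k t - h (base z) i j) @[t --> (0 : R)^'] -->
    'D_(fiber z) (fun w => h w i j) (base z).
  by have := @diff_derivable _ _ _ _ _ (fiber z) dh; rewrite /derivable => /cvgP.
have idc : t @[t --> (0 : R)^'] --> (0 : R) by exact: cvg_within.
(* Continuity along the fiber, read off from the convergent difference quotient. *)
have kc : k t @[t --> (0 : R)^'] --> h (base z) i j.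
  apply: (@cvg_punctured_eq (fun t => h (base z) i j + t * (t^-1 * (k t - h (base z) i j)))).
    by move=> t t0; rewrite mulVKf // addrC subrK.
  have H : h (base z) i j + t * (t^-1 * (k t - h (base z) i j)) @[t --> (0 : R)^'] -->
      h (base z) i j + 0 * 'D_(fiber z) (fun w => h w i j) (base z).
    by apply: cvgD; [exact: cvg_cst|exact: cvgM idc quot].
  by rewrite mul0r addr0 in H.
pose d (l : 'I_4) (t : R) := if (l < 2)%N then 1 else t.
have entry : d i t * k t * d j t^-1 @[t --> (0 : R)^'] --> Jc b (bwd b z) i j.
  have := cvg_comp _ _ (limJ (normal_dom nz)) (@coord_continuous _ _ _ i j _).
  apply: cvg_punctured_eq => t t0.
  by rewrite /= rescaledE // /dil_mx mul_mx_diag mul_diag_mx !mxE.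
have [ij|ij] := boolP (ur i j).
  move/andP: (ij) => [i2 j2]; rewrite /= add0r.
  (* The convergent entry is [t^-1 * k t]. Multiplied by [t] it tends to 0, so [h] vanishes at
     [base z] in this block and the entry is the difference quotient itself. *)
  have kE t : t != 0 -> t * (d i t * k t * d j t^-1) = k t.
    by move=> t0; rewrite /d i2 ltnNge j2 /= mul1r mulrCA divff // mulr1.
  have h0 : h (base z) i j = 0.
    by have := punctured_cvg_unique kE (cvgM idc entry) kc; rewrite mul0r => <-.
  rewrite -(derive_sum_delta _ dh).
  apply: (punctured_cvg_unique _ entry quot) => t t0.
  by rewrite /d i2 ltnNge j2 /= mul1r h0 subr0 mulrC.
rewrite orFb [X in _ + X]big1 ?addr0 => [|l _]; last by rewrite mulr0.
have [dij|dij] := boolP (dl i j).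
  move/andP: (dij) => [i2 j2].
  have kE t : t != 0 -> t * k t = d i t * k t * d j t^-1.
    by move=> t0; rewrite /d ltnNge i2 j2 /= mulr1.
  by have := punctured_cvg_unique kE (cvgM idc kc) entry; rewrite mul0r => <-.
apply: esym; apply: (punctured_cvg_unique _ kc entry) => t t0; rewrite /d.
move: ij dij; rewrite /ur /dl; case: (ltnP i 2) => i2; case: (ltnP j 2) => j2 //= _ _.
  by rewrite mulr1 mul1r.
by rewrite mulrAC divff // mul1r.
Qed.

Hypothesis sJc : smooth_on ndom (fun z => Jc b (bwd b z)).

(** One fiber derivative leaves a function of [base z], which a second one kills. No regularity is
    known for [al] and [be], so these derivatives are computed from difference quotients along lines
    in the fibers. *)
Lemma limit_structure_partials s i j z : ndom z ->
  (1 < count (fun k : 'I_4 => 2 <= k)%N s)%N ->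
  partials s (fun z => Jc b (bwd b z) i j) z = 0.
Proof.
have [al [be JE]] := limit_structure_affine.
set g := (fun z => Jc b (bwd b z) i j) => nz s2.
have nline (k : 'I_4) (h : R) (w : 'rV[R]_4) : (2 <= k)%N -> ndom w -> ndom (h *: delta_mx 0 k + w).
  by move=> k2; rewrite /ndom /= base_line.
have D1 (k : 'I_4) (w : 'rV[R]_4) : (2 <= k)%N -> ndom w -> 'D_(delta_mx 0 k) g w = be i j k (base w).
  move=> k2 nw; apply: derive_affine_line => h.
  rewrite /g !JE //; last exact: nline.
  rewrite base_line // -addrA; congr (_ + _).
  rewrite fiber_lin; under eq_bigr do rewrite mxE mulrDl.
  rewrite big_split /= addrC; congr (_ + _).
  rewrite (bigD1 k) //= big1 ?addr0 => [|l lk]; last first.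
    by rewrite !mxE (negbTE lk) andbF; case: ifP => _; rewrite mulr0 mul0r.
  by rewrite !mxE ltnNge k2 !eqxx /= mulr1.
have D2 (k l : 'I_4) (w : 'rV[R]_4) : (2 <= k)%N -> (2 <= l)%N -> ndom w ->
    'D_(delta_mx 0 l) ('D_(delta_mx 0 k) g) w = 0.
  move=> k2 l2 nw.
  apply: etrans (derive_on_open (g := fun w => be i j k (base w)) _ open_ndom nw _) _.
    by move=> w' nw'; exact: D1.
  by apply: derive_cst_line => h; rewrite base_line.
(* Two fiber letters are moved to the end of the word, where [partials] applies them first. *)
pose vert := seq.filter (fun k : 'I_4 => 2 <= k)%N s.
pose hor := seq.filter (fun k : 'I_4 => ~~ (2 <= k)%N) s.
have vall k : k \in vert -> (2 <= k)%N by rewrite mem_filter => /andP[].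
have : (1 < size vert)%N by rewrite size_filter.
have sv : perm_eq s (hor ++ vert).
  by rewrite perm_sym perm_catC perm_filterC.
move: vert sv vall => [|l [|k v]] // sv vall _.
have sg : smooth ndom g := sJc i j.
have -> : partials s g z = partials ((hor ++ v) ++ [:: l; k]) g z.
  apply: (partials_perm open_ndom sg nz); apply: perm_trans sv _.
  by rewrite -catA perm_cat2l -[_ :: _ :: v]/([:: l; k] ++ v) perm_catC.
rewrite partials_cat /=.
have k2 : (2 <= k)%N by apply: vall; rewrite !inE eqxx orbT.
have l2 : (2 <= l)%N by apply: vall; rewrite inE eqxx.
apply: etrans (partials_on_open (g := fun=> 0) _ open_ndom nz _) _.
  by move=> w nw; exact: D2.
case: (hor ++ v) => [|a r] //; exact: (partials_cst open_ndom).
Qed.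

End limit_structure.
End normal_charts.

(** * Jets of the structures isomorphic to the model *)

(** Inverses are compared on an open set where both [P] and [P'] are invertible; it contains [y],
    since they have the same value there. *)
Lemma mjeq_conj {R : realType} n m p (U : set 'rV[R]_n) (y : 'rV[R]_n)
    (P P' B B' : 'rV[R]_n -> 'M[R]_p) :
  open U -> U y -> smooth_on U P -> smooth_on U P' -> smooth_on U B -> smooth_on U B' ->
  P y \in unitmx -> mjeq m y P P' -> mjeq m y B B' ->
  mjeq m y (fun z => P z *m B z *m invmx (P z)) (fun z => P' z *m B' z *m invmx (P' z)).
Proof.
move=> oU Uy sP sP' sB sB' uP PP BB.
pose U1 := [set z | U z /\ P z \in unitmx].
have oU1 : open U1 by exact: open_unitmx.
have sP1 : smooth_on U1 P' by apply: smooth_on_sub sP' => z [].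
pose U2 := [set z | U1 z /\ P' z \in unitmx].
have oU2 : open U2 by exact: open_unitmx.
have U2y : U2 y by split; [split|rewrite -(mjeq_val PP)].
have U2U : U2 `<=` U by move=> z [[]].
have sP2 := smooth_on_sub U2U sP; have sP2' := smooth_on_sub U2U sP'.
have sB2 := smooth_on_sub U2U sB; have sB2' := smooth_on_sub U2U sB'.
have uP2 z : U2 z -> P z \in unitmx by move=> [[]].
have uP2' z : U2 z -> P' z \in unitmx by move=> [].
have sV := smooth_on_invmx oU2 uP2 sP2; have sV' := smooth_on_invmx oU2 uP2' sP2'.
apply: (mjeq_mulmx oU2 U2y) => //; try by apply: smooth_on_mulmx.
  by apply: (mjeq_mulmx oU2 U2y).
exact: (mjeq_invmx oU2 U2y).
Qed.

Section germ_of_isomorphism.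
Context {R : realType} {T : Type} {A : set (chart R 4 T)} {L : set T}.
Hypothesis hM : smooth_manifold A.
Hypothesis hL : surface A L.

Definition vertical : pred 'I_4 := fun k => (2 <= k)%N.

(** The manifold, the bundle and the limit are left behind here: what remains is a conjugation of
    matrix germs on ['rV_4] together with the vanishing of derivatives of [g]. *)
Lemma germ_local_form c x (J : endo R 4 T) (Jc : endo R 4 (nbpoint R T)) :
  A c -> dom c x -> L x -> is_NBII A L J Jc -> germ_isomorphic A L J Jc ->
  exists (Om Ob : set 'rV[R]_4) (psi : 'rV[R]_4 -> 'rV[R]_4) (g : 'rV[R]_4 -> 'M[R]_4),
  [/\ open Om /\ Om (fwd c x), open Ob, smooth_on Om psi, smooth_on Ob g &
    [/\ forall y, Om y -> Ob (psi y), jacobian psi (fwd c x) \in unitmx,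
        forall y, Om y -> J c (bwd c y) *m jacobian psi y = jacobian psi y *m g (psi y) &
        forall z s i j, Ob z -> (1 < count vertical s)%N ->
          partials s (fun w => g w i j) z = 0]].
Proof.
move=> Ac cx Lx [aJc [cF [cO [Gam [W [phi [J' [_ _ _ [zW dW _] [aJ' [_ limJ]]]]]]]]]].
move=> [U [V [Psi [LU zV [mU mV sPsi [Gi [sG K1 K2]]] PsiL inter]]]].
(* [Psi] maps L to the zero section but may move its points, so the bundle chart is taken at the
   base point [x'] of [Psi x]. *)
have [x' Lx' Px] : zero_section A L (Psi x) by rewrite -PsiL; exists x.
have [c' ac' c'x'] := hL Lx'.
pose b := normal_chart A L c'.
have Bb : normal_atlas A L b by exists c'.
have bPx : dom b (Psi x).
  rewrite -Px; split; last exact: c'x'.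
  split; first exact: Lx'.
  by rewrite /= (tangent_sub_class hM ac' Lx' c'x'); exact: (normal_space_class hM ac').
have VPx : V (Psi x) by apply: zV; exists x'.
have [_ GPx] := K1 _ (LU _ Lx).
have [Q1 [oQ1 Q1x Q1U Q1b sQ1]] := sPsi c b x Ac Bb (LU _ Lx) cx bPx.
have cG : dom c (Gi (Psi x)) by rewrite GPx.
have [Q2 [oQ2 Q2x Q2V Q2c sQ2]] := sG b c (Psi x) Bb Ac VPx bPx cG.
pose psi y := fwd b (Psi (bwd c y)).
pose th z := fwd c (Gi (bwd b z)).
have psix : psi (fwd c x) = fwd b (Psi x) by rewrite /psi (bwd_fwd hM).
have bK y : Q1 y -> bwd b (psi y) = Psi (bwd c y).
  by move=> Oy; have [] := normal_fwdK hM ac' (Q1b _ Oy).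
exists Q1, (ndom c'), psi, (fun z => Jc b (bwd b z)).
have sg : smooth_on (ndom c') (fun z => Jc b (bwd b z)).
  have [sJc _ _] := aJc; apply: smooth_on_sub (sJc b Bb) => z nz.
  by apply/(normal_cimgP hM ac'); split=> //; have [] := normal_dom hM ac' nz.
split; [by []|exact: (open_ndom hM ac')|exact: sQ1|exact: sg|split].
- by move=> y Oy; have [] := normal_fwdK hM ac' (Q1b _ Oy).
(* [th] is the inverse isomorphism in the same charts; differentiating [th (psi y) = y] makes the
   Jacobian of [psi] invertible. *)
- have d1 : differentiable psi (fwd c x) by exact: smooth_on_diff sQ1 Q1x.
  have d2 : differentiable th (psi (fwd c x)).
    by rewrite psix; exact: smooth_on_diff sQ2 Q2x.
  have E := jacobian_comp d1 d2.
  have oO : open [set y | Q1 y /\ Q2 (psi y)] by exact: open_preimage_open sQ1 oQ2.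
  have Ox : [set y | Q1 y /\ Q2 (psi y)] (fwd c x) by split=> //; rewrite psix.
  have dc : differentiable (fun y => th (psi y)) (fwd c x).
    exact: (@differentiable_comp _ _ _ _ psi th).
  have Eid : jacobian (fun y => th (psi y)) (fwd c x) = jacobian id (fwd c x).
    apply: (jacobian_on_open oO Ox dc) => y [Oy _].
    have [Uy cy yE] := cimgP hM Ac (Q1U _ Oy).
    by rewrite /th bK // (K1 _ Uy).2.
  rewrite jacobian_id E in Eid.
  exact: (mulmx1_unit Eid).1.
- move=> y Oy; have [Uy cy yE] := cimgP hM Ac (Q1U _ Oy).
  have := inter c b (bwd c y) Ac Bb Uy cy (Q1b _ Oy).
  by rewrite -(bK _ Oy) yE; apply.
- move=> z s i j nz s2; have [sJ' _ _] := aJ'.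
  have lim q : dom b q -> rescaled A L J' t b q @[t --> (0 : R)^'] --> Jc b q.
    by move=> bq; exact: limJ.
  exact: (limit_structure_partials hM ac' zW (sJ' b Bb) lim sg i j nz s2).
Qed.

End germ_of_isomorphism.

(** * Polynomial parametrization of the jets of isomorphic structures *)

Section parametrization.
Context {R : realType} {m : nat}.

Definition almost_horizontal (a : multi_index 4 m) : bool := (count vertical (word a) <= 1)%N.

(** The order is [m.+1] because the conjugation involves the Jacobian of the map, whose m-jet uses
    one more derivative. *)
Definition map_index : finType := (multi_index 4 m.+1 * 'I_4)%type.

Definition model_index : finType :=
  {x : multi_index 4 m * ('I_4 * 'I_4) | almost_horizontal x.1}.

Let N := (#|map_index| + #|model_index|)%N.

Definition map_coef (u : 'rV[R]_N) (a : multi_index 4 m.+1) : 'rV[R]_4 :=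
  \row_j lsubmx u 0 (enum_rank (a, j)).

(** The default [0] is the value of the derivatives with at least two fiber directions. *)
Definition model_coef (u : 'rV[R]_N) (a : multi_index 4 m) : 'M[R]_4 :=
  \matrix_(i, j) oapp (fun x : model_index => rsubmx u 0 (enum_rank x)) 0 (insub (a, (i, j))).

Variable y : 'rV[R]_4.

(* A point of R^(4 + N) is a pair (point of R^4, parameter). *)
Definition map_poly (z : 'rV[R]_(4 + N)) : 'rV[R]_4 :=
  taylor y (map_coef (rsubmx z)) (lsubmx z).

Definition map_jacobian (z : 'rV[R]_(4 + N)) : 'M[R]_4 :=
  \matrix_(i, j) 'D_(delta_mx 0 (lshift N i)) (fun w => map_poly w 0 j) z.

(** The center is the image of [y] under the polynomial map, which itself depends on the
    parameters. *)
Definition model_poly (z : 'rV[R]_(4 + N)) : 'M[R]_4 :=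
  taylor (map_poly (row_mx y (rsubmx z))) (model_coef (rsubmx z)) (map_poly z).

Definition pulled_back (z : 'rV[R]_(4 + N)) : 'M[R]_4 :=
  map_jacobian z *m model_poly z *m invmx (map_jacobian z).

Definition param_dom : set 'rV[R]_N := [set u | map_jacobian (row_mx y u) \in unitmx].

Definition param (u : 'rV[R]_N) : jet_space R 4 m :=
  jet_at y (fun z => pulled_back (row_mx z u)).

Lemma smooth_on_lsubmx n1 n2 (U : set 'rV[R]_(n1 + n2)) : open U ->
  smooth_on U (fun z : 'rV[R]_(n1 + n2) => lsubmx z).
Proof.
move=> oU i j; rewrite (ord1 i).
by apply: (smooth_eq oU _ (@smooth_coord _ _ U _)) => z _; rewrite mxE.
Qed.

Lemma smooth_on_rsubmx n1 n2 (U : set 'rV[R]_(n1 + n2)) : open U ->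
  smooth_on U (fun z : 'rV[R]_(n1 + n2) => rsubmx z).
Proof.
move=> oU i j; rewrite (ord1 i).
by apply: (smooth_eq oU _ (@smooth_coord _ _ U _)) => z _; rewrite mxE.
Qed.

Let oT n : open (setT : set 'rV[R]_n) := openT.

Lemma smooth_map_poly : smooth_on setT map_poly.
Proof.
apply: smooth_taylor => //; [exact: smooth_on_cst|exact: smooth_on_lsubmx|].
move=> a i j; rewrite (ord1 i).
pose k := enum_rank (a, j) : 'I_#|map_index|.
apply: (smooth_eq (@oT _) _ (@smooth_coord _ _ setT (rshift 4 (lshift #|model_index| k)))).
by move=> z _; rewrite !mxE.
Qed.

Lemma smooth_map_jacobian : smooth_on setT map_jacobian.
Proof.
move=> i j.
apply: (smooth_eq (@oT _) _ (smooth_D (lshift N i) (smooth_map_poly 0 j : smooth _ _))).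
by move=> z _; rewrite mxE.
Qed.

Lemma smooth_model_poly : smooth_on setT model_poly.
Proof.
apply: smooth_taylor => //; last 1 first.
- move=> a i j; case E : (insub (a, (i, j)) : option model_index) => [x|].
    apply: (smooth_eq (@oT _) _ (@smooth_coord _ _ setT (rshift 4 (rshift #|map_index| (enum_rank x))))).
    by move=> z _; rewrite mxE E /= !mxE.
  by apply: (smooth_eq (@oT _) _ (@smooth_cst _ _ setT 0)) => z _; rewrite mxE E.
- apply: (smooth_on_comp (@oT _) (@oT _) _ smooth_map_poly) => //.
  apply: (smooth_on_comp (g := fun z : 'rV[R]_(4 + N) => rsubmx z) (@oT _) (@oT _)) => //.
    by apply: smooth_on_row_mxr.
  exact: smooth_on_rsubmx.
- exact: smooth_map_poly.
Qed.

Lemma open_param_dom : open param_dom.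
Proof.
rewrite (_ : param_dom = [set u | setT u /\ map_jacobian (row_mx y u) \in unitmx]).
  apply: open_unitmx => //.
  apply: (smooth_on_comp (@oT _) (@oT _) _ smooth_map_jacobian) => //.
  exact: smooth_on_row_mxr.
by apply/seteqP; split=> u //= [].
Qed.

Lemma smooth_param : smooth_on param_dom param.
Proof.
have oV := open_param_dom.
pose O := [set z | setT z /\ map_jacobian z \in unitmx].
have oO : open O by apply: open_unitmx => //; exact: smooth_map_jacobian.
have sJ : smooth_on O map_jacobian by apply: smooth_on_sub smooth_map_jacobian.
have sG : smooth_on O pulled_back.
  apply: smooth_on_mulmx => //.
    by apply: smooth_on_mulmx => //; apply: smooth_on_sub smooth_model_poly.
  by apply: smooth_on_invmx => // z [].
apply: smooth_on_jet_of_coef => // a i j.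
have VO u : param_dom u -> O (row_mx y u) by move=> Vu; split.
have := smooth_parametric_partials (word a) oO oV (sG i j) VO.
by apply: smooth_eq => // u Vu; rewrite mxE.
Qed.

Lemma map_jacobianE (u : 'rV[R]_N) (z : 'rV[R]_4) :
  map_jacobian (row_mx z u) = jacobian (taylor y (map_coef u)) z.
Proof.
have st : smooth_on setT (taylor y (map_coef u)) by exact: smooth_on_taylor.
have dt : differentiable (taylor y (map_coef u)) z by exact: smooth_on_diff st _.
apply/matrixP => i j.
have E : (fun w => map_poly (row_mx w u) 0 j) = (fun w => taylor y (map_coef u) w 0 j).
  by apply/funext => w; rewrite /map_poly row_mxKl row_mxKr.
by rewrite mxE -derive_row_mx E; exact: (esym (jacobianE i j dt)).
Qed.

Lemma model_polyE (u : 'rV[R]_N) (z : 'rV[R]_4) :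
  model_poly (row_mx z u) =
  taylor (taylor y (map_coef u) y) (model_coef u) (taylor y (map_coef u) z).
Proof. by rewrite /model_poly /map_poly !row_mxKl !row_mxKr. Qed.

Variables (Om Ob : set 'rV[R]_4) (psi : 'rV[R]_4 -> 'rV[R]_4) (f g : 'rV[R]_4 -> 'M[R]_4).
Hypotheses (oOm : open Om) (Omy : Om y) (oOb : open Ob).
Hypotheses (spsi : smooth_on Om psi) (sg : smooth_on Ob g).
Hypothesis psiOb : forall z, Om z -> Ob (psi z).
Hypothesis upsi : jacobian psi y \in unitmx.
Hypothesis fpsi : forall z, Om z -> f z *m jacobian psi z = jacobian psi z *m g (psi z).
Hypothesis g0 : forall z s i j, Ob z -> (1 < count vertical s)%N ->
  partials s (fun w => g w i j) z = 0.

(** The parameters are the derivatives of [psi] at [y] and those of [g] at [psi y]. Passing to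
    Taylor polynomials preserves the m-jets of the Jacobian and of the composite, hence that of the
    conjugate, which is [f]. *)
Lemma jet_in_param : exists2 u, param_dom u & jet_at y f = param u.
Proof.
pose u : 'rV[R]_N := row_mx
  (\row_k partials (word (enum_val k : map_index).1) (fun z => psi z 0 (enum_val k : map_index).2) y)
  (\row_k let x := val (enum_val k : model_index) in
     partials (word x.1) (fun z => g z x.2.1 x.2.2) (psi y)).
have mapE a : map_coef u a = \matrix_(i, j) partials (word a) (fun z => psi z i j) y.
  by apply/matrixP => i j; rewrite (ord1 i) [LHS]mxE /u row_mxKl [LHS]mxE enum_rankK [RHS]mxE.
have modelE a : model_coef u a = \matrix_(i, j) partials (word a) (fun z => g z i j) (psi y).
  apply/matrixP => i j; rewrite [LHS]mxE [RHS]mxE /u row_mxKr; case: insubP => [x _ xE|].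
    by rewrite /= mxE enum_rankK xE.
  by rewrite /= /almost_horizontal -ltnNge => a2; rewrite g0 //; exact: psiOb.
pose tp := taylor y (map_coef u).
pose tg := taylor (psi y) (model_coef u).
have stp U : open U -> smooth_on U tp by exact: smooth_on_taylor.
have stg U : open U -> smooth_on U tg by exact: smooth_on_taylor.
have jp : mjeq m.+1 y psi tp.
  have := mjeq_taylor (m := m.+1) oOm Omy spsi.
  by rewrite /tp; congr (mjeq _ _ _ (taylor _ _)); apply/funext.
have jg : mjeq m (psi y) g tg.
  have := mjeq_taylor (m := m) oOb (psiOb Omy) sg.
  by rewrite /tg; congr (mjeq _ _ _ (taylor _ _)); apply/funext.
have tpy : tp y = psi y by rewrite (mjeq_val jp).
have jJ : mjeq m y (jacobian psi) (jacobian tp).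
  by apply: (mjeq_jacobian oOm Omy); [exact: spsi|exact: stp|exact: jp].
have uJ : jacobian tp y \in unitmx by rewrite -(mjeq_val jJ).
have ud : param_dom u by rewrite /param_dom /= map_jacobianE.
exists u => //; apply: jet_at_mjeq.
(* The two composites are compared over one open set, so [tp] has to map into [Ob] as [psi] does. *)
pose U1 := [set z | Om z /\ Ob (tp z)].
have oU1 : open U1 by apply: open_preimage_open => //; exact: stp.
have U1y : U1 y by split=> //; rewrite tpy; exact: psiOb.
have U1Om : U1 `<=` Om by move=> z [].
have sp := smooth_on_sub U1Om spsi.
have stp1 := stp U1 oU1.
have sJp := smooth_on_jacobian oU1 sp; have sJt := smooth_on_jacobian oU1 stp1.
have sgp : smooth_on U1 (fun z => g (psi z)).
  by apply: (smooth_on_comp oU1 oOb _ sg sp) => z Uz; exact/psiOb/U1Om.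
have sgt : smooth_on U1 (fun z => tg (tp z)).
  by apply: (smooth_on_comp oU1 oOb _ (stg Ob oOb) stp1) => z [].
have jc : mjeq m y (fun z => g (psi z)) (fun z => tg (tp z)).
  move=> i j.
  apply: (jeq_comp (V := Ob) (f := fun z => g z i j) (f' := fun z => tg z i j) oU1 U1y oOb).
  - exact: sg.
  - exact: (stg Ob oOb).
  - exact: sp.
  - exact: stp1.
  - by move=> z Uz; exact/psiOb/U1Om.
  - by move=> z [].
  - exact: jg.
  - exact: mjeq_weak jp.
have := mjeq_conj oU1 U1y sJp sJt sgp sgt upsi jJ jc.
pose U2 := [set z | U1 z /\ jacobian psi z \in unitmx].
have oU2 : open U2 := open_unitmx oU1 sJp.
have U2y : U2 y := conj U1y upsi.
have E1 : mjeq m y f (fun z => jacobian psi z *m g (psi z) *m invmx (jacobian psi z)).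
  apply: (mjeq_on oU2 U2y) => z [[Omz _] uz].
  by rewrite -fpsi // mulmxK.
have E2 : mjeq m y (fun z => jacobian tp z *m tg (tp z) *m invmx (jacobian tp z))
    (fun z => pulled_back (row_mx z u)).
  apply: (mjeq_on oU1 U1y) => z _.
  by rewrite /pulled_back map_jacobianE model_polyE -/tp tpy.
by move=> E; exact: mjeq_trans E1 (mjeq_trans E E2).
Qed.

End parametrization.

(** * Dimension count *)

Section counting.

Lemma sum4n (f : 'I_4 -> nat) :
  (\sum_i f i = f (inord 0) + f (inord 1) + f (inord 2) + f (inord 3))%N.
Proof.
rewrite !big_ord_recr big_ord0 /= add0n.
by congr (f _ + f _ + f _ + f _)%N; apply: val_inj; rewrite /= inordK.
Qed.

(** A multi-index of order exactly [m.+1] is determined by its first three entries, each less than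
    [m.+2]. Passing from m-jets to (m+1)-jets thus costs only a cubic term. *)
Lemma card_multi_indexS m :
  (#|{: multi_index 4 m.+1}| <= #|{: multi_index 4 m}| + m.+2 ^ 3)%N.
Proof.
pose f (a : multi_index 4 m.+1) : multi_index 4 m + 'I_m.+2 * 'I_m.+2 * 'I_m.+2 :=
  let r := inr (val a (inord 0), val a (inord 1), val a (inord 2)) in
  if (\sum_i val a i <= m)%N then
    if insub [ffun i => inord (val a i) : 'I_m.+1] is Some x then inl x else r
  else r.
have finj : injective f.
  move=> a a'; rewrite /f.
  have le (b : multi_index 4 m.+1) i : (\sum_i val b i <= m)%N -> (val b i < m.+1)%N.
    by move=> bm; rewrite ltnS (leq_trans _ bm) // (bigD1 i) //= leq_addr.
  have sub (b : multi_index 4 m.+1) : (\sum_i val b i <= m)%N ->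
      exists2 x : multi_index 4 m, insub [ffun i => inord (val b i) : 'I_m.+1] = Some x &
        forall i, val x i = val b i :> nat.
    move=> bm; case: insubP => [x _ xE|/negP[]].
      by exists x => // i; rewrite xE ffunE inordK // le.
    rewrite (leq_trans _ bm) //; apply: leq_sum => i _.
    by rewrite ffunE inordK // le.
  case: ifP => am; case: ifP => am'.
  - have [x -> xE] := sub _ am; have [x' -> xE'] := sub _ am'.
    move=> [xx]; apply/val_inj/ffunP => i; apply: val_inj.
    by rewrite /= -xE xx xE'.
  - by have [x -> _] := sub _ am.
  - by have [x' -> _] := sub _ am'.
  move=> [/(congr1 val) /= e0 /(congr1 val) /= e1 /(congr1 val) /= e2].
  have tot (b : multi_index 4 m.+1) : (\sum_i val b i <= m)%N = false ->
      (\sum_i val b i = m.+1)%N.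
    move=> bm; apply/eqP; rewrite eqn_leq (valP b) /=.
    by rewrite ltnNge bm.
  have e3 : val a (inord 3) = val a' (inord 3) :> nat.
    have E := etrans (tot _ am) (esym (tot _ am')); rewrite !sum4n in E.
    by move: E; rewrite [X in (X + _ + _ + _)%N]e0 [X in (_ + X + _ + _)%N]e1 [X in (_ + _ + X + _)%N]e2 => /addnI.
  by apply/val_inj/ffunP; elim/ord4P; apply: val_inj.
have := leq_card f finj.
by rewrite card_sum !card_prod !card_ord !expnS expn0 muln1 mulnA.
Qed.

(** Four entries of at most [m %/ 4] have sum at most [m]: a cube inside the simplex already gives
    growth of degree 4. *)
Lemma card_multi_index_lower m : ((m %/ 4).+1 ^ 4 <= #|{: multi_index 4 m}|)%N.
Proof.
have le (g : {ffun 'I_4 -> 'I_(m %/ 4).+1}) i : (g i < m.+1)%N.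
  by rewrite ltnS (leq_trans (_ : _ <= m %/ 4)%N) ?leq_div // -ltnS.
pose h (g : {ffun 'I_4 -> 'I_(m %/ 4).+1}) : {ffun 'I_4 -> 'I_m.+1} :=
  [ffun i => Ordinal (le g i)].
have hP g : (\sum_(i < 4) h g i <= m)%N.
  rewrite (@leq_trans (\sum_(i < 4) m %/ 4)%N) //.
    by apply: leq_sum => i _; rewrite ffunE /= -ltnS.
  by rewrite sum_nat_const card_ord mulnC leq_trunc_div.
pose f g : multi_index 4 m := Sub (h g) (hP g).
have finj : injective f.
  move=> g g' /(congr1 val); rewrite !SubK => /ffunP gg.
  apply/ffunP => i; apply: val_inj.
  by have := congr1 val (gg i); rewrite !ffunE.
have := leq_card f finj.
by rewrite card_ffun !card_ord.
Qed.

(** The two fiber entries are 0 or 1, so reading them in ['I_2] is injective; the other two are less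
    than [m.+1]. *)
Lemma card_almost_horizontal m :
  (#|[pred a : multi_index 4 m | almost_horizontal a]| <= 4 * m.+1 ^ 2)%N.
Proof.
pose f (a : multi_index 4 m) : 'I_m.+1 * 'I_m.+1 * 'I_2 * 'I_2 :=
  (val a (inord 0), val a (inord 1), inord (val a (inord 2)), inord (val a (inord 3))).
have le1 (a : multi_index 4 m) (k : 'I_4) : almost_horizontal a -> (2 <= k)%N -> (val a k < 2)%N.
  move=> ha k2; rewrite ltnS -count_word (leq_trans _ ha) //.
  by apply: sub_count => i /= /eqP->.
have finj : {in [pred a : multi_index 4 m | almost_horizontal a] &, injective f}.
  move=> a a' ha ha' [/(congr1 val) /= e0 /(congr1 val) /= e1 e2 e3].
  have := congr1 val e2; rewrite /= !inordK ?le1 ?inordK // => {}e2.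
  have := congr1 val e3; rewrite /= !inordK ?le1 ?inordK // => {}e3.
  by apply/val_inj/ffunP; elim/ord4P; apply: val_inj.
rewrite -(card_in_imset finj) (leq_trans (max_card _)) //.
by rewrite !card_prod !card_ord expnS expn1; lia.
Qed.

Lemma tangential_almost_horizontal m (a : multi_index 4 m) :
  tangential a -> almost_horizontal a.
Proof.
move=> ta; rewrite /almost_horizontal (_ : count _ _ = 0)%N //.
apply/eqP; rewrite -leqn0 leqNgt -has_count; apply/hasPn => i ia.
by rewrite /vertical /= -ltnNge; exact: tangential_word ta ia.
Qed.

(** Only entries at tangential multi-indices are constrained. They are bounded by all 8 entries at
    the almost horizontal multi-indices, whence [32 = 8 * 4]. *)
Lemma card_free_index m :
  (8 * #|{: multi_index 4 m}| <= #|free_index (m := m)| + 32 * m.+1 ^ 2)%N.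
Proof.
have F : #|free_index (m := m)| = #|[pred x | free_coord (m := m) x]| := card_sig _.
have := cardC (free_coord (m := m)); rewrite !card_prod !card_ord => E.
have B : (#|[predC (free_coord (m := m))]| <= 8 * (4 * m.+1 ^ 2))%N.
  pose Q := [pred a : multi_index 4 m | almost_horizontal a].
  apply: (@leq_trans #|[predX Q & predX 'I_2 'I_4]|); last first.
    rewrite cardX cardX !card_ord mulnC; apply: leq_mul => //.
    exact: card_almost_horizontal.
  apply: subset_leq_card; apply/fintype.subsetP => -[a [i l]].
  rewrite !inE /free_coord negbK /= => /and3P[_ _ ta].
  by rewrite (tangential_almost_horizontal ta).
have {}F : #|free_index (m := m)| = #|free_coord (m := m)|.
  by rewrite F; apply: eq_card => x; rewrite inE.
rewrite F; move: B E.
move: #|free_coord (m := m)| #|[predC (free_coord (m := m))]| #|{: multi_index 4 m}| (m.+1 ^ 2)%N.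
by move=> x y n p; lia.
Qed.

Lemma card_model_index m : (#|model_index (m := m)| <= 64 * m.+1 ^ 2)%N.
Proof.
rewrite card_sig.
pose Q := [pred a : multi_index 4 m | almost_horizontal a].
apply: (@leq_trans #|[predX Q & predX 'I_4 'I_4]|).
  apply: subset_leq_card; apply/fintype.subsetP => -[a [i l]].
  by rewrite !inE /= => ->.
rewrite cardX cardX !card_ord.
have : (#|Q| <= 4 * m.+1 ^ 2)%N := card_almost_horizontal m.
by move: #|Q| (m.+1 ^ 2)%N => a b; lia.
Qed.

Lemma dimension_gap k : \forall m \near \oo,
  (#|map_index (m := m)| + #|model_index (m := m)| + k <= #|free_index (m := m)|)%N.
Proof.
near=> m.
have h1 := card_multi_indexS m; have h2 := card_multi_index_lower m.
have h3 := card_free_index m; have h4 := card_model_index m.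
rewrite card_prod card_ord.
pose q := (m %/ 4)%N.+1.
have mq : (m < 4 * q)%N by rewrite /q; lia.
(* After cancelling the leading terms, [4 * #|{: multi_index 4 m}|], at least [4 * q ^ 4], has to
   exceed [4 * m.+2 ^ 3 + (64 + 32) * m.+1 ^ 2 + k]. In terms of [q ^ 3] the first two summands are
   at most [4 * 125 + 96 * 16 = 2036], which is less than [4 * 600]. *)
have qk : (600 + k <= q)%N.
  have : (4 * (600 + k) <= m)%N by near: m; exact: nbhs_infty_ge.
  by rewrite /q; lia.
rewrite -/q in h2.
have a1 : (m.+2 ^ 3 <= 125 * q ^ 3)%N.
  by rewrite -(@expnMn 5 q 3) leq_exp2r //; lia.
have a2 : (m.+1 ^ 2 <= 16 * q ^ 2)%N.
  by rewrite -(@expnMn 4 q 2) leq_exp2r //; lia.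
have a3 : (600 * q ^ 3 + k * q ^ 3 <= q ^ 4)%N.
  by rewrite -mulnDl (expnS q 3) leq_mul2r qk orbT.
have a4 : (q ^ 2 <= q ^ 3)%N by rewrite leq_exp2l //; lia.
have a5 : (1 <= q ^ 3)%N by rewrite expn_gt0 /q.
have a6 : (k <= k * q ^ 3)%N by rewrite leq_pmulr.
move: h1 h2 h3 h4 a1 a2 a3 a4 a5 a6.
move: #|{: multi_index 4 m.+1}| #|{: multi_index 4 m}| #|free_index (m := m)|.
move: #|model_index (m := m)| (m.+2 ^ 3)%N (m.+1 ^ 2)%N (q ^ 2)%N (k * q ^ 3)%N (q ^ 3)%N.
by move: (q ^ 4)%N => a b c d e p l n o r; lia.
Unshelve. all: by end_near. Qed.

End counting.

Theorem proposition23 (R : realType) (M : Type) (A : set (chart R 4 M))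
    (L : set M) (hM : smooth_manifold A) (hL : surface A L) :
  infinite_codimension A L
    (fun J => exists2 Jc : endo R 4 (nbpoint R M),
       is_NBII A L J Jc & germ_isomorphic A L J Jc).
Proof.
move=> x c Lx ac cx; have [Ac cL] := ac.
have y0 : snd2 (fwd c x) = 0 by exact/cL.
(* The exceptional set has to lie in [ac_jets], hence the intersection; its dimension is bounded
   through the image of [param]. *)
exists (fun m => ac_jets A L c x `&` (param (m := m) (fwd c x) @` param_dom (fwd c x))).
split=> [m u []//|m J aJ pJ [Jc nJ gJ]|k].
  split.
    by exists setT, J; split=> //; exact: mopen_setT.
  have [Om [Ob [psi [g [[oOm Omx] oOb spsi sg [psiOb upsi fpsi g0]]]]]] :=
    germ_local_form hM hL Ac cx Lx nJ gJ.
  have [u ud uE] := jet_in_param (m := m) oOm Omx oOb spsi sg psiOb upsi fpsi g0.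
  by exists u => //; rewrite -uE -jetE.
have := dimension_gap k; apply: filterS => m gap.
exists #|free_index (m := m)|, (#|map_index (m := m)| + #|model_index (m := m)|)%N; split.
- rewrite (ac_jets_local hM m ac cx Lx); exact: submanifold_local_jets.
(* The countable family of charts is constant: a single open domain carries the whole
   parametrization. *)
- exists (fun=> param_dom (fwd c x)), (fun=> param (fwd c x)); split.
    by move=> _; split; [exact: open_param_dom|exact: smooth_param].
  by move=> u [_ pu]; exists 0%N.
- exact: gap.
Qed.
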